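(* Let $g:\mathbb{C}\to\mathbb{C}$ be an entire function with $g(0)\neq 0$, let $(\zeta_k)_k$ be an enumeration of the distinct zeros of $g$ (a finite, possibly empty, or countably infinite family), and let $\pi_n(x)=p_n(nx)$ be the rescaled Appell polynomials associated with $g$. Let $n\ge 0$ be an integer and $x\in\mathbb{C}\setminus\{0\}$. For each $k$ put $$\theta_k=\mathrm{Arg}(x\zeta_k)-i\log|x\zeta_k| .$$ Assume that every $\theta_k$ with $\mathrm{Im}(\theta_k)=0$ is a simple zero of the function $\theta\mapsto g(e^{i\theta}/x)$. Then $$\frac{\pi_n(x)}{n!}=\frac{x^n}{2\pi}\left(\mathrm{PV}\int_{-\pi}^{\pi}\frac{e^{n(e^{i\theta}-i\theta)}}{g(e^{i\theta}/x)}\,d\theta-2\pi i\sum_{k}\Theta\big(\mathrm{Im}(\theta_k)\big)\,\mathrm{Res}\left(\frac{e^{n(e^{i\theta}-i\theta)}}{g(e^{i\theta}/x)};\theta=\theta_k\right)\right).$$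
   Context: The Appell polynomials $p_n$, $n=0,1,2,\dots$, associated with an entire function $g$ with $g(0)\ne 0$ are defined by $\sum_{n\ge 0}p_n(x)\frac{z^n}{n!}=\frac{e^{zx}}{g(z)}$ (Taylor expansion in $z$ about $z=0$), i.e. $p_n(x)=n!\,[z^n]\,\frac{e^{xz}}{g(z)}$. The rescaled Appell polynomials are $\pi_n(x)=p_n(nx)$. $\mathrm{Arg}(z)\in(-\pi,\pi]$ denotes the principal argument. The points $\theta_k$ are exactly the zeros of $\theta\mapsto g(e^{i\theta}/x)$ in the strip $\mathrm{Re}(\theta)\in(-\pi,\pi]$. The function $\Theta:\mathbb{R}\to\mathbb{R}$ is $\Theta(t)=1$ if $t>0$, $\Theta(0)=1/2$, $\Theta(t)=0$ if $t<0$. (Since $\mathrm{Im}(\theta_k)=-\log|x\zeta_k|$, only the finitely many $k$ with $|x\zeta_k|\le 1$ contribute.) $\mathrm{Res}(f;\theta=\theta_k)$ is the residue of $f$, as a function of the complex variable $\theta$, at $\theta_k$. $\mathrm{PV}$ denotes the Cauchy principal value at the (simple) poles of the integrand on the real axis, an ordinary integral if there are none. As the integrand is $2\pi$-periodic, if it has a pole at $\theta=\pm\pi$ then $\mathrm{PV}\int_{-\pi}^{\pi}$ means $\mathrm{PV}\int_{a}^{a+2\pi}$ for any real $a$ such that $a$ is not a pole. *)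

(* Defs.v *)
From Stdlib Require Import Reals Factorial List ClassicalEpsilon Lra.
From Coquelicot Require Import Coquelicot.
Open Scope C_scope.

Definition Cexp (z : C) : C :=
  ((exp (Re z) * cos (Im z))%R, (exp (Re z) * sin (Im z))%R).

(* Principal argument, with values in (-PI, PI]; arbitrary at 0. *)
Definition Carg (z : C) : R :=
  if Rle_dec 0 (Im z) then acos (Re z / Cmod z) else (- acos (Re z / Cmod z))%R.

Definition entire (g : C -> C) : Prop :=
  forall z : C, ex_derive (K := C_AbsRing) (V := C_NormedModule) g z.

(* [a] is the sequence of Taylor coefficients of [f] about 0. *)
Definition is_taylor (f : C -> C) (a : nat -> C) : Prop :=
  exists r : R, (0 < r)%R /\
    forall z : C, (Cmod z < r)%R ->
      is_pseries (K := C_AbsRing) (V := C_NormedModule) a z (f z).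

Definition taylor_coef (f : C -> C) (n : nat) : C :=
  iota (T := C_CompleteNormedModule)
    (fun c : C => exists a : nat -> C, is_taylor f a /\ a n = c).

Definition appell (g : C -> C) (n : nat) (x : C) : C :=
  RtoC (INR (fact n)) * taylor_coef (fun z : C => Cexp (z * x) / g z) n.

Definition rescaled_appell (g : C -> C) (n : nat) (x : C) : C :=
  appell g n (RtoC (INR n) * x).

Definition is_simple_zero (f : C -> C) (a : C) : Prop :=
  f a = 0 /\
  exists l : C, is_derive (K := C_AbsRing) (V := C_NormedModule) f a l /\ l <> 0.

(* Laurent expansion of [f] on a punctured disc centred at [a]:
   [p j] is the coefficient of (z - a)^j and [q j] that of (z - a)^(-j-1). *)
Definition is_laurent (f : C -> C) (a : C) (p q : nat -> C) : Prop :=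
  exists r : R, (0 < r)%R /\
    forall z : C, (0 < Cmod (z - a) < r)%R ->
      exists s t : C,
        is_pseries (K := C_AbsRing) (V := C_NormedModule) p (z - a) s /\
        is_pseries (K := C_AbsRing) (V := C_NormedModule) q (/ (z - a)) t /\
        f z = s + t / (z - a).

Definition is_residue (f : C -> C) (a c : C) : Prop :=
  exists p q : nat -> C, is_laurent f a p q /\ q 0%nat = c.

Definition Residue (f : C -> C) (a : C) : C :=
  iota (T := C_CompleteNormedModule) (is_residue f a).

Definition is_pole (f : C -> C) (a : C) : Prop :=
  filterlim (fun z : C => Cmod (f z)) (locally' (T := C_UniformSpace) a)
    (Rbar_locally p_infty).

(* [f] restricted to the real axis, set to 0 at distance less than [eps] from
   the real poles of [f]: its integral over [a, b] is that of [f] over [a, b]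
   minus the eps-neighbourhoods of the poles. *)
Definition excise (f : C -> C) (eps t : R) : C :=
  if excluded_middle_informative
       (exists s : R, is_pole f (RtoC s) /\ (Rabs (t - s) < eps)%R)
  then 0 else f (RtoC t).

(* Meaningful only when neither end point [a], [b] is a pole of [f]. *)
Definition is_PV_RInt (f : C -> C) (a b : R) (l : C) : Prop :=
  filterlimi
    (fun eps : R => is_RInt (V := C_R_NormedModule) (excise f eps) a b)
    (at_right 0) (locally (T := C_UniformSpace) l).

(* Principal value over one period of a 2*PI-periodic [f]; the interval may
   start at any real point which is not a pole, in particular at -PI when the
   latter is not a pole. *)
Definition is_PV_period (f : C -> C) (l : C) : Prop :=
  forall a : R, ~ is_pole f (RtoC a) -> is_PV_RInt f a (a + 2 * PI) l.

(* [s] is the sum of the finitely many nonzero terms of the family [f]. *)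
Definition is_finite_support_sum (K : Type) (f : K -> C) (s : C) : Prop :=
  exists l : list K,
    NoDup l /\ (forall k : K, f k <> 0 -> In k l) /\
    s = fold_right Cplus 0 (map f l).

Definition Theta (t : R) : R :=
  if Rlt_dec 0 t then 1%R else if Req_EM_T t 0 then (1 / 2)%R else 0%R.

Definition theta_pt (x zeta : C) : C :=
  RtoC (Carg (x * zeta)) - Ci * RtoC (ln (Cmod (x * zeta))).

Definition integrand (g : C -> C) (n : nat) (x theta : C) : C :=
  Cexp (RtoC (INR n) * (Cexp (Ci * theta) - Ci * theta))
  / g (Cexp (Ci * theta) / x).

Local Open Scope R_scope.

Lemma Re_div_Cmod_bound (z : C) : z <> 0%C -> (-1 <= Re z / Cmod z <= 1)%R.
Proof.
intros Hz. pose proof (proj1 (Cmod_gt_0 z) Hz) as Hm.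
assert (E : (Rabs (Re z / Cmod z) <= 1)%R).
{ rewrite Rabs_div; [|lra]. rewrite (Rabs_pos_eq (Cmod z)); [|lra].
  apply (Rmult_le_reg_r (Cmod z)); [lra|]. field_simplify; [|lra].
  apply re_le_Cmod. }
apply Rabs_le_between in E. lra.
Qed.

Lemma Carg_bound (z : C) : z <> 0%C -> - PI < Carg z <= PI.
Proof.
intros Hz. pose proof PI_RGT_0. pose proof (proj1 (Cmod_gt_0 z) Hz) as Hm.
unfold Carg. destruct (acos_bound (Re z / Cmod z)) as [h0 h1].
destruct (Rle_dec 0 (Im z)) as [h|h]; [lra|].
split; [|lra]. apply Ropp_lt_contravar. destruct h1 as [h1|h1]; [exact h1|exfalso].
pose proof (Re_div_Cmod_bound z Hz) as Hr.
pose proof (cos_acos _ Hr) as E. rewrite h1, cos_PI in E.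
assert (E2 : Re z = - Cmod z). { apply (Rmult_eq_reg_r (/ Cmod z)); [|apply Rinv_neq_0_compat; lra]. unfold Rdiv in E. rewrite <- E. field. lra. }
pose proof (Cmod2_alt z) as E3. rewrite E2 in E3. simpl in E3.
assert (Im z * Im z = 0) by lra. apply Rmult_integral in H0. lra.
Qed.

Lemma Carg_polar (z : C) : z <> 0%C -> z = (RtoC (Cmod z) * Cexp (Ci * RtoC (Carg z)))%C.
Proof.
intros Hz. pose proof (proj1 (Cmod_gt_0 z) Hz) as Hm.
pose proof (Re_div_Cmod_bound z Hz) as Hr.
assert (S : sqrt (1 - Rsqr (Re z / Cmod z)) = Rabs (Im z) / Cmod z).
{ replace (1 - Rsqr (Re z / Cmod z)) with (Rsqr (Im z / Cmod z)).
  - rewrite sqrt_Rsqr_abs, Rabs_div; [|lra]. rewrite (Rabs_pos_eq (Cmod z)); lra.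
  - pose proof (Cmod2_alt z) as E. unfold Rsqr. apply (Rmult_eq_reg_r (Cmod z ^ 2)); [|nra].
    field_simplify; [|lra|lra]. nra. }
unfold Cexp. rewrite (Cmult_comm Ci), re_mult_Ci, im_RtoC, Ropp_0, exp_0.
replace (Im (RtoC (Carg z) * Ci)) with (Carg z) by (unfold Im, Cmult; simpl; ring).
unfold Carg. destruct (Rle_dec 0 (Im z)) as [h|h].
- rewrite cos_acos, sin_acos, S, Rabs_pos_eq by assumption.
  destruct z as [a b]; unfold Re, Im, Cmult in *; simpl in *. f_equal; field; lra.
- rewrite cos_neg, sin_neg, cos_acos, sin_acos, S, Rabs_left by (assumption || lra).
  destruct z as [a b]; unfold Re, Im, Cmult in *; simpl in *. f_equal; field; lra.
Qed.

(* Main.v *)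
(* Put G(w) = g(w/x) and w = e^{i theta}, so that the integrand is w^{-n} f(w) with
   f(w) = e^{n w} / G(w), and pi_n(x) / n! = x^n [w^n] f(w).  On a disc |w| < R with R > 1,
   f has finitely many poles, all in |w| <= 1, and can be written as
     f(w) = B(w) + w^{n+1} (sum_a c_a / (w - a) + V'(w)),
   with B holomorphic, a running over the distinct poles and V a rational function
   collecting the higher order poles.  Then
   - [w^n] f = [w^n] B;
   - the integrals of w V'(w) = -i d/dtheta V(e^{i theta}), over a period as well as over a small
     circle around theta_k, vanish;
   - the residue of w / (w - a) at theta_k, where e^{i theta_k} = a, is -i, while its
     (principal value) integral over a period is 2 pi if |a| < 1 and pi if |a| = 1, because
     e^{it} / (e^{it} - e^{is}) = 1/2 - (i/2) cot((t - s)/2).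
   So both sides equal x^n [w^n] B. *)
Require Import Defs.
From Stdlib Require Import Reals Factorial.
From Stdlib Require Import ZArith List ClassicalEpsilon FunctionalExtensionality Lra Lia.
From Coquelicot Require Import Coquelicot.
Open Scope C_scope.

(** * Continuity and complex differentiability *)

(** Subtracting the poles, rather than indenting a contour at those on the path, leaves only full
    circles as contours, so one analytic tool suffices: the mean of a function over a circle. Taylor
    coefficients, residues and their uniqueness are all read off such means. Cauchy's formula comes
    from the mean of [w * phi w], where [phi] is the difference quotient of [f] at [z]; at that
    stage [phi] is only known to be continuous at [z], whence a mean value property that tolerates
    one circle without differentiability. In the power w^(n+1), n factors cancel w^(-n) and the last
    one turns c/(w - a) into c w/(w - a), whose mean does not depend on a for |a| < 1. The same
    power leaves the n-th coefficient at 0 untouched, because no pole lies at 0. A multiple pole on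
    the unit circle would put a singularity of V' on the path of integration; the simplicity
    assumption excludes exactly this. Finiteness of the poles, with multiplicity, comes from a
    Jensen-type count. *)

Notation Clim f F y := (filterlim f F (locally (T := C_UniformSpace) y)).
Notation Ccont f z :=
  (continuous (T := C_UniformSpace) (U := C_UniformSpace) f z).
Notation Rcont f t := (continuous (U := C_UniformSpace) (f : R -> C) t).

Lemma sqrt2_le_2 : (sqrt 2 <= 2)%R.
Proof.
replace 2%R with (sqrt (2 * 2)) at 2 by (apply sqrt_square; lra).
apply sqrt_le_1_alt; lra.
Qed.

Lemma C_ball_Cmod (x y : C) (eps : posreal) :
  (Cmod (y - x) < eps)%R -> ball (M := C_UniformSpace) x eps y.
Proof. exact (C_NormedModule_mixin_compat1 x y eps). Qed.

(** Balls of [C_UniformSpace] are boxes of the product structure; the modulus exceeds the box radius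
    by a factor of at most sqrt 2, rounded up to 2 to keep later constants rational. *)
Lemma Cmod_C_ball (x y : C) (eps : posreal) :
  ball (M := C_UniformSpace) x eps y -> (Cmod (y - x) < 2 * eps)%R.
Proof.
intros H. eapply Rlt_le_trans; [exact (C_NormedModule_mixin_compat2 x y eps H)|].
apply Rmult_le_compat_r; [apply Rlt_le, cond_pos|].
apply sqrt2_le_2.
Qed.

Lemma filterlim_C {T : Type} (F : (T -> Prop) -> Prop) {FF : Filter F}
  (f : T -> C) (y : C) :
  Clim f F y <-> forall eps : R, (0 < eps)%R -> F (fun x => (Cmod (f x - y) < eps)%R).
Proof.
split; intros H.
- intros eps He.
  assert (He2 : (0 < eps / 2)%R) by lra.
  generalize (proj1 (filterlim_locally f y) H (mkposreal _ He2)).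
  apply filter_imp. intros x Hx. apply Cmod_C_ball in Hx. simpl in Hx. lra.
- apply (filterlim_locally f y). intros eps.
  generalize (H eps (cond_pos eps)). apply filter_imp. intros x. apply C_ball_Cmod.
Qed.

Lemma locally_C_Cmod (z : C) (P : C -> Prop) :
  locally (T := C_UniformSpace) z P <->
  exists d : R, (0 < d)%R /\ forall w, (Cmod (w - z) < d)%R -> P w.
Proof.
split.
- intros [e He]. exists e. split; [apply cond_pos|].
  intros w Hw. apply He, C_ball_Cmod, Hw.
- intros [d [Hd H]]. assert (Hd2 : (0 < d / 2)%R) by lra.
  exists (mkposreal _ Hd2). intros w Hw. apply H. apply Cmod_C_ball in Hw. simpl in Hw; lra.
Qed.

Lemma Ccont_eps (f : C -> C) (z : C) :
  Ccont f z <-> forall eps : R, (0 < eps)%R -> exists d : R, (0 < d)%R /\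
    forall w, (Cmod (w - z) < d)%R -> (Cmod (f w - f z) < eps)%R.
Proof.
split.
- intros H eps He. apply locally_C_Cmod. apply (proj1 (filterlim_C _ _ _) H eps He).
- intros H. apply (filterlim_C _ _ _). intros eps He. apply locally_C_Cmod, (H eps He).
Qed.

Lemma Rcont_eps (f : R -> C) (t : R) :
  Rcont f t <-> forall eps : R, (0 < eps)%R -> exists d : R, (0 < d)%R /\
    forall s, (Rabs (s - t) < d)%R -> (Cmod (f s - f t) < eps)%R.
Proof.
split.
- intros H eps He.
  destruct (proj1 (filterlim_C _ _ _) H eps He) as [d Hd]. exists d. split; [apply cond_pos|]. exact Hd.
- intros H. apply (filterlim_C _ _ _). intros eps He.
  destruct (H eps He) as [d [Hd H1]]. exists (mkposreal d Hd). exact H1.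
Qed.

Lemma Clim_plus {T} (F : (T -> Prop) -> Prop) {FF : Filter F} (f g : T -> C) (a b : C) :
  Clim f F a -> Clim g F b -> Clim (fun x => f x + g x) F (a + b).
Proof.
rewrite !(filterlim_C F). intros Hf Hg eps He.
assert (He2 : (0 < eps / 2)%R) by lra.
generalize (filter_and _ _ (Hf _ He2) (Hg _ He2)). apply filter_imp. intros x [H1 H2].
replace (f x + g x - (a + b)) with ((f x - a) + (g x - b)) by ring.
eapply Rle_lt_trans; [apply Cmod_triangle|]. lra.
Qed.

Lemma Clim_mult {T} (F : (T -> Prop) -> Prop) {FF : Filter F} (f g : T -> C) (a b : C) :
  Clim f F a -> Clim g F b -> Clim (fun x => f x * g x) F (a * b).
Proof.
rewrite !(filterlim_C F). intros Hf Hg eps He.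
set (M := (1 + Cmod a + Cmod b)%R).
assert (HM : (1 <= M)%R).
{ unfold M. pose proof (Cmod_ge_0 a); pose proof (Cmod_ge_0 b); lra. }
set (e := Rmin 1 (eps / (2 * M))).
assert (Hq : (0 < eps / (2 * M))%R) by (apply Rdiv_lt_0_compat; lra).
assert (He0 : (0 < e)%R) by (apply Rmin_glb_lt; lra).
generalize (filter_and _ _ (Hf e He0) (Hg e He0)). apply filter_imp. intros x [H1 H2].
replace (f x * g x - a * b) with ((f x - a) * (g x - b) + ((f x - a) * b + a * (g x - b))) by ring.
assert (E1 : (e <= 1)%R) by apply Rmin_l.
assert (E2 : (e * M <= eps / 2)%R).
{ apply Rle_trans with (eps / (2 * M) * M)%R.
  - apply Rmult_le_compat_r; [lra|apply Rmin_r].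
  - right. field. lra. }
eapply Rle_lt_trans; [apply Cmod_triangle|].
eapply Rle_lt_trans; [apply Rplus_le_compat_l, Cmod_triangle|].
rewrite !Cmod_mult.
pose proof (Cmod_ge_0 (f x - a)); pose proof (Cmod_ge_0 (g x - b)).
pose proof (Cmod_ge_0 a); pose proof (Cmod_ge_0 b).
unfold M in E2. nra.
Qed.

Lemma Clim_inv {T} (F : (T -> Prop) -> Prop) {FF : Filter F} (f : T -> C) (a : C) :
  a <> 0 -> Clim f F a -> Clim (fun x => / f x) F (/ a).
Proof.
rewrite !(filterlim_C F). intros Ha Hf eps He.
assert (Hm : (0 < Cmod a)%R) by (apply Cmod_gt_0; exact Ha).
set (e := Rmin (Cmod a / 2) (eps * (Cmod a * Cmod a / 2))).
assert (He0 : (0 < e)%R).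
{ apply Rmin_glb_lt; [lra|]. apply Rmult_lt_0_compat; [lra|nra]. }
generalize (Hf e He0). apply filter_imp. intros x H1.
assert (E1 : (e <= Cmod a / 2)%R) by apply Rmin_l.
assert (E2 : (e <= eps * (Cmod a * Cmod a / 2))%R) by apply Rmin_r.
assert (H2 : (Cmod a / 2 < Cmod (f x))%R).
{ pose proof (Cmod_triangle (f x) (- (f x - a))) as H.
  rewrite Cmod_opp in H. replace (f x + - (f x - a)) with a in H by ring. lra. }
assert (Hx : f x <> 0) by (apply Cmod_gt_0; lra).
replace (/ f x - / a) with (- (f x - a) / (f x * a)) by (field; auto).
rewrite Cmod_div, Cmod_opp, Cmod_mult by (apply Cmult_neq_0; auto).
apply Rmult_lt_reg_r with (Cmod (f x) * Cmod a)%R; [nra|].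
unfold Rdiv. rewrite Rmult_assoc, Rinv_l by nra.
assert (Cmod a * Cmod a / 2 < Cmod (f x) * Cmod a)%R by nra. nra.
Qed.

Lemma Clim_const {T} (F : (T -> Prop) -> Prop) {FF : Filter F} (c : C) :
  Clim (fun _ : T => c) F c.
Proof. apply filterlim_const. Qed.

Lemma Clim_pow {T} (F : (T -> Prop) -> Prop) {FF : Filter F} (f : T -> C) (a : C) (n : nat) :
  Clim f F a -> Clim (fun x => f x ^ n) F (a ^ n).
Proof.
intros H. induction n as [|n IH]; simpl.
- apply Clim_const; auto.
- apply Clim_mult; auto.
Qed.

Lemma pow_eventually_small (q eps : R) : (0 <= q < 1)%R -> (0 < eps)%R ->
  exists N : nat, forall k, (N <= k)%nat -> (q ^ k < eps)%R.
Proof.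
intros Hq He. destruct (pow_lt_1_zero q) with (y := eps) as [N HN]; auto.
- rewrite Rabs_pos_eq; lra.
- exists N. intros k Hk. specialize (HN k Hk).
  rewrite Rabs_pos_eq in HN; auto. apply pow_le; lra.
Qed.

(** * Differentiability in Carathéodory's form *)

(** The difference quotient extends continuously to [z]. In this form the product and chain rules
    are algebra on [phi], and the same [phi] later serves as the kernel in Cauchy's formula. *)
Definition Caratheodory (f : C -> C) (z d : C) : Prop :=
  exists phi : C -> C, Ccont phi z /\ phi z = d /\
    forall w, f w = f z + (w - z) * phi w.

Notation Cderive f z d :=
  (is_derive (K := C_AbsRing) (V := C_NormedModule) (f : C -> C) (z : C) (d : C)).
Notation Cex f z := (ex_derive (K := C_AbsRing) (V := C_NormedModule) (f : C -> C) (z : C)).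

(** The filter of [is_derive] over [C_AbsRing] consists of modulus balls, so here, unlike in
    [Cmod_C_ball], no constant is lost. *)
Lemma is_derive_C_eps (f : C -> C) (z d : C) :
  Cderive f z d <-> forall eps : R, (0 < eps)%R -> exists r : R, (0 < r)%R /\
    forall w, (Cmod (w - z) < r)%R ->
      (Cmod (f w - f z - (w - z) * d) <= eps * Cmod (w - z))%R.
Proof.
split.
- intros [_ H] eps He.
  destruct (H z (fun P HP => HP) (mkposreal eps He)) as [r Hr].
  exists r. split; [apply cond_pos|]. intros w Hw. exact (Hr w Hw).
- intros H. split.
  + apply (is_linear_scal_l (K := C_AbsRing) (V := C_NormedModule) d).
  + intros x Hx eps.
    apply (is_filter_lim_locally_unique (K := C_AbsRing) (V := AbsRing_NormedModule C_AbsRing)) in Hx.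
    rewrite <- Hx. destruct (H eps (cond_pos eps)) as [r [Hr H1]].
    exists (mkposreal r Hr). intros w Hw. exact (H1 w Hw).
Qed.

Lemma Caratheodory_is_derive (f : C -> C) (z d : C) : Cderive f z d <-> Caratheodory f z d.
Proof.
rewrite is_derive_C_eps. split.
- intros H.
  exists (fun w => if excluded_middle_informative (w = z) then d else (f w - f z) / (w - z)).
  assert (E : forall w, f w = f z + (w - z) *
    (if excluded_middle_informative (w = z) then d else (f w - f z) / (w - z))).
  { intros w. destruct (excluded_middle_informative (w = z)) as [->|Hw].
    - ring.
    - field. intros K. apply Hw. replace w with (w - z + z) by ring. rewrite K. ring. }
  repeat split; [|now destruct (excluded_middle_informative (z = z))|exact E].
  apply Ccont_eps. intros eps He.
  destruct (H (eps / 2)%R) as [r [Hr H1]]; [lra|].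
  exists r. split; auto. intros w Hw.
  destruct (excluded_middle_informative (z = z)) as [_|K]; [|congruence].
  destruct (excluded_middle_informative (w = z)) as [Hwz|Hwz].
  + replace (d - d) with (RtoC 0) by ring. rewrite Cmod_0. exact He.
  + assert (K : w - z <> 0).
    { intros K. apply Hwz. replace w with (w - z + z) by ring. rewrite K. ring. }
    replace ((f w - f z) / (w - z) - d) with ((f w - f z - (w - z) * d) / (w - z)) by (field; auto).
    rewrite Cmod_div by auto. specialize (H1 w Hw).
    apply Cmod_gt_0 in K.
    apply Rle_lt_trans with (eps / 2)%R; [|lra].
    apply Rmult_le_reg_r with (Cmod (w - z)); auto.
    unfold Rdiv. rewrite Rmult_assoc, Rinv_l by lra. unfold Rdiv in H1; lra.
- intros [phi [Hc [Hz Hf]]] eps He.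
  destruct (proj1 (Ccont_eps _ _) Hc eps He) as [r [Hr H1]].
  exists r. split; auto. intros w Hw. rewrite (Hf w).
  replace (f z + (w - z) * phi w - f z - (w - z) * d) with ((phi w - phi z) * (w - z))
    by (rewrite Hz; ring).
  rewrite Cmod_mult. apply Rmult_le_compat_r; [apply Cmod_ge_0|]. apply Rlt_le, H1, Hw.
Qed.

Lemma Ccont_id (z : C) : Ccont (fun w : C => w) z.
Proof. apply continuous_id. Qed.

Lemma Ccont_const (c z : C) : Ccont (fun _ => c) z.
Proof. apply continuous_const. Qed.

Lemma Ccont_plus (f g : C -> C) z : Ccont f z -> Ccont g z -> Ccont (fun w => f w + g w) z.
Proof. apply Clim_plus, _. Qed.

Lemma Ccont_mult (f g : C -> C) z : Ccont f z -> Ccont g z -> Ccont (fun w => f w * g w) z.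
Proof. apply Clim_mult, _. Qed.

Lemma Ccont_ext (f g : C -> C) z : (forall w : C, f w = g w) -> Ccont f z -> Ccont g z.
Proof. intros H. apply continuous_ext, H. Qed.

Lemma Ccont_opp (f : C -> C) z : Ccont f z -> Ccont (fun w => - f w) z.
Proof.
intros H. apply (Ccont_ext (fun w => (- (1)) * f w)); [intros w; ring|].
apply Ccont_mult; [apply Ccont_const|exact H].
Qed.

Lemma Ccont_inv (f : C -> C) z : f z <> 0 -> Ccont f z -> Ccont (fun w => / f w) z.
Proof. apply Clim_inv, _. Qed.

Lemma Ccont_comp (f g : C -> C) z : Ccont f z -> Ccont g (f z) -> Ccont (fun w => g (f w)) z.
Proof. apply continuous_comp. Qed.

Lemma Cderive_Ccont (f : C -> C) (z d : C) : Cderive f z d -> Ccont f z.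
Proof.
intros H. apply Caratheodory_is_derive in H. destruct H as [phi [Hc [_ Hf]]].
apply (Ccont_ext (fun w => f z + (w - z) * phi w)); [intros w; symmetry; apply Hf|].
apply Ccont_plus; [apply Ccont_const|]. apply Ccont_mult; auto.
apply Ccont_plus; [apply Ccont_id|apply Ccont_const].
Qed.

Lemma Cex_Ccont (f : C -> C) (z : C) : Cex f z -> Ccont f z.
Proof. intros [d H]. exact (Cderive_Ccont f z d H). Qed.

Lemma Cderive_const (c z : C) : Cderive (fun _ => c) z 0.
Proof.
apply Caratheodory_is_derive. exists (fun _ => 0).
repeat split; [apply Ccont_const|intros w; ring].
Qed.

Lemma Cderive_id (z : C) : Cderive (fun w => w) z 1.
Proof.
apply Caratheodory_is_derive. exists (fun _ => 1).
repeat split; [apply Ccont_const|intros w; ring].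
Qed.

Lemma Cderive_plus (f g : C -> C) (z a b : C) :
  Cderive f z a -> Cderive g z b -> Cderive (fun w => f w + g w) z (a + b).
Proof. exact (@is_derive_plus C_AbsRing C_NormedModule f g z a b). Qed.

Lemma Cderive_mult (f g : C -> C) (z a b : C) :
  Cderive f z a -> Cderive g z b -> Cderive (fun w => f w * g w) z (a * g z + f z * b).
Proof.
rewrite !Caratheodory_is_derive. intros [p [Hp [<- Ep]]] [q [Hq [<- Eq]]].
exists (fun w => p w * g w + f z * q w). repeat split.
- apply Ccont_plus; apply Ccont_mult; [exact Hp| |apply Ccont_const|exact Hq].
  apply (Cderive_Ccont g z (q z)), Caratheodory_is_derive. exists q; auto.
- intros w. rewrite (Ep w), (Eq w). ring.
Qed.

Lemma Cderive_comp (f g : C -> C) (z a b : C) :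
  Cderive f z a -> Cderive g (f z) b -> Cderive (fun w => g (f w)) z (a * b).
Proof.
intros Hf Hg. pose proof (Cderive_Ccont _ _ _ Hf) as Cf.
rewrite !Caratheodory_is_derive in *. destruct Hf as [p [Hp [<- Ep]]], Hg as [q [Hq [<- Eq]]].
exists (fun w => p w * q (f w)). repeat split.
- apply Ccont_mult; [exact Hp|]. apply Ccont_comp; [exact Cf|exact Hq].
- intros w. rewrite (Eq (f w)). rewrite (Ep w) at 1. ring.
Qed.

Lemma Cderive_inv (f : C -> C) (z a : C) : f z <> 0 ->
  Cderive f z a -> Cderive (fun w => / f w) z (- a / (f z * f z)).
Proof.
intros Hz Hf. pose proof (Cderive_Ccont _ _ _ Hf) as Cf.
apply is_derive_C_eps. intros eps He.
(* Carathéodory's identity must hold for every w, also where [f w = 0]. This product satisfies it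
   everywhere, and it equals [/ f w - / f z] wherever [f w] is nonzero, in particular near z. *)
assert (H : Cderive (fun w => (/ f w) * (/ f z) * (f z - f w)) z (- a / (f z * f z))).
{ apply Caratheodory_is_derive in Hf. destruct Hf as [p [Hp [<- Ep]]].
  apply Caratheodory_is_derive. exists (fun w => (/ f w) * (/ f z) * (- p w)). split; [|split].
  - apply Ccont_mult; [apply Ccont_mult; [apply Ccont_inv; auto|apply Ccont_const]|].
    apply Ccont_opp, Hp.
  - field; auto.
  - intros w. assert (K : f z - f w = - ((w - z) * p w)) by (rewrite (Ep w); ring).
    rewrite K. ring. }
destruct (proj1 (is_derive_C_eps _ _ _) H eps He) as [r [Hr H1]].
assert (Hm : (0 < Cmod (f z))%R) by (apply Cmod_gt_0; auto).
destruct (proj1 (Ccont_eps _ _) Cf _ Hm) as [r' [Hr' H2]].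
exists (Rmin r r'). split; [apply Rmin_glb_lt; auto|].
intros w Hw.
assert (Hw1 : (Cmod (w - z) < r)%R) by (eapply Rlt_le_trans; [exact Hw|apply Rmin_l]).
assert (Hw2 : (Cmod (w - z) < r')%R) by (eapply Rlt_le_trans; [exact Hw|apply Rmin_r]).
specialize (H1 w Hw1). specialize (H2 w Hw2).
assert (Hfw : f w <> 0).
{ intros K. rewrite K in H2. replace (0 - f z) with (- f z) in H2 by ring.
  rewrite Cmod_opp in H2. lra. }
replace (/ f w - / f z - (w - z) * (- a / (f z * f z)))
  with (/ f w * / f z * (f z - f w) - / f z * / f z * (f z - f z) - (w - z) * (- a / (f z * f z)))
  by (field; auto). exact H1.
Qed.

Lemma Cderive_eq (f : C -> C) (z a b : C) : Cderive f z a -> a = b -> Cderive f z b.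
Proof. intros H <-; exact H. Qed.

Lemma Cderive_near (f g : C -> C) (z d : C) (r : R) : (0 < r)%R ->
  (forall w, (Cmod (w - z) < r)%R -> f w = g w) -> Cderive f z d -> Cderive g z d.
Proof.
intros Hr E. rewrite !is_derive_C_eps. intros H eps He.
destruct (H eps He) as [s [Hs H1]].
exists (Rmin r s). split; [apply Rmin_glb_lt; auto|].
intros w Hw.
rewrite <- (E w), <- (E z).
- apply H1. eapply Rlt_le_trans; [exact Hw|apply Rmin_r].
- replace (z - z) with (RtoC 0) by ring. rewrite Cmod_0; auto.
- eapply Rlt_le_trans; [exact Hw|apply Rmin_l].
Qed.

Lemma Cderive_unique (f : C -> C) (z a b : C) : Cderive f z a -> Cderive f z b -> a = b.
Proof. intros Ha Hb. rewrite <- (is_C_derive_unique f z a Ha). apply is_C_derive_unique, Hb. Qed.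

Lemma Cex_const (c z : C) : Cex (fun _ => c) z.
Proof. exists (RtoC 0). apply Cderive_const. Qed.

Lemma Cex_id (z : C) : Cex (fun w => w) z.
Proof. exists (RtoC 1). apply Cderive_id. Qed.

Lemma Cex_plus (f g : C -> C) z : Cex f z -> Cex g z -> Cex (fun w => f w + g w) z.
Proof. intros [a Ha] [b Hb]. eexists. apply Cderive_plus; eauto. Qed.

Lemma Cex_mult (f g : C -> C) z : Cex f z -> Cex g z -> Cex (fun w => f w * g w) z.
Proof. intros [a Ha] [b Hb]. eexists. apply Cderive_mult; eauto. Qed.

Lemma Cex_opp (f : C -> C) z : Cex f z -> Cex (fun w => - f w) z.
Proof.
intros H. apply (ex_derive_ext (K := C_AbsRing) (V := C_NormedModule) (fun w => (- (1)) * f w)).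
- intros t. change ((- (1)) * f t = - f t). ring.
- apply Cex_mult; auto using Cex_const.
Qed.

Lemma Cex_minus (f g : C -> C) z : Cex f z -> Cex g z -> Cex (fun w => f w - g w) z.
Proof. intros Hf Hg. apply Cex_plus; auto using Cex_opp. Qed.

Lemma Cex_inv (f : C -> C) z : f z <> 0 -> Cex f z -> Cex (fun w => / f w) z.
Proof. intros Hz [a Ha]. eexists. apply Cderive_inv; eauto. Qed.

Lemma Cex_div (f g : C -> C) z : g z <> 0 -> Cex f z -> Cex g z -> Cex (fun w => f w / g w) z.
Proof. intros Hz Hf Hg. apply Cex_mult; auto using Cex_inv. Qed.

Lemma Cex_comp (f g : C -> C) z : Cex f z -> Cex g (f z) -> Cex (fun w => g (f w)) z.
Proof. intros [a Ha] [b Hb]. eexists. apply Cderive_comp; eauto. Qed.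

Lemma Cex_pow (f : C -> C) z (n : nat) : Cex f z -> Cex (fun w => f w ^ n) z.
Proof.
intros H. induction n as [|n IH]; simpl; [apply Cex_const|apply Cex_mult; auto].
Qed.

Lemma Cex_near (f g : C -> C) (z : C) (r : R) : (0 < r)%R ->
  (forall w, (Cmod (w - z) < r)%R -> f w = g w) -> Cex f z -> Cex g z.
Proof. intros Hr E [d Hd]. exists d. eapply Cderive_near; eauto. Qed.

(** * The complex exponential *)

Lemma Ci_sqr : Ci * Ci = - (1).
Proof. unfold Ci, Cmult, RtoC, Copp; simpl; f_equal; ring. Qed.

Lemma Ci_neq_0 : Ci <> 0.
Proof. intros K. pose proof Cmod_Ci as M. rewrite K, Cmod_0 in M. lra. Qed.

Lemma Cexp_plus (z w : C) : Cexp (z + w) = Cexp z * Cexp w.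
Proof.
unfold Cexp. destruct z as [a b], w as [c d]. unfold Re, Im, Cplus, Cmult; simpl.
rewrite exp_plus, cos_plus, sin_plus. f_equal; ring.
Qed.

Lemma Cexp_0 : Cexp 0 = 1.
Proof. unfold Cexp, Re, Im; simpl. rewrite exp_0, cos_0, sin_0. unfold RtoC. f_equal; ring. Qed.

Lemma Cexp_neq_0 (z : C) : Cexp z <> 0.
Proof.
intros H. assert (K : Cexp z * Cexp (- z) = 1).
{ rewrite <- Cexp_plus. replace (z + - z) with (RtoC 0) by ring. apply Cexp_0. }
rewrite H in K. replace (0 * Cexp (- z)) with (RtoC 0) in K by ring.
apply RtoC_inj in K. lra.
Qed.

Lemma Cexp_opp (z : C) : Cexp (- z) = / Cexp z.
Proof.
assert (K : Cexp z * Cexp (- z) = 1).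
{ rewrite <- Cexp_plus. replace (z + - z) with (RtoC 0) by ring. apply Cexp_0. }
replace (Cexp (- z)) with (/ Cexp z * (Cexp z * Cexp (- z)))
  by (field; apply Cexp_neq_0).
rewrite K. ring.
Qed.

Lemma Cexp_nat (n : nat) (z : C) : Cexp (RtoC (INR n) * z) = Cexp z ^ n.
Proof.
induction n as [|n IH].
- simpl. replace (RtoC 0 * z) with (RtoC 0) by ring. apply Cexp_0.
- rewrite S_INR, RtoC_plus, Cpow_S, <- IH, <- Cexp_plus. f_equal. ring.
Qed.

Lemma Cmod_Cexp (z : C) : Cmod (Cexp z) = exp (Re z).
Proof.
unfold Cmod, Cexp; simpl.
replace (exp (Re z) * cos (Im z) * (exp (Re z) * cos (Im z) * 1) +
  exp (Re z) * sin (Im z) * (exp (Re z) * sin (Im z) * 1))%R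
  with (exp (Re z) * exp (Re z))%R.
- apply sqrt_square, Rlt_le, exp_pos.
- pose proof (sin2_cos2 (Im z)) as H. unfold Rsqr in H. nra.
Qed.

Lemma Cexp_RtoC (t : R) : Cexp (RtoC t) = RtoC (exp t).
Proof.
unfold Cexp, Re, Im, RtoC; simpl. rewrite cos_0, sin_0. f_equal; ring.
Qed.

Lemma Cexp_Ci_2PI (t : R) : Cexp (Ci * RtoC (t + 2 * PI)) = Cexp (Ci * RtoC t).
Proof.
unfold Cexp, Ci, Re, Im, RtoC, Cmult; simpl.
replace (0 * (t + 2 * PI) - 1 * 0)%R with (0 * t - 1 * 0)%R by ring.
replace (0 * 0 + 1 * (t + 2 * PI))%R with (t + 2 * PI)%R by ring.
replace (0 * 0 + 1 * t)%R with t by ring.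
rewrite cos_plus, sin_plus, cos_2PI, sin_2PI. f_equal; ring.
Qed.

Lemma Rderive_eps (f : R -> R) (l : R) : is_derive f 0 l ->
  forall eps, (0 < eps)%R -> exists r, (0 < r)%R /\
    forall t, (Rabs t < r)%R -> (Rabs (f t - f 0 - t * l) <= eps * Rabs t)%R.
Proof.
intros [_ H] eps He. destruct (H 0%R (fun P HP => HP) (mkposreal eps He)) as [r Hr].
exists r. split; [apply cond_pos|]. intros t Ht.
assert (B : ball 0%R r t).
{ unfold ball; simpl; unfold AbsRing_ball, abs, minus, plus, opp; simpl.
  now rewrite Ropp_0, Rplus_0_r. }
specialize (Hr t B). unfold norm, minus, plus, opp, scal in Hr; simpl in Hr.
unfold abs in Hr; simpl in Hr. unfold mult in Hr; simpl in Hr.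
rewrite Ropp_0, Rplus_0_r in Hr.
replace (f t - f 0 - t * l)%R with (f t + - f 0 + - (t * l))%R by ring. exact Hr.
Qed.

(** Only at 0 is the derivative computed by hand, from the first order expansions of exp, cos and
    sin; the functional equation then carries it to every point. *)
Lemma Cexp_deriv_0 : Cderive Cexp 0 1.
Proof.
apply is_derive_C_eps. intros eps He.
(* Each coordinate of the error is at most 5 e |w|, and passing from coordinates to the modulus
   costs at most a factor 2, whence the 10. *)
set (e := Rmin 1 (eps / 10)).
assert (He0 : (0 < e)%R) by (apply Rmin_glb_lt; lra).
assert (De : is_derive exp 0 1) by (auto_derive; [auto|rewrite exp_0; ring]).
assert (Dc : is_derive cos 0 0) by (auto_derive; [auto|rewrite sin_0; ring]).
assert (Ds : is_derive sin 0 1) by (auto_derive; [auto|rewrite cos_0; ring]).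
destruct (Rderive_eps _ _ De e He0) as [r1 [Hr1 H1]].
destruct (Rderive_eps _ _ Dc e He0) as [r2 [Hr2 H2]].
destruct (Rderive_eps _ _ Ds e He0) as [r3 [Hr3 H3]].
exists (Rmin e (Rmin r1 (Rmin r2 r3))). split.
{ repeat apply Rmin_glb_lt; lra. }
intros w Hw. replace (w - 0) with w in * by ring.
pose proof (Rmin_l e (Rmin r1 (Rmin r2 r3))). pose proof (Rmin_r e (Rmin r1 (Rmin r2 r3))).
pose proof (Rmin_l r1 (Rmin r2 r3)). pose proof (Rmin_r r1 (Rmin r2 r3)).
pose proof (Rmin_l r2 r3). pose proof (Rmin_r r2 r3).
pose proof (Rmin_l 1 (eps / 10)) as Q1. pose proof (Rmin_r 1 (eps / 10)) as Q2. fold e in Q1, Q2.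
destruct w as [u v].
pose proof (Rmax_Cmod (u, v)) as HM. simpl in HM.
pose proof (Rmax_l (Rabs u) (Rabs v)). pose proof (Rmax_r (Rabs u) (Rabs v)).
set (m := Cmod (u, v)) in *.
assert (Hu : (Rabs u <= m)%R) by lra. assert (Hv : (Rabs v <= m)%R) by lra.
specialize (H1 u ltac:(lra)). specialize (H2 v ltac:(lra)). specialize (H3 v ltac:(lra)).
rewrite exp_0 in H1. rewrite cos_0 in H2. rewrite sin_0 in H3.
rewrite Cexp_0. unfold Cexp, Re, Im; simpl.
pose proof (Rabs_pos u); pose proof (Rabs_pos v).
set (A := (exp u - 1 - u * 1)%R) in *. set (B := (cos v - 1 - v * 0)%R) in *.
set (D := (sin v - 0 - v * 1)%R) in *.
assert (EA : exp u = (1 + u + A)%R) by (unfold A; ring).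
assert (EB : cos v = (1 + B)%R) by (unfold B; ring).
assert (ED : sin v = (v + D)%R) by (unfold D; ring).
assert (HA : (Rabs A <= e * m)%R) by nra.
assert (HB : (Rabs B <= e * m)%R) by nra.
assert (HD : (Rabs D <= e * m)%R) by nra.
assert (Hm0 : (0 <= m)%R) by lra. assert (Hme : (m < e)%R) by lra.
eapply Rle_trans; [apply Cmod_2Rmax|].
pose proof sqrt2_le_2 as S2.
assert (S0 : (0 <= sqrt 2)%R) by apply sqrt_pos.
assert (Hem : (e * m <= m)%R) by nra.
assert (X : (Rmax (Rabs (exp u * cos v + - 1 + - (u * 1 - v * 0)))
                  (Rabs (exp u * sin v + - 0 + - (u * 0 + v * 1))) <= 5 * (e * m))%R).
{ apply Rmax_lub.
  - replace (exp u * cos v + - 1 + - (u * 1 - v * 0))%R with (A + (1 + u + A) * B)%R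
      by (rewrite EA, EB; ring).
    eapply Rle_trans; [apply Rabs_triang|]. rewrite Rabs_mult.
    assert (Rabs (1 + u + A) <= 3)%R.
    { eapply Rle_trans; [apply Rabs_triang|].
      pose proof (Rabs_triang 1 u). rewrite Rabs_R1 in *. lra. }
    pose proof (Rabs_pos B). nra.
  - replace (exp u * sin v + - 0 + - (u * 0 + v * 1))%R with (D + ((u + A) * (v + D)))%R
      by (rewrite EA, ED; ring).
    eapply Rle_trans; [apply Rabs_triang|]. rewrite Rabs_mult.
    assert (Rabs (u + A) <= m + e * m)%R by (eapply Rle_trans; [apply Rabs_triang|]; lra).
    assert (Rabs (v + D) <= m + e * m)%R by (eapply Rle_trans; [apply Rabs_triang|]; lra).
    pose proof (Rabs_pos (u + A)). pose proof (Rabs_pos (v + D)).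
    assert (Rabs (u + A) * Rabs (v + D) <= (m + e * m) * (m + e * m))%R.
    { apply Rmult_le_compat; lra. }
    assert (m * m <= e * m)%R by nra.
    assert ((m + e * m) * (m + e * m) <= (2 * m) * (2 * m))%R by (apply Rmult_le_compat; nra).
    lra. }
unfold Cmod in m. fold m. cbn [fst snd].
match goal with |- (_ * ?Y <= _)%R => assert (Y <= 5 * (e * m))%R by exact X end.
apply Rle_trans with (2 * (5 * (e * m)))%R.
- apply Rmult_le_compat; auto. eapply Rle_trans; [|apply Rmax_l]. apply Rabs_pos.
- nra.
Qed.

Lemma Cexp_deriv (z : C) : Cderive Cexp z (Cexp z).
Proof.
apply (is_derive_ext (K := C_AbsRing) (V := C_NormedModule) (fun w => Cexp z * Cexp (w - z))).
- intros w. change (Cexp z * Cexp (w - z) = Cexp w).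
  rewrite <- Cexp_plus. f_equal. ring.
- eapply Cderive_eq.
  + apply Cderive_mult; [apply Cderive_const|].
    apply (Cderive_comp (fun w => w - z) Cexp).
    * apply Cderive_plus; [apply Cderive_id|apply (Cderive_const (- z))].
    * cbv beta. replace (z - z) with (RtoC 0) by ring. apply Cexp_deriv_0.
  + cbv beta. ring.
Qed.

Lemma Cex_Cexp (f : C -> C) z : Cex f z -> Cex (fun w => Cexp (f w)) z.
Proof. intros H. apply (Cex_comp f Cexp); auto. eexists. apply Cexp_deriv. Qed.

Ltac cex := cbv beta; try assumption; match goal with
  | |- Cex (fun _ => ?c) _ => apply (Cex_const c)
  | |- Cex (fun w => w) _ => apply Cex_id
  | |- Cex (fun w => @?f w + @?g w) _ => apply (Cex_plus f g); cex
  | |- Cex (fun w => @?f w - @?g w) _ => apply (Cex_minus f g); cex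
  | |- Cex (fun w => - @?f w) _ => apply (Cex_opp f); cex
  | |- Cex (fun w => @?f w * @?g w) _ => apply (Cex_mult f g); cex
  | |- Cex (fun w => @?f w / @?g w) _ => apply (Cex_div f g); [cbv beta|cex|cex]
  | |- Cex (fun w => / @?f w) _ => apply (Cex_inv f); [cbv beta|cex]
  | |- Cex (fun w => @?f w ^ ?n) _ => apply (Cex_pow f); cex
  | |- Cex (fun w => Cexp (@?f w)) _ => apply (Cex_Cexp f); cex
  | _ => idtac
  end.

(** * Integrals of complex-valued functions and power series *)

Notation Cint f a b l :=
  (is_RInt (V := C_R_NormedModule) (f : R -> C) a b (l : C)).
Notation RCderive f t d :=
  (is_derive (K := R_AbsRing) (V := C_R_NormedModule) (f : R -> C) t (d : C)).

Lemma Cint_eq (f : R -> C) a b (l m : C) : Cint f a b l -> l = m -> Cint f a b m.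
Proof. intros H <-; exact H. Qed.

Lemma Cint_ext (f g : R -> C) a b (l : C) : (a <= b)%R ->
  (forall t, (a < t < b)%R -> f t = g t) -> Cint f a b l -> Cint g a b l.
Proof.
intros Hab E. apply (is_RInt_ext (V := C_R_NormedModule)).
intros t. rewrite Rmin_left, Rmax_right by exact Hab. apply E.
Qed.

Lemma Cint_ext_all (f g : R -> C) a b (l : C) :
  (forall t, f t = g t) -> Cint f a b l -> Cint g a b l.
Proof. intros E. apply (is_RInt_ext (V := C_R_NormedModule)). intros t _. apply E. Qed.

Lemma Cint_plus (f g : R -> C) a b (l m : C) :
  Cint f a b l -> Cint g a b m -> Cint (fun t => f t + g t) a b (l + m).
Proof. exact (is_RInt_plus (V := C_R_NormedModule) f g a b l m). Qed.

Lemma Cint_opp (f : R -> C) a b (l : C) :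
  Cint f a b l -> Cint (fun t => - f t) a b (- l).
Proof. exact (is_RInt_opp (V := C_R_NormedModule) f a b l). Qed.

Lemma Cint_minus (f g : R -> C) a b (l m : C) :
  Cint f a b l -> Cint g a b m -> Cint (fun t => f t - g t) a b (l - m).
Proof. intros Hf Hg. apply Cint_plus; [exact Hf|apply Cint_opp, Hg]. Qed.

Lemma Cint_pair (f : R -> C) a b (l : C) :
  is_RInt (fun t => Re (f t)) a b (Re l) -> is_RInt (fun t => Im (f t)) a b (Im l) ->
  Cint f a b l.
Proof.
destruct l as [u v]. simpl.
apply (is_RInt_fct_extend_pair (U := R_NormedModule) (V := R_NormedModule) f a b u v).
Qed.

Lemma Cint_Re (f : R -> C) a b (l : C) :
  Cint f a b l -> is_RInt (fun t => Re (f t)) a b (Re l).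
Proof. exact (is_RInt_fct_extend_fst (U := R_NormedModule) (V := R_NormedModule) f a b l). Qed.

Lemma Cint_Im (f : R -> C) a b (l : C) :
  Cint f a b l -> is_RInt (fun t => Im (f t)) a b (Im l).
Proof. exact (is_RInt_fct_extend_snd (U := R_NormedModule) (V := R_NormedModule) f a b l). Qed.

(** The integral lives in [C] as a real vector space, whose [scal] takes real factors only; a
    complex factor goes through real and imaginary parts. *)
Lemma Cint_scal (c : C) (f : R -> C) a b (l : C) :
  Cint f a b l -> Cint (fun t => c * f t) a b (c * l).
Proof.
intros H. pose proof (Cint_Re _ _ _ _ H) as HR. pose proof (Cint_Im _ _ _ _ H) as HI.
destruct c as [u v]. apply Cint_pair.
- exact (is_RInt_minus _ _ _ _ _ _ (is_RInt_scal _ _ _ u _ HR) (is_RInt_scal _ _ _ v _ HI)).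
- exact (is_RInt_plus _ _ _ _ _ _ (is_RInt_scal _ _ _ u _ HI) (is_RInt_scal _ _ _ v _ HR)).
Qed.

Lemma Cint_const (c : C) a b : Cint (fun _ => c) a b (RtoC (b - a) * c).
Proof.
eapply Cint_eq; [apply (is_RInt_const (V := C_R_NormedModule) a b c)|].
destruct c as [u v]. unfold scal; simpl; unfold prod_scal, RtoC, Cmult, scal; simpl.
unfold mult; simpl. f_equal; ring.
Qed.

Lemma Cint_zero a b : Cint (fun _ => RtoC 0) a b 0.
Proof. eapply Cint_eq; [apply Cint_const|ring]. Qed.

Lemma C_R_norm (x : C) : norm (x : C_R_NormedModule) = Cmod x.
Proof.
destruct x as [u v]. unfold norm, Cmod; simpl. unfold prod_norm; simpl.
unfold norm; simpl. unfold abs; simpl.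
f_equal. rewrite !Rmult_1_r, <- !Rabs_mult, !Rabs_pos_eq by nra. reflexivity.
Qed.

Lemma Cint_bound (f : R -> C) a b (l : C) (M : R) : (a <= b)%R ->
  (forall t, (a <= t <= b)%R -> (Cmod (f t) <= M)%R) -> Cint f a b l ->
  (Cmod l <= (b - a) * M)%R.
Proof.
intros Hab HM H. rewrite <- C_R_norm.
apply (norm_RInt_le_const (V := C_R_NormedModule) f a b l M Hab); [|exact H].
intros t Ht. rewrite (C_R_norm (f t)). auto.
Qed.

Lemma Cint_unique (f : R -> C) a b (l m : C) : Cint f a b l -> Cint f a b m -> l = m.
Proof.
intros Hl Hm. rewrite <- (is_RInt_unique (V := C_R_CompleteNormedModule) f a b l Hl).
exact (is_RInt_unique (V := C_R_CompleteNormedModule) f a b m Hm).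
Qed.

Lemma Cint_continuous (f : R -> C) a b : (a <= b)%R ->
  (forall t, (a <= t <= b)%R -> Rcont f t) -> exists l : C, Cint f a b l.
Proof.
intros Hab H. apply (ex_RInt_continuous (V := C_R_CompleteNormedModule) f a b).
intros t. rewrite Rmin_left, Rmax_right by exact Hab. apply H.
Qed.

Lemma Cint_Chasles (f : R -> C) a b c (l m : C) :
  Cint f a b l -> Cint f b c m -> Cint f a c (l + m).
Proof. exact (is_RInt_Chasles (V := C_R_NormedModule) f a b c l m). Qed.

Lemma Cint_sub (f : R -> C) a b c d (l : C) : (a <= c)%R -> (c <= d)%R -> (d <= b)%R ->
  Cint f a b l -> exists m : C, Cint f c d m.
Proof.
intros H1 H2 H3 H.
apply (ex_RInt_Chasles_2 (V := C_R_CompleteNormedModule) f a c d); [lra|].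
apply (ex_RInt_Chasles_1 (V := C_R_CompleteNormedModule) f a d b); [lra|].
exists l; exact H.
Qed.

(** Uniformity is asked on the whole line because the exchange theorem works in
    [fct_UniformSpace R]; functions of [circ t] meet this as soon as the bound depends on |circ t| =
    1 alone. *)
Lemma Cint_uniform_limit (f : nat -> R -> C) (S : R -> C) a b (L : C) :
  (forall k, Cint (f k) a b L) ->
  (forall eps, (0 < eps)%R -> exists N, forall k, (N <= k)%nat ->
     forall t, (Cmod (f k t - S t) <= eps)%R) ->
  Cint S a b L.
Proof.
intros Hf Hu.
destruct (filterlim_RInt (V := C_R_CompleteNormedModule) f a b eventually _ S (fun _ => L) Hf)
  as [l [Hl HS]].
- apply (filterlim_locally (U := fct_UniformSpace R C_UniformSpace)). intros eps.
  destruct (Hu (eps / 2)%R) as [N HN]; [pose proof (cond_pos eps); lra|].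
  exists N. intros k Hk t. apply C_ball_Cmod.
  eapply Rle_lt_trans; [apply (HN k Hk t)|]. pose proof (cond_pos eps); lra.
- assert (E : l = L :> C).
  { apply (filterlim_locally_unique (F := eventually) (K := R_AbsRing) (V := C_R_NormedModule) (fun _ : nat => L)).
    - exact Hl.
    - apply filterlim_const. }
  rewrite <- E. exact HS.
Qed.

Lemma Rcont_id : forall t, Rcont (fun s => RtoC s) t.
Proof.
intros t. apply Rcont_eps. intros eps He. exists eps. split; auto.
intros s Hs. rewrite <- RtoC_minus, Cmod_R. exact Hs.
Qed.

Lemma Rcont_const (c : C) t : Rcont (fun _ => c) t.
Proof. apply Clim_const, _. Qed.

Lemma Rcont_plus (f g : R -> C) t : Rcont f t -> Rcont g t -> Rcont (fun s => f s + g s) t.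
Proof. apply Clim_plus, _. Qed.

Lemma Rcont_mult (f g : R -> C) t : Rcont f t -> Rcont g t -> Rcont (fun s => f s * g s) t.
Proof. apply Clim_mult, _. Qed.

Lemma Rcont_inv (f : R -> C) t : f t <> 0 -> Rcont f t -> Rcont (fun s => / f s) t.
Proof. apply Clim_inv, _. Qed.

Lemma Rcont_pow (f : R -> C) t n : Rcont f t -> Rcont (fun s => f s ^ n) t.
Proof. apply Clim_pow, _. Qed.

Lemma Rcont_comp (f : C -> C) (u : R -> C) t : Rcont u t -> Ccont f (u t) -> Rcont (fun s => f (u s)) t.
Proof. apply (continuous_comp (V := C_UniformSpace)). Qed.

Lemma Rcont_ext (f g : R -> C) t : (forall s, f s = g s) -> Rcont f t -> Rcont g t.
Proof. intros H. apply continuous_ext, H. Qed.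

Ltac rcont := cbv beta; try assumption; match goal with
  | |- Rcont (fun _ => ?c) _ => apply (Rcont_const c)
  | |- Rcont (fun s => RtoC s) _ => apply Rcont_id
  | |- Rcont (fun s => @?f s + @?g s) _ => apply (Rcont_plus f g); rcont
  | |- Rcont (fun s => @?f s * @?g s) _ => apply (Rcont_mult f g); rcont
  | |- Rcont (fun s => / @?f s) _ => apply (Rcont_inv f); [cbv beta|rcont]
  | |- Rcont (fun s => @?f s ^ ?n) _ => apply (Rcont_pow f); rcont
  | _ => idtac
  end.

Lemma Rcont_line (z v : C) t : Rcont (fun s => z + RtoC s * v) t.
Proof.
apply Rcont_plus; [apply Rcont_const|]. apply Rcont_mult; [apply Rcont_id|apply Rcont_const].
Qed.

Lemma RCderive_eps (f : R -> C) (t : R) (d : C) :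
  (forall eps : R, (0 < eps)%R -> exists r : R, (0 < r)%R /\
    forall s, (Rabs (s - t) < r)%R ->
      (Cmod (f s - f t - RtoC (s - t) * d) <= eps * Rabs (s - t))%R) -> RCderive f t d.
Proof.
intros H. split.
- apply (is_linear_scal_l (K := R_AbsRing) (V := C_R_NormedModule) d).
- intros x Hx eps.
  apply (is_filter_lim_locally_unique (K := R_AbsRing) (V := R_NormedModule)) in Hx.
  rewrite <- Hx. destruct (H eps (cond_pos eps)) as [r [Hr H1]].
  exists (mkposreal r Hr). intros s Hs. specialize (H1 s Hs).
  rewrite <- C_R_norm in H1.
  assert (E : f s - f t - RtoC (s - t) * d =
    minus (minus (f s) (f t)) (scal (minus s t : R_AbsRing) (d : C_R_NormedModule)) :> C).
  { destruct d as [u v]. unfold minus, plus, opp, scal; simpl.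
    unfold prod_scal, prod_plus, prod_opp, plus, opp, scal; simpl. unfold mult; simpl.
    unfold Cminus, Cplus, Copp, Cmult, RtoC; simpl. f_equal; ring. }
  rewrite E in H1. exact H1.
Qed.

(** Every path used is a line in a suitable coordinate: a side of a rectangle is one, and a circle
    is the image of a vertical line under [Cexp]. This chain rule is therefore the only bridge
    needed from complex to real derivatives. *)
Lemma RCderive_line (F : C -> C) (z v : C) (t : R) (d : C) :
  Cderive F (z + RtoC t * v) d -> RCderive (fun s => F (z + RtoC s * v)) t (v * d).
Proof.
intros H. apply RCderive_eps. intros eps He.
assert (Hv : (0 < Cmod v + 1)%R) by (pose proof (Cmod_ge_0 v); lra).
destruct (proj1 (is_derive_C_eps _ _ _) H (eps / (Cmod v + 1))%R) as [r [Hr H1]].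
{ apply Rdiv_lt_0_compat; lra. }
exists (r / (Cmod v + 1))%R. split; [apply Rdiv_lt_0_compat; lra|].
intros s Hs.
assert (E : z + RtoC s * v - (z + RtoC t * v) = RtoC (s - t) * v) by (rewrite RtoC_minus; ring).
specialize (H1 (z + RtoC s * v)). rewrite E in H1.
rewrite Cmod_mult, Cmod_R in H1.
pose proof (Rabs_pos (s - t)). pose proof (Cmod_ge_0 v).
assert (K : (Rabs (s - t) * Cmod v <= Rabs (s - t) * (Cmod v + 1))%R) by nra.
assert (K2 : (Rabs (s - t) * (Cmod v + 1) < r)%R).
{ apply (Rmult_lt_compat_r (Cmod v + 1)) in Hs; auto.
  unfold Rdiv in Hs. rewrite Rmult_assoc, Rinv_l in Hs; lra. }
specialize (H1 ltac:(lra)).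
replace (RtoC (s - t) * (v * d)) with (RtoC (s - t) * v * d) by ring.
eapply Rle_trans; [exact H1|].
apply Rle_trans with (eps / (Cmod v + 1) * (Rabs (s - t) * (Cmod v + 1)))%R.
- apply Rmult_le_compat_l; auto. apply Rlt_le, Rdiv_lt_0_compat; lra.
- right. field. lra.
Qed.

Lemma Cint_FTC (f df : R -> C) a b : (a <= b)%R ->
  (forall t, (a <= t <= b)%R -> RCderive f t (df t)) ->
  (forall t, (a <= t <= b)%R -> Rcont df t) ->
  Cint df a b (f b - f a).
Proof.
intros Hab Hd Hc.
apply (is_RInt_derive (V := C_R_CompleteNormedModule) f df a b);
  intros t; rewrite Rmin_left, Rmax_right by exact Hab; [apply Hd|apply Hc].
Qed.

(** * Circles and the moments of [circ] *)

Definition circ (t : R) : C := Cexp (Ci * RtoC t).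

Lemma Cmod_circ t : Cmod (circ t) = 1%R.
Proof.
unfold circ. rewrite Cmod_Cexp. rewrite Cmult_comm, re_mult_Ci, im_RtoC, Ropp_0. apply exp_0.
Qed.

Lemma circ_neq_0 t : circ t <> 0.
Proof. apply Cexp_neq_0. Qed.

Lemma circ_2PI t : circ (t + 2 * PI) = circ t.
Proof. apply Cexp_Ci_2PI. Qed.

Lemma Rcont_circ t : Rcont circ t.
Proof.
apply (Rcont_ext (fun s => Cexp (0 + RtoC s * Ci))).
- intros s. unfold circ. f_equal. ring.
- apply (Rcont_comp Cexp); [apply Rcont_line|]. apply Cex_Ccont. eexists. apply Cexp_deriv.
Qed.

Lemma Rcont_circle (f : C -> C) (c : C) (r t : R) :
  Ccont f (c + RtoC r * circ t) -> Rcont (fun s => f (c + RtoC r * circ s)) t.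
Proof.
apply (Rcont_comp f (fun s => c + RtoC r * circ s)).
apply Rcont_plus; [apply Rcont_const|]. apply Rcont_mult; [apply Rcont_const|apply Rcont_circ].
Qed.

(** Up to the factor [Ci], the integrand is the t-derivative of [V (c + RtoC r * circ t)], which
    takes the same value at both ends of a period. *)
Lemma Cint_circle_derive (V V' : C -> C) (c : C) (r a : R) :
  (forall t, Cderive V (c + RtoC r * circ t) (V' (c + RtoC r * circ t))) ->
  (forall t, Ccont V' (c + RtoC r * circ t)) ->
  Cint (fun t => RtoC r * circ t * V' (c + RtoC r * circ t)) a (a + 2 * PI) 0.
Proof.
intros HV HV'. pose proof PI_RGT_0.
assert (H1 : Cint (fun t => Ci * (RtoC r * circ t * V' (c + RtoC r * circ t))) a (a + 2 * PI)
  (V (c + RtoC r * circ (a + 2 * PI)) - V (c + RtoC r * circ a))).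
{ apply (Cint_FTC (fun t => V (c + RtoC r * circ t))); [lra| |].
  - intros t _.
    apply (is_derive_ext (K := R_AbsRing) (V := C_R_NormedModule)
      (fun s => (fun z => V (c + RtoC r * Cexp z)) (0 + RtoC s * Ci))).
    { intros s. unfold circ. cbv beta. replace (0 + RtoC s * Ci) with (Ci * RtoC s) by ring. reflexivity. }
    apply (RCderive_line (fun z => V (c + RtoC r * Cexp z)) 0 Ci t (RtoC r * circ t * V' (c + RtoC r * circ t))).
    assert (E : 0 + RtoC t * Ci = Ci * RtoC t) by ring. rewrite E.
    eapply Cderive_eq.
    + apply (Cderive_comp (fun z => c + RtoC r * Cexp z) V).
      * apply Cderive_plus; [apply Cderive_const|].
        apply Cderive_mult; [apply Cderive_const|apply Cexp_deriv].
      * apply HV.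
    + cbv beta. fold (circ t). ring.
  - intros t _. rcont; [apply Rcont_circ|].
    apply Rcont_circle, HV'. }
rewrite circ_2PI in H1.
apply (Cint_scal (- Ci)) in H1.
eapply Cint_eq; [eapply Cint_ext_all; [|exact H1]|ring].
intros t. cbv beta. replace (- Ci * (Ci * (RtoC r * circ t * V' (c + RtoC r * circ t))))
  with (- (Ci * Ci) * (RtoC r * circ t * V' (c + RtoC r * circ t))) by ring.
rewrite Ci_sqr. ring.
Qed.

Lemma Cderive_pow (k : nat) (z : C) : Cderive (fun w => w ^ S k) z (RtoC (INR (S k)) * z ^ k).
Proof.
induction k as [|k IH].
- simpl. eapply Cderive_eq.
  + apply Cderive_mult; [apply Cderive_id|apply (Cderive_const 1)].
  + cbv beta. ring.
- eapply Cderive_eq.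
  + apply (Cderive_mult (fun w => w) (fun w => w ^ S k)); [apply Cderive_id|exact IH].
  + cbv beta. rewrite (S_INR (S k)), RtoC_plus. rewrite !Cpow_S. ring.
Qed.

Lemma INR_C_neq_0 (k : nat) : RtoC (INR (S k)) <> 0.
Proof. intros H. apply RtoC_inj in H. pose proof (pos_INR k). rewrite S_INR in H. lra. Qed.

Lemma Cint_circ_pow (k : nat) (a : R) : Cint (fun t => circ t ^ S k) a (a + 2 * PI) 0.
Proof.
eapply Cint_ext_all; [|apply (Cint_circle_derive (fun w => / RtoC (INR (S k)) * w ^ S k) (fun w => w ^ k) 0 1 a)].
- intros t. cbv beta. replace (0 + RtoC 1 * circ t) with (circ t) by ring. rewrite Cpow_S. ring.
- intros t. eapply Cderive_eq.
  + apply Cderive_mult; [apply Cderive_const|apply Cderive_pow].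
  + cbv beta. field. apply INR_C_neq_0.
- intros t. apply Cex_Ccont, Cex_pow, Cex_id.
Qed.

Lemma Cint_circ_inv_pow (k : nat) (a : R) : Cint (fun t => (/ circ t) ^ S k) a (a + 2 * PI) 0.
Proof.
eapply Cint_ext_all; [|apply (Cint_circle_derive (fun w => - / RtoC (INR (S k)) * (/ w) ^ S k)
  (fun w => (/ w) ^ S (S k)) 0 1 a)].
- intros t. cbv beta. replace (0 + RtoC 1 * circ t) with (circ t) by ring.
  rewrite !Cpow_S. field. apply circ_neq_0.
- intros t. replace (0 + RtoC 1 * circ t) with (circ t) by ring.
  pose proof (circ_neq_0 t) as Hc. eapply Cderive_eq.
  + apply Cderive_mult; [apply Cderive_const|].
    apply (Cderive_comp (fun w => / w) (fun w => w ^ S k)).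
    * apply (Cderive_inv (fun w => w)); [exact Hc|apply Cderive_id].
    * apply Cderive_pow.
  + cbv beta. rewrite !Cpow_S. field. split; [exact Hc|apply INR_C_neq_0].
- intros t. replace (0 + RtoC 1 * circ t) with (circ t) by ring.
  apply Cex_Ccont, Cex_pow. apply (Cex_inv (fun w => w)); [apply circ_neq_0|apply Cex_id].
Qed.

(** * Power series through their partial sums *)

(** The upper index is included, as in [sum_n]; hence the exponents [S n] in all remainders. *)
Fixpoint Csum (a : nat -> C) (n : nat) : C :=
  match n with O => a O | S m => Csum a m + a (S m) end.

Definition is_PS (a : nat -> C) (z l : C) : Prop :=
  forall eps : R, (0 < eps)%R -> exists N, forall n, (N <= n)%nat ->
    (Cmod (Csum (fun k => (a k * z ^ k)%C) n - l) < eps)%R.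

Lemma is_pseries_PS (a : nat -> C) (z l : C) :
  is_pseries (K := C_AbsRing) (V := C_NormedModule) a z l <-> is_PS a z l.
Proof.
assert (E : forall n, sum_n (fun k => scal (pow_n (z : C_AbsRing) k) (a k : C_NormedModule)) n =
  Csum (fun k => (a k * z ^ k)%C) n :> C).
{ assert (P : forall k, pow_n (z : C_AbsRing) k = z ^ k :> C).
  { induction k as [|k IH]; simpl; [reflexivity|]. rewrite IH. reflexivity. }
  induction n as [|n IH].
  - rewrite sum_O. simpl. change (1 * a 0%nat = a 0%nat * 1). ring.
  - rewrite sum_Sn, IH. simpl Csum. 
    change (Csum (fun k => (a k * z ^ k)%C) n + pow_n (z : C_AbsRing) (S n) * a (S n) =
      Csum (fun k => (a k * z ^ k)%C) n + a (S n) * z ^ (S n)).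
    rewrite P. ring. }
unfold is_pseries, is_series, is_PS. split.
- intros H eps He. destruct (proj1 (filterlim_C eventually _ _) H eps He) as [N HN].
  exists N. intros n Hn. specialize (HN n Hn). rewrite <- E. exact HN.
- intros H. apply (filterlim_C eventually). intros eps He. destruct (H eps He) as [N HN].
  exists N. intros n Hn. specialize (HN n Hn). rewrite <- E in HN. exact HN.
Qed.

Lemma Csum_ext (a b : nat -> C) n : (forall k, a k = b k) -> Csum a n = Csum b n.
Proof. intros H. induction n; simpl; rewrite ?IHn, ?H; reflexivity. Qed.

Lemma Csum_shift (a : nat -> C) n : Csum a (S n) = a O + Csum (fun k => a (S k)) n.
Proof. induction n as [|n IH]; [reflexivity|]. simpl in *. rewrite IH. ring. Qed.

Lemma Csum_scal (c : C) (a : nat -> C) n : Csum (fun k => c * a k) n = c * Csum a n.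
Proof. induction n as [|n IH]; simpl; [|rewrite IH]; ring. Qed.

Lemma Csum_geom (q : C) n : Csum (fun k => q ^ k) n * (1 - q) = 1 - q ^ S n.
Proof.
induction n as [|n IH]; [simpl; ring|].
simpl Csum. rewrite Cmult_plus_distr_r, IH. rewrite !Cpow_S. ring.
Qed.

(** Beyond [N] the partial sums stay within 1 of the limit, so consecutive ones differ by less than
    2; the remaining terms are finitely many. *)
Lemma is_PS_terms_bounded (a : nat -> C) (z l : C) : is_PS a z l ->
  exists M, (0 <= M)%R /\ forall k, (Cmod (a k) * Cmod z ^ k <= M)%R.
Proof.
intros H. destruct (H 1%R Rlt_0_1) as [N HN].
assert (B : forall n, exists M, (0 <= M)%R /\ forall k, (k <= n)%nat -> (Cmod (a k) * Cmod z ^ k <= M)%R).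
{ induction n as [|n [M [HM IH]]].
  - exists (Cmod (a O)). split; [apply Cmod_ge_0|]. intros k Hk.
    replace k with O by lia. simpl. lra.
  - exists (Rmax M (Cmod (a (S n)) * Cmod z ^ S n)). split; [eapply Rle_trans; [exact HM|apply Rmax_l]|].
    intros k Hk. destruct (Nat.eq_dec k (S n)) as [->|Hne]; [apply Rmax_r|].
    eapply Rle_trans; [apply IH; lia|apply Rmax_l]. }
destruct (B N) as [M [HM HB]]. exists (Rmax M 2). split; [eapply Rle_trans; [exact HM|apply Rmax_l]|].
intros k. destruct (Nat.le_gt_cases k N) as [Hk|Hk].
- eapply Rle_trans; [apply HB, Hk|apply Rmax_l].
- eapply Rle_trans; [|apply Rmax_r]. destruct k as [|k]; [lia|].
  pose proof (HN k ltac:(lia)) as H1. pose proof (HN (S k) ltac:(lia)) as H2.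
  simpl Csum in H2. rewrite <- Cmod_pow, <- Cmod_mult.
  set (s := Csum (fun k => (a k * z ^ k)%C) k) in *.
  change (z * z ^ k) with (z ^ S k) in H2.
  replace (a (S k) * z ^ S k) with ((s + a (S k) * z ^ S k - l) + - (s - l)) by ring.
  eapply Rle_trans; [apply Cmod_triangle|]. rewrite Cmod_opp. lra.
Qed.

(** The bound sees [u] only through [M] and [q], which makes it uniform over a circle. It is the
    limit in m of the geometric bound on the block of terms from n + 1 to n + m. *)
Lemma is_PS_tail (b : nat -> C) (u l : C) (M q : R) : (0 <= q < 1)%R ->
  (forall k, (Cmod (b k * u ^ k) <= M * q ^ k)%R) -> is_PS b u l ->
  forall n, (Cmod (Csum (fun k => (b k * u ^ k)%C) n - l) <= M * q ^ S n / (1 - q))%R.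
Proof.
intros Hq Hb H n.
assert (HM : (0 <= M)%R).
{ specialize (Hb O). simpl in Hb. pose proof (Cmod_ge_0 (b O * 1)). lra. }
assert (P : forall m, (Cmod (Csum (fun k => (b k * u ^ k)%C) (n + m) - Csum (fun k => (b k * u ^ k)%C) n)
   <= M * (q ^ S n - q ^ S (n + m)) / (1 - q))%R).
{ induction m as [|m IH].
  - rewrite Nat.add_0_r. replace (Csum (fun k => (b k * u ^ k)%C) n - Csum (fun k => (b k * u ^ k)%C) n) with (RtoC 0) by ring.
    rewrite Cmod_0. right. field. lra.
  - rewrite Nat.add_succ_r. simpl Csum. 
    match goal with |- (Cmod (?x + ?y - ?z) <= _)%R => replace (x + y - z) with ((x - z) + y) by ring end.
    eapply Rle_trans; [apply Cmod_triangle|].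
    pose proof (Hb (S (n + m))) as H1.
    apply Rle_trans with (M * (q ^ S n - q ^ S (n + m)) / (1 - q) + M * q ^ S (n + m))%R.
    + apply Rplus_le_compat; [exact IH|exact H1].
    + right. change (q ^ S (S (n + m)))%R with (q * q ^ S (n + m))%R. field. lra. }
apply Rle_plus_epsilon. intros eps He.
destruct (H eps He) as [N HN]. specialize (HN (n + N)%nat ltac:(lia)). specialize (P N).
set (x := Csum _ (n + N)) in *. set (y := Csum _ n) in *.
replace (y - l) with (- (x - y) + (x - l)) by ring.
eapply Rle_trans; [apply Cmod_triangle|]. rewrite Cmod_opp.
assert (Q : (M * (q ^ S n - q ^ S (n + N)) / (1 - q) <= M * q ^ S n / (1 - q))%R).
{ unfold Rdiv. apply Rmult_le_compat_r; [apply Rlt_le, Rinv_0_lt_compat; lra|].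
  apply Rmult_le_compat_l; [exact HM|]. pose proof (pow_le q (S (n + N)) ltac:(lra)). lra. }
lra.
Qed.

Lemma geom_tail_small (M q eps : R) : (0 <= q < 1)%R -> (0 < eps)%R ->
  exists N, forall n, (N <= n)%nat -> (M * q ^ S n / (1 - q) < eps)%R.
Proof.
intros Hq He.
assert (HM : (0 < Rabs M + 1)%R) by (pose proof (Rabs_pos M); lra).
destruct (pow_eventually_small q (eps * (1 - q) / (Rabs M + 1))) as [N HN]; [exact Hq| |].
- apply Rdiv_lt_0_compat; [apply Rmult_lt_0_compat; lra|exact HM].
- exists N. intros n Hn. specialize (HN (S n) ltac:(lia)).
  apply Rmult_lt_reg_r with (1 - q)%R; [lra|].
  unfold Rdiv at 1. rewrite Rmult_assoc, Rinv_l, Rmult_1_r by lra.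
  assert (Hp : (0 <= q ^ S n)%R) by (apply pow_le; lra).
  apply Rle_lt_trans with ((Rabs M + 1) * q ^ S n)%R.
  + apply Rmult_le_compat_r; [exact Hp|]. pose proof (Rle_abs M). lra.
  + apply (Rmult_lt_compat_l (Rabs M + 1)) in HN; [|exact HM].
    replace (eps * (1 - q))%R with ((Rabs M + 1) * (eps * (1 - q) / (Rabs M + 1)))%R by (field; lra).
    exact HN.
Qed.

Lemma Cint_Csum (f : nat -> R -> C) (l : nat -> C) a b n :
  (forall k, Cint (f k) a b (l k)) -> Cint (fun t => Csum (fun k => f k t) n) a b (Csum l n).
Proof.
intros H. induction n as [|n IH]; [apply H|]. simpl. apply Cint_plus; auto.
Qed.

Lemma Csum_first (l : nat -> C) n : (forall k, l (S k) = 0) -> Csum l n = l O.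
Proof. intros H. induction n as [|n IH]; [reflexivity|]. simpl. rewrite IH, H. ring. Qed.

(** Meant for [u] equal to [circ] or its inverse: positive powers have mean zero, so only the
    constant term survives, and the geometric decay of the coefficients allows termwise
    integration. *)
Lemma Cint_series (b : nat -> C) (u S : R -> C) (M q a : R) : (0 <= q < 1)%R ->
  (forall k, (Cmod (b k) <= M * q ^ k)%R) ->
  (forall t, Cmod (u t) = 1%R) ->
  (forall k, Cint (fun t => u t ^ Datatypes.S k) a (a + 2 * PI) 0) ->
  (forall t, is_PS b (u t) (S t)) ->
  Cint S a (a + 2 * PI) (RtoC (2 * PI) * b O).
Proof.
intros Hq Hb Hu Hi HS.
apply (Cint_uniform_limit (fun n t => Csum (fun k => b k * u t ^ k) n)).
- intros n. eapply Cint_eq.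
  + apply (Cint_Csum (fun k t => b k * u t ^ k)
      (fun k => b k * match k with O => RtoC (2 * PI) | _ => 0 end)).
    intros k. apply Cint_scal. destruct k as [|k]; [|apply Hi].
    simpl. eapply Cint_eq; [apply Cint_const|].
    replace (a + 2 * PI - a)%R with (2 * PI)%R by ring. ring.
  + rewrite Csum_first; [ring|]. intros k. ring.
- intros eps He. destruct (geom_tail_small M q eps Hq He) as [N HN].
  exists N. intros n Hn t. apply Rlt_le. eapply Rle_lt_trans; [|apply (HN n Hn)].
  apply is_PS_tail; [exact Hq| |apply HS].
  intros k. rewrite Cmod_mult, Cmod_pow, Hu, pow1, Rmult_1_r. apply Hb.
Qed.

(** * Goursat's lemma and mean values over circles *)

Definition CI (f : R -> C) (a b : R) : C := RInt (V := C_R_CompleteNormedModule) f a b.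

Lemma CI_correct (f : R -> C) a b : (a <= b)%R ->
  (forall t, (a <= t <= b)%R -> Rcont f t) -> Cint f a b (CI f a b).
Proof.
intros Hab H. apply (RInt_correct (V := C_R_CompleteNormedModule)).
exact (Cint_continuous f a b Hab H).
Qed.

Lemma CI_Chasles (f : R -> C) a b c : (a <= b)%R -> (b <= c)%R ->
  (forall t, (a <= t <= c)%R -> Rcont f t) -> CI f a c = CI f a b + CI f b c.
Proof.
intros Hab Hbc H. symmetry. apply (Cint_unique f a c).
- apply (Cint_Chasles f a b c); apply CI_correct; auto; intros t Ht; apply H; lra.
- apply CI_correct; [lra|exact H].
Qed.

Lemma nested_intervals (x : nat -> R) (L : R) : (0 <= L)%R ->
  (forall k, (x k <= x (S k))%R /\ (x (S k) + L / 2 ^ S k <= x k + L / 2 ^ k)%R) ->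
  exists p, forall k, (x k <= p <= x k + L / 2 ^ k)%R.
Proof.
intros HL H.
assert (Hg : Un_growing x) by (intros k; apply H).
assert (Hpos : forall k, (0 <= L / 2 ^ k)%R).
{ intros k. apply Rle_mult_inv_pos; [exact HL|apply pow_lt; lra]. }
assert (Hd : forall k m, (x (k + m)%nat + L / 2 ^ (k + m) <= x k + L / 2 ^ k)%R).
{ intros k m. induction m as [|m IH]; [rewrite Nat.add_0_r; lra|].
  rewrite Nat.add_succ_r. eapply Rle_trans; [apply H|exact IH]. }
assert (Hle : forall k n, (x n <= x k + L / 2 ^ k)%R).
{ intros k n. destruct (Nat.le_gt_cases k n) as [Hk|Hk].
  - replace n with (k + (n - k))%nat by lia. specialize (Hd k (n - k)%nat).
    specialize (Hpos (k + (n - k))%nat). lra.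
  - assert (x n <= x k)%R by (apply Rge_le, growing_prop; [exact Hg|lia]).
    specialize (Hpos k). lra. }
destruct (growing_cv x Hg) as [p Hp].
- exists (x O + L / 2 ^ 0)%R. intros y [n ->]. apply Hle.
- exists p. intros k. split; [apply (growing_ineq x p Hg Hp)|].
  apply Rle_plus_epsilon. intros eps He. destruct (Hp eps He) as [N HN].
  specialize (HN N (le_n N)). unfold Rdist in HN. apply Rabs_def2 in HN.
  specialize (Hle k N). lra.
Qed.

(** A cell at depth k is encoded by its lower left corner alone, its sides being L / 2^k and M /
    2^k. Choosing a quarter means keeping each coordinate or shifting it by half the current
    side. *)
Lemma bisection (P : R -> R -> nat -> Prop) (L M x0 y0 : R) : (0 <= L)%R -> (0 <= M)%R ->
  P x0 y0 O ->
  (forall x y k, P x y k -> exists x' y',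
     (x' = x \/ x' = x + L / 2 ^ S k)%R /\ (y' = y \/ y' = y + M / 2 ^ S k)%R /\ P x' y' (S k)) ->
  exists p q, forall k, exists x y, P x y k /\
     (x <= p <= x + L / 2 ^ k)%R /\ (y <= q <= y + M / 2 ^ k)%R.
Proof.
intros HL HM H0 HS.
(* Stated for all pairs, vacuously where [P] fails, so that choice yields a total function that can
   be iterated. *)
assert (HS' : forall (s : R * R) k, exists s' : R * R, P (fst s) (snd s) k ->
  (fst s' = fst s \/ fst s' = fst s + L / 2 ^ S k)%R /\
  (snd s' = snd s \/ snd s' = snd s + M / 2 ^ S k)%R /\ P (fst s') (snd s') (S k)).
{ intros [x y] k. destruct (excluded_middle_informative (P x y k)) as [Hp|Hp].
  - destruct (HS x y k Hp) as [x' [y' K]]. exists (x', y'). intros _. exact K.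
  - exists (x, y). intros K. contradiction. }
set (next := fun k s => proj1_sig (constructive_indefinite_description _ (HS' s k))).
set (sq := fix sq k := match k with O => (x0, y0) | S m => next m (sq m) end).
assert (Hsq : forall k, P (fst (sq k)) (snd (sq k)) k).
{ induction k as [|k IH]; [exact H0|].
  change (sq (S k)) with (next k (sq k)). unfold next.
  destruct (constructive_indefinite_description _ (HS' (sq k) k)) as [s' K]. simpl.
  apply K, IH. }
assert (Hst : forall k, (fst (sq (S k)) = fst (sq k) \/ fst (sq (S k)) = fst (sq k) + L / 2 ^ S k)%R /\
  (snd (sq (S k)) = snd (sq k) \/ snd (sq (S k)) = snd (sq k) + M / 2 ^ S k)%R).
{ intros k. change (sq (S k)) with (next k (sq k)). unfold next.
  destruct (constructive_indefinite_description _ (HS' (sq k) k)) as [s' K]. cbn [proj1_sig].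
  destruct (K (Hsq k)) as [K1 [K2 _]]. split; assumption. }
assert (Hn : forall (A : R) (u v : R) k, (0 <= A)%R -> (v = u \/ v = u + A / 2 ^ S k)%R ->
  (u <= v)%R /\ (v + A / 2 ^ S k <= u + A / 2 ^ k)%R).
{ intros A u v k HA Hv.
  assert (E : (A / 2 ^ k = A / 2 ^ S k + A / 2 ^ S k)%R).
  { simpl. field. apply pow_nonzero; lra. }
  assert (0 <= A / 2 ^ S k)%R by (apply Rle_mult_inv_pos; [exact HA|apply pow_lt; lra]).
  rewrite E. destruct Hv as [->| ->]; lra. }
destruct (nested_intervals (fun k => fst (sq k)) L HL) as [p Hp].
{ intros k. apply (Hn L _ _ k HL), Hst. }
destruct (nested_intervals (fun k => snd (sq k)) M HM) as [q Hq].
{ intros k. apply (Hn M _ _ k HM), Hst. }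
exists p, q. intros k. exists (fst (sq k)), (snd (sq k)). auto.
Qed.

Lemma C_pair_h (s t : R) : (s, t) = RtoC t * Ci + RtoC s * 1 :> C.
Proof. unfold RtoC, Ci, Cmult, Cplus; simpl. f_equal; ring. Qed.

Lemma C_pair_v (s t : R) : (s, t) = RtoC s + RtoC t * Ci :> C.
Proof. unfold RtoC, Ci, Cmult, Cplus; simpl. f_equal; ring. Qed.

Lemma Rcont_h (phi : C -> C) s t : Ccont phi (s, t) -> Rcont (fun u => phi (u, t)) s.
Proof.
intros H. apply (Rcont_ext (fun u => phi (RtoC t * Ci + RtoC u * 1))).
{ intros u. now rewrite <- C_pair_h. }
apply (Rcont_comp phi); [apply Rcont_line|]. now rewrite <- C_pair_h.
Qed.

Lemma Rcont_v (phi : C -> C) s t : Ccont phi (s, t) -> Rcont (fun u => phi (s, u)) t.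
Proof.
intros H. apply (Rcont_ext (fun u => phi (RtoC s + RtoC u * Ci))).
{ intros u. now rewrite <- C_pair_v. }
apply (Rcont_comp phi); [apply Rcont_line|]. now rewrite <- C_pair_v.
Qed.

(** The counterclockwise boundary integral over [a, b] x [c, d]: bottom and right sides, minus top
    and left sides. *)
Definition rect_int (phi : C -> C) (a b c d : R) : C :=
  CI (fun s => phi (s, c)) a b + Ci * CI (fun t => phi (b, t)) c d
  - CI (fun s => phi (s, d)) a b - Ci * CI (fun t => phi (a, t)) c d.

Definition on_rect (P : C -> Prop) (a b c d : R) : Prop :=
  forall s t, (a <= s <= b)%R -> (c <= t <= d)%R -> P (s, t).

Lemma rect_int_split_h (phi : C -> C) a m b c d : (a <= m)%R -> (m <= b)%R -> (c <= d)%R ->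
  on_rect (fun z => Ccont phi z) a b c d ->
  rect_int phi a b c d = rect_int phi a m c d + rect_int phi m b c d.
Proof.
intros Ham Hmb Hcd H. unfold rect_int.
rewrite (CI_Chasles (fun s => phi (s, c)) a m b), (CI_Chasles (fun s => phi (s, d)) a m b);
  auto; try ring; intros t Ht; apply Rcont_h, H; lra.
Qed.

Lemma rect_int_split_v (phi : C -> C) a b c m d : (a <= b)%R -> (c <= m)%R -> (m <= d)%R ->
  on_rect (fun z => Ccont phi z) a b c d ->
  rect_int phi a b c d = rect_int phi a b c m + rect_int phi a b m d.
Proof.
intros Hab Hcm Hmd H. unfold rect_int.
rewrite (CI_Chasles (fun t => phi (a, t)) c m d), (CI_Chasles (fun t => phi (b, t)) c m d);
  auto; try ring; intros t Ht; apply Rcont_v, H; lra.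
Qed.

Lemma Cint_h_primitive (P p : C -> C) a b t : (a <= b)%R ->
  (forall z, Cderive P z (p z)) -> (forall z, Ccont p z) ->
  Cint (fun s => p (s, t)) a b (P (b, t) - P (a, t)).
Proof.
intros Hab HP Hp. rewrite !(C_pair_h _ t).
apply (Cint_FTC (fun s => P (RtoC t * Ci + RtoC s * 1))); [exact Hab| |].
- intros s _. rewrite C_pair_h. rewrite <- (Cmult_1_l (p _)). apply (RCderive_line P), HP.
- intros s _. apply Rcont_h, Hp.
Qed.

Lemma Cint_v_primitive (P p : C -> C) c d s : (c <= d)%R ->
  (forall z, Cderive P z (p z)) -> (forall z, Ccont p z) ->
  Cint (fun t => Ci * p (s, t)) c d (P (s, d) - P (s, c)).
Proof.
intros Hcd HP Hp. rewrite !(C_pair_v s).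
apply (Cint_FTC (fun t => P (RtoC s + RtoC t * Ci))); [exact Hcd| |].
- intros t _. rewrite C_pair_v. apply (RCderive_line P), HP.
- intros t _. apply Rcont_mult; [apply Rcont_const|]. apply Rcont_v, Hp.
Qed.

(* The affine approximation [A + D z] of [phi] has a primitive, so only the error [e]
   contributes to the boundary integral. *)
Lemma rect_int_bound (phi : C -> C) (A D : C) a b c d e : (a <= b)%R -> (c <= d)%R ->
  on_rect (fun z => Ccont phi z) a b c d ->
  on_rect (fun z => (Cmod (phi z - (A + D * z)) <= e)%R) a b c d ->
  (Cmod (rect_int phi a b c d) <= 2 * ((b - a) + (d - c)) * e)%R.
Proof.
intros Hab Hcd Hc He.
set (p := fun z => A + D * z). set (P := fun z => A * z + D * / 2 * z ^ 2).
assert (HP : forall z, Cderive P z (p z)).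
{ intros z. eapply Cderive_eq.
  - apply Cderive_plus; apply Cderive_mult; [apply Cderive_const|apply Cderive_id|apply Cderive_const|apply Cderive_pow].
  - unfold p; cbv beta; simpl. rewrite RtoC_plus. field. }
assert (Hp : forall z, Ccont p z).
{ intros z. apply Cex_Ccont. unfold p. cex. }
assert (B1 : forall t, (c <= t <= d)%R ->
  (Cmod (CI (fun s => phi (s, t)) a b - (P (b, t) - P (a, t))) <= (b - a) * e)%R).
{ intros t Ht. eapply (Cint_bound (fun s => phi (s, t) - p (s, t))); [exact Hab| |].
  - intros s Hs. apply He; assumption.
  - apply Cint_minus; [|apply Cint_h_primitive; assumption].
    apply CI_correct; [exact Hab|]. intros s Hs. apply Rcont_h, Hc; assumption. }
assert (B2 : forall s, (a <= s <= b)%R ->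
  (Cmod (Ci * CI (fun t => phi (s, t)) c d - (P (s, d) - P (s, c))) <= (d - c) * e)%R).
{ intros s Hs. eapply (Cint_bound (fun t => Ci * phi (s, t) - Ci * p (s, t))); [exact Hcd| |].
  - intros t Ht. replace (Ci * phi (s, t) - Ci * p (s, t)) with (Ci * (phi (s, t) - p (s, t))) by ring.
    rewrite Cmod_mult, Cmod_Ci, Rmult_1_l. apply He; assumption.
  - apply Cint_minus; [|apply Cint_v_primitive; assumption].
    apply Cint_scal. apply CI_correct; [exact Hcd|]. intros t Ht. apply Rcont_v, Hc; assumption. }
pose proof (B1 c ltac:(lra)) as C1. pose proof (B1 d ltac:(lra)) as C2.
pose proof (B2 a ltac:(lra)) as C3. pose proof (B2 b ltac:(lra)) as C4.
unfold rect_int.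
set (h1 := CI (fun s => phi (s, c)) a b) in *. set (h2 := CI (fun s => phi (s, d)) a b) in *.
set (v1 := Ci * CI (fun t => phi (a, t)) c d) in *. set (v2 := Ci * CI (fun t => phi (b, t)) c d) in *.
replace (h1 + v2 - h2 - v1) with
  ((h1 - (P (b, c) - P (a, c))) + (v2 - (P (b, d) - P (b, c))) +
   (- (h2 - (P (b, d) - P (a, d))) + - (v1 - (P (a, d) - P (a, c))))) by ring.
eapply Rle_trans; [apply Cmod_triangle|].
pose proof (Cmod_triangle (h1 - (P (b, c) - P (a, c))) (v2 - (P (b, d) - P (b, c)))).
pose proof (Cmod_triangle (- (h2 - (P (b, d) - P (a, d)))) (- (v1 - (P (a, d) - P (a, c))))).
rewrite !Cmod_opp in *. lra.
Qed.

Lemma Cmod_pair_le (u v : R) : (Cmod (u, v) <= Rabs u + Rabs v)%R.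
Proof.
rewrite C_pair_v. eapply Rle_trans; [apply Cmod_triangle|].
rewrite Cmod_mult, !Cmod_R, Cmod_Ci. lra.
Qed.

(** Some quarter always carries at least a quarter of the boundary integral, which therefore decays
    no faster than 4^(-k); at the limit point of the cells the affine approximation forces it to be
    o(4^(-k)). *)
Theorem goursat (phi : C -> C) a b c d : (a <= b)%R -> (c <= d)%R ->
  on_rect (fun z => Cex phi z) a b c d -> rect_int phi a b c d = 0.
Proof.
intros Hab Hcd H.
destruct (Req_dec (Cmod (rect_int phi a b c d)) 0) as [E|E]; [now apply Cmod_eq_0|exfalso].
(* Half of the modulus, so that the invariant of the bisection is a strict inequality already at
   depth 0. *)
set (eta := (Cmod (rect_int phi a b c d) / 2)%R).
assert (Heta : (0 < eta)%R) by (unfold eta; pose proof (Cmod_ge_0 (rect_int phi a b c d)); lra).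
set (L := (b - a)%R). set (M := (d - c)%R).
assert (HL : (0 <= L)%R) by (unfold L; lra). assert (HM : (0 <= M)%R) by (unfold M; lra).
destruct (bisection (fun x y k => (a <= x /\ x + L / 2 ^ k <= b)%R /\ (c <= y /\ y + M / 2 ^ k <= d)%R /\
    (eta / 4 ^ k < Cmod (rect_int phi x (x + L / 2 ^ k) y (y + M / 2 ^ k)))%R) L M a c HL HM)
  as [p [q Hpq]].
- simpl. replace (a + L / 1)%R with b by (unfold L; field).
  replace (c + M / 1)%R with d by (unfold M; field).
  repeat split; try lra. unfold eta; pose proof (Cmod_ge_0 (rect_int phi a b c d)); lra.
- intros x y k [Hx [Hy Hk]].
  set (l := (L / 2 ^ S k)%R) in *. set (m := (M / 2 ^ S k)%R) in *.
  assert (Hl : (L / 2 ^ k = l + l)%R) by (unfold l; simpl; field; apply pow_nonzero; lra).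
  assert (Hm : (M / 2 ^ k = m + m)%R) by (unfold m; simpl; field; apply pow_nonzero; lra).
  assert (Hl0 : (0 <= l)%R) by (unfold l; apply Rle_mult_inv_pos; [exact HL|apply pow_lt; lra]).
  assert (Hm0 : (0 <= m)%R) by (unfold m; apply Rle_mult_inv_pos; [exact HM|apply pow_lt; lra]).
  rewrite Hl, Hm in *.
  assert (Hcont : forall x1 x2 y1 y2, (a <= x1)%R -> (x2 <= b)%R -> (c <= y1)%R -> (y2 <= d)%R ->
    on_rect (fun z => Ccont phi z) x1 x2 y1 y2).
  { intros x1 x2 y1 y2 ? ? ? ? s t Hs Ht. apply Cex_Ccont, H; lra. }
  rewrite (rect_int_split_h phi x (x + l)) in Hk by (try lra; apply Hcont; lra).
  rewrite (rect_int_split_v phi x (x + l) y (y + m)) in Hk by (try lra; apply Hcont; lra).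
  rewrite (rect_int_split_v phi (x + l) (x + (l + l)) y (y + m)) in Hk by (try lra; apply Hcont; lra).
  replace (x + (l + l))%R with (x + l + l)%R in Hk by ring.
  replace (y + (m + m))%R with (y + m + m)%R in Hk by ring.
  set (r1 := rect_int phi x (x + l) y (y + m)) in *.
  set (r2 := rect_int phi x (x + l) (y + m) (y + m + m)) in *.
  set (r3 := rect_int phi (x + l) (x + l + l) y (y + m)) in *.
  set (r4 := rect_int phi (x + l) (x + l + l) (y + m) (y + m + m)) in *.
  pose proof (Cmod_triangle (r1 + r2) (r3 + r4)). pose proof (Cmod_triangle r1 r2).
  pose proof (Cmod_triangle r3 r4).
  assert (E4 : (eta / 4 ^ k = 4 * (eta / 4 ^ S k))%R) by (simpl; field; apply pow_nonzero; lra).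
  rewrite E4 in Hk. set (e := (eta / 4 ^ S k)%R) in *.
  destruct (Rlt_dec e (Cmod r1)) as [K|K1]; [exists x, y; repeat split; auto; lra|].
  destruct (Rlt_dec e (Cmod r2)) as [K|K2]; [exists x, (y + m)%R; repeat split; auto; lra|].
  destruct (Rlt_dec e (Cmod r3)) as [K|K3]; [exists (x + l)%R, y; repeat split; auto; lra|].
  destruct (Rlt_dec e (Cmod r4)) as [K|K4]; [exists (x + l)%R, (y + m)%R; repeat split; auto; lra|].
  lra.
- assert (HD : exists D, Cderive phi (p, q) D).
  { destruct (Hpq O) as [x [y [[Hx [Hy _]] [Hp Hq]]]]. apply H; lra. }
  destruct HD as [D HD].
  (* A cell scaled by h = 2^(-k) has perimeter 2 (L + M) h and error at most eps (L + M) h, so its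
     integral is at most 2 eps (L + M)^2 h^2, which must not exceed eta h^2. The added 1 covers the
     degenerate rectangle L = M = 0. *)
  set (eps := (eta / (4 * ((L + M) * (L + M) + 1)))%R).
  assert (Hq0 : (0 < (L + M) * (L + M) + 1)%R) by nra.
  assert (Heps : (0 < eps)%R) by (apply Rdiv_lt_0_compat; lra).
  destruct (proj1 (is_derive_C_eps _ _ _) HD eps Heps) as [r [Hr Hd]].
  destruct (pow_eventually_small (/ 2) (r / (L + M + 1))) as [k Hk]; [lra|apply Rdiv_lt_0_compat; lra|].
  specialize (Hk k (le_n k)).
  destruct (Hpq k) as [x [y [[Hx [Hy Hbig]] [Hp Hq]]]].
  set (h := ((/ 2) ^ k)%R) in *.
  assert (Hh : (0 < h)%R) by (apply pow_lt; lra).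
  assert (E2 : (/ 2 ^ k = h)%R) by (unfold h; rewrite pow_inv; reflexivity).
  assert (E4 : (/ 4 ^ k = h * h)%R).
  { rewrite <- E2. rewrite <- Rinv_mult. f_equal. rewrite <- Rpow_mult_distr. f_equal; lra. }
  unfold Rdiv in Hx, Hy, Hbig, Hp, Hq. rewrite E2 in *. rewrite E4 in Hbig.
  assert (Hs : ((L + M) * h < r)%R).
  { apply (Rmult_lt_compat_l (L + M + 1)) in Hk; [|lra].
    replace ((L + M + 1) * (r / (L + M + 1)))%R with r in Hk by (field; lra). nra. }
  assert (Hbd : (Cmod (rect_int phi x (x + L * h) y (y + M * h)) <=
     2 * ((x + L * h - x) + (y + M * h - y)) * (eps * ((L + M) * h)))%R).
  { assert (HLh : (0 <= L * h)%R) by nra. assert (HMh : (0 <= M * h)%R) by nra.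
    apply (rect_int_bound phi (phi (p, q) - D * (p, q)) D); try lra.
    - intros s t Hs1 Ht1. apply Cex_Ccont, H; lra.
    - intros s t Hs1 Ht1.
      replace (phi (s, t) - (phi (p, q) - D * (p, q) + D * (s, t))) with
        (phi (s, t) - phi (p, q) - ((s, t) - (p, q)) * D) by ring.
      assert (Hdist : (Cmod ((s, t) - (p, q)) <= (L + M) * h)%R).
      { eapply Rle_trans; [apply (Cmod_pair_le (s + - p) (t + - q))|].
        assert (Rabs (s + - p) <= L * h)%R by (apply Rabs_le; lra).
        assert (Rabs (t + - q) <= M * h)%R by (apply Rabs_le; lra). lra. }
      eapply Rle_trans; [apply Hd; lra|]. apply Rmult_le_compat_l; lra. }
  replace (2 * ((x + L * h - x) + (y + M * h - y)) * (eps * ((L + M) * h)))%R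
    with (2 * eps * ((L + M) * (L + M)) * (h * h))%R in Hbd by ring.
  assert (Hfin : (2 * eps * ((L + M) * (L + M)) <= eta)%R).
  { assert (E5 : (eps * (4 * ((L + M) * (L + M) + 1)) = eta)%R) by (unfold eps; field; lra).
    nra. }
  assert (0 < h * h)%R by nra. nra.
Qed.

(** * Means over concentric circles *)

Lemma Cexp_pair (s t : R) : Cexp (s, t) = RtoC (exp s) * circ t.
Proof.
rewrite C_pair_v, Cexp_plus, Cexp_RtoC. unfold circ. now rewrite (Cmult_comm (RtoC t)).
Qed.

Lemma Cmod_scaled_circ (r t : R) : (0 <= r)%R -> Cmod (RtoC r * circ t) = r.
Proof. intros Hr. rewrite Cmod_mult, Cmod_circ, Cmod_R, Rabs_pos_eq by exact Hr. ring. Qed.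

Lemma Rcont_scaled_circ (f : C -> C) r t : Ccont f (RtoC r * circ t) ->
  Rcont (fun s => f (RtoC r * circ s)) t.
Proof.
intros H. apply (Rcont_comp f (fun s => RtoC r * circ s)); [|exact H].
apply Rcont_mult; [apply Rcont_const|apply Rcont_circ].
Qed.

(* In the coordinate [log w] an annulus is a rectangle whose horizontal sides cancel. *)
Lemma annulus_invariance (f : C -> C) (r1 r2 a : R) (A B : C) : (0 < r1)%R -> (r1 <= r2)%R ->
  (forall w, (r1 <= Cmod w <= r2)%R -> Cex f w) ->
  Cint (fun t => f (RtoC r1 * circ t)) a (a + 2 * PI) A ->
  Cint (fun t => f (RtoC r2 * circ t)) a (a + 2 * PI) B -> A = B.
Proof.
intros H1 H12 Hf HA HB. pose proof PI_RGT_0.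
assert (L12 : (ln r1 <= ln r2)%R) by (apply ln_le; lra).
pose proof (goursat (fun z => f (Cexp z)) (ln r1) (ln r2) a (a + 2 * PI) L12 ltac:(lra)) as G.
assert (D : on_rect (fun z => Cex (fun z => f (Cexp z)) z) (ln r1) (ln r2) a (a + 2 * PI)).
{ intros s t Hs Ht. apply (Cex_comp Cexp f); [eexists; apply Cexp_deriv|]. apply Hf.
  rewrite Cexp_pair, Cmod_scaled_circ by apply Rlt_le, exp_pos.
  rewrite <- (exp_ln r1), <- (exp_ln r2) by lra.
  assert (X : forall u v, (u <= v)%R -> (exp u <= exp v)%R).
  { intros u v [Huv| ->]; [apply Rlt_le, exp_increasing, Huv|lra]. }
  split; apply X; lra. }
specialize (G D). unfold rect_int in G.
assert (Eh : CI (fun s => f (Cexp (s, a))) (ln r1) (ln r2) =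
  CI (fun s => f (Cexp (s, (a + 2 * PI)%R))) (ln r1) (ln r2)).
{ apply (RInt_ext (V := C_R_CompleteNormedModule)). intros s _.
  rewrite !Cexp_pair, circ_2PI. reflexivity. }
assert (V : forall r X, (0 < r)%R -> Cint (fun t => f (RtoC r * circ t)) a (a + 2 * PI) X ->
  CI (fun t => f (Cexp (ln r, t))) a (a + 2 * PI) = X).
{ intros r X Hr HX. apply (is_RInt_unique (V := C_R_CompleteNormedModule)).
  eapply Cint_ext_all; [|exact HX]. intros t. rewrite Cexp_pair, exp_ln; auto. }
rewrite Eh, (V r1 A), (V r2 B) in G by (assumption || lra).
set (h := CI _ _ _) in G.
replace A with (B - (- Ci) * (h + Ci * B - h - Ci * A)).
- rewrite G. ring.
- replace (B - (- Ci) * (h + Ci * B - h - Ci * A)) with (B + Ci * Ci * (B - A)) by ring.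
  rewrite Ci_sqr. ring.
Qed.

(** A Lebesgue number argument: continuity at each point of the circle of radius [r0] gives a radius
    depending on the angle, and compactness of [a, b] gives a common one. *)
Lemma circle_equicontinuity (f : C -> C) (r0 a b eps : R) : (0 <= r0)%R -> (0 < eps)%R ->
  (forall w, Cmod w = r0 -> Ccont f w) ->
  exists d, (0 < d)%R /\ forall r t, (Rabs (r - r0) < d)%R -> (a <= t <= b)%R ->
    (Cmod (f (RtoC r * circ t)%C - f (RtoC r0 * circ t)%C) <= eps)%R.
Proof.
intros Hr0 He Hf.
assert (K : forall u, exists d : posreal, forall r t, (Rabs (r - r0) < d)%R -> (Rabs (t - u) < d)%R ->
   (Cmod (f (RtoC r * circ t)%C - f (RtoC r0 * circ u)%C) < eps / 2)%R).
{ intros u. destruct (proj1 (Ccont_eps _ _) (Hf _ (Cmod_scaled_circ r0 u Hr0)) (eps / 2)%R) as [d1 [Hd1 H1]]; [lra|].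
  destruct (proj1 (Rcont_eps _ _) (Rcont_circ u) (d1 / (2 * (r0 + 1)))%R) as [d2 [Hd2 H2]].
  { apply Rdiv_lt_0_compat; lra. }
  assert (Hd : (0 < Rmin (d1 / 2) d2)%R) by (apply Rmin_glb_lt; lra).
  exists (mkposreal _ Hd). simpl. intros r t Hr Ht.
  pose proof (Rmin_l (d1 / 2) d2). pose proof (Rmin_r (d1 / 2) d2).
  apply H1. specialize (H2 t ltac:(lra)).
  replace (RtoC r * circ t - RtoC r0 * circ u) with
    (RtoC (r - r0) * circ t + RtoC r0 * (circ t - circ u)) by (rewrite RtoC_minus; ring).
  eapply Rle_lt_trans; [apply Cmod_triangle|].
  rewrite !Cmod_mult, !Cmod_R, Cmod_circ, (Rabs_pos_eq r0) by exact Hr0.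
  assert (X : (r0 * Cmod (circ t - circ u) <= d1 / 2)%R).
  { apply Rle_trans with (r0 * (d1 / (2 * (r0 + 1))))%R; [apply Rmult_le_compat_l; lra|].
    apply Rle_trans with ((r0 + 1) * (d1 / (2 * (r0 + 1))))%R.
    - apply Rmult_le_compat_r; [|lra]. apply Rlt_le, Rdiv_lt_0_compat; lra.
    - right. field. lra. }
  lra. }
set (delta := fun u => proj1_sig (constructive_indefinite_description _ (K u))).
destruct (compactness_value_1d a b delta) as [d Hd].
exists d. split; [apply cond_pos|]. intros r t Hr Ht.
(* [compactness_value_1d] yields a nearby centre only under a double negation, which is harmless
   once the goal is a contradiction. *)
apply Rnot_lt_le. intros Hlt. apply (Hd t Ht). intros [u [Hu [Htu Hdu]]].
unfold delta in Htu, Hdu. destruct (constructive_indefinite_description _ (K u)) as [e Ke]. simpl in *.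
pose proof (Ke r t ltac:(lra) ltac:(lra)) as K1.
assert (Hz : (Rabs (r0 - r0) < e)%R) by (rewrite Rminus_diag, Rabs_R0; apply cond_pos).
pose proof (Ke r0 t Hz ltac:(lra)) as K2.
set (x := f (RtoC r * circ t)) in *. set (y := f (RtoC r0 * circ t)) in *. set (z := f (RtoC r0 * circ u)) in *.
replace (x - y) with ((x - z) + - (y - z)) in Hlt by ring.
pose proof (Cmod_triangle (x - z) (- (y - z))) as T. rewrite Cmod_opp in T. lra.
Qed.

(* The function may fail to be differentiable on one circle (and at 0): the mean over
   circles is still continuous in the radius, and locally constant elsewhere. *)
Theorem mean_value (f : C -> C) (R0 rho r a : R) : 
  (forall w, (Cmod w < R0)%R -> Ccont f w) ->
  (forall w, (Cmod w < R0)%R -> w <> 0 -> Cmod w <> rho -> Cex f w) ->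
  (0 <= r < R0)%R -> Cint (fun t => f (RtoC r * circ t)) a (a + 2 * PI) (RtoC (2 * PI) * f 0).
Proof.
intros Hc Hd Hr. pose proof PI_RGT_0.
set (J := fun r => CI (fun t => f (RtoC r * circ t)) a (a + 2 * PI)).
assert (HJ : forall r, (0 <= r < R0)%R -> Cint (fun t => f (RtoC r * circ t)) a (a + 2 * PI) (J r)).
{ intros s Hs. apply CI_correct; [lra|]. intros t _. apply Rcont_scaled_circ, Hc.
  rewrite Cmod_scaled_circ; lra. }
assert (HJc : forall r0 eps, (0 <= r0 < R0)%R -> (0 < eps)%R -> exists d, (0 < d)%R /\
  forall s, (0 <= s < R0)%R -> (Rabs (s - r0) < d)%R -> (Cmod (J s - J r0) <= 2 * PI * eps)%R).
{ intros r0 eps Hr0 He.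
  destruct (circle_equicontinuity f r0 a (a + 2 * PI) eps) as [d [Hd0 H1]]; [lra|exact He| |].
  { intros w Hw. apply Hc. lra. }
  exists d. split; [exact Hd0|]. intros s Hs Hsd.
  replace (2 * PI * eps)%R with ((a + 2 * PI - a) * eps)%R by ring.
  apply (Cint_bound (fun t => f (RtoC s * circ t) - f (RtoC r0 * circ t))); [lra| |].
  - intros t Ht. apply H1; assumption.
  - apply Cint_minus; apply HJ; assumption. }
assert (Hann : forall r1 r2, (0 < r1)%R -> (r1 <= r2)%R -> (r2 < R0)%R -> (rho < r1 \/ r2 < rho)%R -> J r1 = J r2).
{ intros r1 r2 K1 K2 K3 K4. apply (annulus_invariance f r1 r2 a); auto; try (apply HJ; lra).
  intros w Hw. apply Hd; try lra. intros ->. rewrite Cmod_0 in Hw. lra. }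
assert (Hclose : forall x y : C, (forall eps, (0 < eps)%R -> (Cmod (x - y) <= 2 * PI * eps)%R) -> x = y).
{ intros x y Hxy. assert (E : (Cmod (x - y) <= 0)%R).
  { apply Rle_plus_epsilon. intros eps He. rewrite Rplus_0_l.
    replace eps with (2 * PI * (eps / (2 * PI)))%R by (field; lra).
    apply Hxy. apply Rdiv_lt_0_compat; lra. }
  pose proof (Cmod_ge_0 (x - y)). assert (E0 : Cmod (x - y) = 0%R) by lra.
  apply Cmod_eq_0 in E0. replace x with (x - y + y) by ring. rewrite E0. ring. }
assert (J0 : J 0%R = RtoC (2 * PI) * f 0).
{ apply (Cint_unique (fun t => f (RtoC 0 * circ t)) a (a + 2 * PI)); [apply HJ; lra|].
  eapply Cint_ext_all; [|eapply Cint_eq; [apply (Cint_const (f 0))|]].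
  - intros t. simpl. f_equal. ring.
  - replace (a + 2 * PI - a)%R with (2 * PI)%R by ring. reflexivity. }
(* Below [rho] the mean is constant and tends to its value at radius 0; at [rho] it is a limit from
   the left; beyond [rho] it is constant and tends to [J rho] from the right. For rho <= 0 no
   positive radius is exceptional and the first case covers everything. *)
assert (C1 : forall s, (0 <= s < R0)%R -> (s < rho \/ rho <= 0)%R -> J s = J 0%R).
{ intros s Hs Hrho. destruct (Req_dec s 0) as [->|Hs0]; [reflexivity|].
  apply Hclose. intros eps He. destruct (HJc 0%R eps ltac:(lra) He) as [d [Hd0 H1]].
  assert (Hm : (0 < Rmin s (d / 2))%R) by (apply Rmin_glb_lt; lra).
  pose proof (Rmin_l s (d / 2)). pose proof (Rmin_r s (d / 2)).
  rewrite <- (Hann (Rmin s (d / 2)) s) by lra.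
  apply H1; [lra|]. rewrite Rabs_pos_eq; lra. }
assert (C2 : (0 < rho < R0)%R -> J rho = J 0%R).
{ intros Hrho. apply Hclose. intros eps He. destruct (HJc rho eps ltac:(lra) He) as [d [Hd0 H1]].
  pose proof (Rmax_l 0 (rho - d / 2)). pose proof (Rmax_r 0 (rho - d / 2)).
  assert (Rmax 0 (rho - d / 2) < rho)%R by (apply Rmax_lub_lt; lra).
  rewrite <- (C1 (Rmax 0 (rho - d / 2))) by lra.
  replace (J rho - J (Rmax 0 (rho - d / 2))) with (- (J (Rmax 0 (rho - d / 2)) - J rho)) by ring.
  rewrite Cmod_opp. apply H1; [lra|]. rewrite Rabs_left; lra. }
assert (C3 : J r = J 0%R).
{ destruct (Rlt_dec r rho) as [K|K]; [apply C1; lra|].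
  destruct (Rle_dec rho 0) as [K'|K']; [apply C1; lra|].
  destruct (Req_dec r rho) as [->|Hne]; [apply C2; lra|].
  rewrite <- C2 by lra.
  apply Hclose. intros eps He. destruct (HJc rho eps ltac:(lra) He) as [d [Hd0 H1]].
  pose proof (Rmin_l r (rho + d / 2)). pose proof (Rmin_r r (rho + d / 2)).
  assert (rho < Rmin r (rho + d / 2))%R by (apply Rmin_glb_lt; lra).
  rewrite <- (Hann (Rmin r (rho + d / 2)) r) by lra.
  apply H1; [lra|]. rewrite Rabs_pos_eq; lra. }
rewrite <- J0, <- C3. apply HJ, Hr.
Qed.

(** * Taylor and Laurent expansions *)

Lemma C_minus_neq_0 (w z : C) : w <> z -> w - z <> 0.
Proof. intros H K. apply H. replace w with (w - z + z) by ring. rewrite K. ring. Qed.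

Lemma Rcont_bounded (u : R -> C) a b : (a <= b)%R ->
  (forall t, (a <= t <= b)%R -> Rcont u t) ->
  exists B, (0 <= B)%R /\ forall t, (a <= t <= b)%R -> (Cmod (u t) <= B)%R.
Proof.
intros Hab Hu. destruct (continuity_ab_maj (fun t => Cmod (u t)) a b Hab) as [m [Hm _]].
- intros t Ht. apply continuity_pt_filterlim. apply filterlim_locally. intros eps.
  destruct (proj1 (Rcont_eps _ _) (Hu t Ht) eps (cond_pos eps)) as [d [Hd H1]].
  exists (mkposreal d Hd). intros s Hs. specialize (H1 s Hs).
  unfold ball; simpl; unfold AbsRing_ball, abs, minus, plus, opp; simpl.
  eapply Rle_lt_trans; [|exact H1].
  pose proof (Cmod_triangle (u s - u t) (u t)) as T1.
  pose proof (Cmod_triangle (u t - u s) (u s)) as T2.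
  replace (u s - u t + u t) with (u s) in T1 by ring.
  replace (u t - u s + u s) with (u t) in T2 by ring.
  replace (u t - u s) with (- (u s - u t)) in T2 by ring. rewrite Cmod_opp in T2.
  apply Rabs_le. lra.
- exists (Cmod (u m)). split; [apply Cmod_ge_0|exact Hm].
Qed.

Lemma Cex_difference_quotient (f phi : C -> C) (z w : C) : w <> z ->
  (forall v, f v = f z + (v - z) * phi v) -> Cex f w -> Cex phi w.
Proof.
intros Hw E Hf. assert (Hm : (0 < Cmod (w - z))%R) by (apply Cmod_gt_0, C_minus_neq_0, Hw).
apply (Cex_near (fun v => (f v - f z) / (v - z)) phi w _ Hm).
- intros v Hv. assert (Hvz : v - z <> 0).
  { apply C_minus_neq_0. intros ->. replace (z - w) with (- (w - z)) in Hv by ring.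
    rewrite Cmod_opp in Hv. lra. }
  rewrite (E v). field. exact Hvz.
- cex. apply C_minus_neq_0, Hw.
Qed.

(** With [phi] the difference quotient of [f] at z, the function [w * phi w] is continuous,
    differentiable off the circle |w| = |z|, and zero at 0, so its mean vanishes. Since it equals (f
    w - f z) / (1 - z/w), expanding the geometric series compares f z with the partial sums. The
    coefficients are circle means and do not depend on z. *)
Theorem cauchy_taylor_0 (f : C -> C) (R0 r a : R) : (0 < r < R0)%R ->
  (forall w, (Cmod w < R0)%R -> Cex f w) ->
  exists c : nat -> C, (forall z, (Cmod z < r)%R -> is_PS c z (f z)) /\
    forall k, Cint (fun t => f (RtoC r * circ t) * (/ (RtoC r * circ t)) ^ k) a (a + 2 * PI)
      (RtoC (2 * PI) * c k).
Proof.
intros Hr Hf. pose proof PI_RGT_0.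
assert (Hnz : forall t, RtoC r * circ t <> 0).
{ intros t. apply Cmod_gt_0. rewrite Cmod_scaled_circ; lra. }
assert (Hcf : forall t, Rcont (fun t => f (RtoC r * circ t)) t).
{ intros t. apply Rcont_scaled_circ, Cex_Ccont, Hf. rewrite Cmod_scaled_circ; lra. }
assert (Hcc : forall t, Rcont (fun t => RtoC r * circ t) t).
{ intros t. rcont. apply Rcont_circ. }
set (I := fun k => CI (fun t => f (RtoC r * circ t) * (/ (RtoC r * circ t)) ^ k) a (a + 2 * PI)).
assert (HI : forall k, Cint (fun t => f (RtoC r * circ t) * (/ (RtoC r * circ t)) ^ k) a (a + 2 * PI) (I k)).
{ intros k. apply CI_correct; [lra|]. intros t _. apply Rcont_mult; [apply Hcf|].
  apply Rcont_pow. apply (Rcont_inv (fun t => RtoC r * circ t)); [apply Hnz|apply Hcc]. }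
assert (H2pi : RtoC (2 * PI) <> 0) by (intros K; apply RtoC_inj in K; lra).
exists (fun k => I k / RtoC (2 * PI)). split.
2:{ intros k. eapply Cint_eq; [apply HI|]. field. exact H2pi. }
intros z Hz.
destruct (Rcont_bounded (fun t => f (RtoC r * circ t) - f z) a (a + 2 * PI)) as [B [HB0 HB]]; [lra| |].
{ intros t _. apply Rcont_plus; [apply Hcf|apply Rcont_const]. }
set (q := (Cmod z / r)%R).
assert (Hq : (0 <= q < 1)%R).
{ unfold q. split; [apply Rle_mult_inv_pos; [apply Cmod_ge_0|lra]|].
  apply Rmult_lt_reg_r with r; [lra|]. unfold Rdiv. rewrite Rmult_assoc, Rinv_l; lra. }
destruct (Hf z ltac:(lra)) as [d Hd]. apply Caratheodory_is_derive in Hd.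
destruct Hd as [phi [Hphi [_ E]]].
assert (MV : Cint (fun t => (RtoC r * circ t) * phi (RtoC r * circ t)) a (a + 2 * PI) 0).
{ eapply Cint_eq; [apply (mean_value (fun w => w * phi w) R0 (Cmod z) r a)|ring]; [| |lra].
  - intros w Hw. apply Ccont_mult; [apply Ccont_id|].
    destruct (excluded_middle_informative (w = z)) as [->|Hne]; [exact Hphi|].
    apply Cex_Ccont, (Cex_difference_quotient f phi z w Hne E), Hf, Hw.
  - intros w Hw _ Hwz. apply Cex_mult; [apply Cex_id|].
    apply (Cex_difference_quotient f phi z w); [intros ->; auto|exact E|apply Hf, Hw]. }
assert (Hest : forall n, (Cmod (Csum (fun k => (I k / RtoC (2 * PI) * z ^ k)%C) n - f z) <= B * q ^ S n / (1 - q))%R).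
{ intros n.
  (* In the part with the constant f z only k = 0 contributes, because negative powers of [circ]
     have mean zero. *)
  assert (HS : Cint (fun t => (f (RtoC r * circ t) - f z) * Csum (fun k => z ^ k * (/ (RtoC r * circ t)) ^ k) n)
     a (a + 2 * PI) (RtoC (2 * PI) * (Csum (fun k => I k / RtoC (2 * PI) * z ^ k) n - f z))).
  { eapply Cint_ext_all; [|eapply Cint_eq;
      [apply (Cint_Csum (fun k t => z ^ k * (f (RtoC r * circ t) * (/ (RtoC r * circ t)) ^ k)
          - (f z * z ^ k * (/ RtoC r) ^ k) * (/ circ t) ^ k)
         (fun k => z ^ k * I k - (f z * z ^ k * (/ RtoC r) ^ k) * match k with O => RtoC (2 * PI) | _ => 0 end))|]].
    - intros t. cbv beta. rewrite <- Csum_scal. apply Csum_ext. intros k.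
      replace (/ (RtoC r * circ t)) with (/ RtoC r * / circ t).
      + rewrite Cpow_mult_l. ring.
      + field. split; [apply circ_neq_0|intros K; apply RtoC_inj in K; lra].
    - intros k. apply Cint_minus; [apply Cint_scal, HI|]. apply Cint_scal.
      destruct k as [|k]; [|apply Cint_circ_inv_pow].
      simpl. eapply Cint_eq; [apply Cint_const|].
      replace (a + 2 * PI - a)%R with (2 * PI)%R by ring. ring.
    - replace (RtoC (2 * PI) * (Csum (fun k => I k / RtoC (2 * PI) * z ^ k) n - f z))
        with (Csum (fun k => RtoC (2 * PI) * (I k / RtoC (2 * PI) * z ^ k)) n - RtoC (2 * PI) * f z)
        by (rewrite Csum_scal; ring).
      rewrite (Csum_ext (fun k => RtoC (2 * PI) * (I k / RtoC (2 * PI) * z ^ k)) (fun k => z ^ k * I k))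
        by (intros k; field; exact H2pi).
      clear -n. induction n as [|n IH]; simpl Csum; [simpl; ring|rewrite IH; ring]. }
  apply Rmult_le_reg_l with (2 * PI)%R; [lra|].
  replace (2 * PI * Cmod (Csum (fun k => (I k / RtoC (2 * PI) * z ^ k)%C) n - f z))%R
    with (Cmod (0 - RtoC (2 * PI) * (Csum (fun k => I k / RtoC (2 * PI) * z ^ k) n - f z))).
  2:{ assert (N0 : forall u : C, 0 - u = - u) by (intros u; ring).
    rewrite N0, Cmod_opp, Cmod_mult, Cmod_R, Rabs_pos_eq by lra. reflexivity. }
  replace (2 * PI * (B * q ^ S n / (1 - q)))%R with ((a + 2 * PI - a) * (B * q ^ S n / (1 - q)))%R by ring.
  eapply Cint_bound; [lra| |apply (Cint_minus _ _ _ _ _ _ MV HS)].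
  intros t Ht. cbv beta.
  set (w := RtoC r * circ t).
  assert (Hw : Cmod w = r) by (apply Cmod_scaled_circ; lra).
  assert (Hw0 : w <> 0) by apply Hnz.
  assert (Hwz : w - z <> 0) by (apply C_minus_neq_0; intros K; rewrite K in Hw; lra).
  set (v := z * / w).
  assert (Hv : Cmod v = q) by (unfold v, q; rewrite Cmod_mult, Cmod_inv, Hw by exact Hw0; reflexivity).
  assert (Hv1 : 1 - v <> 0).
  { apply C_minus_neq_0. intros K. rewrite <- K, Cmod_1 in Hv. lra. }
  rewrite (Csum_ext (fun k => z ^ k * (/ w) ^ k) (fun k => v ^ k))
    by (intros k; unfold v; rewrite Cpow_mult_l; reflexivity).
  (* The two integrands now differ by the geometric remainder (f w - f z) v^(n+1) / (1 - v), where v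
     = z/w has the constant modulus q. *)
  assert (EG : Csum (fun k => v ^ k) n = (1 - v ^ S n) / (1 - v)).
  { rewrite <- Csum_geom. field. exact Hv1. }
  rewrite EG.
  assert (Ew : w * phi w = (f w - f z) / (1 - v)).
  { rewrite (E w). unfold v. field. auto. }
  rewrite Ew.
  replace ((f w - f z) / (1 - v) - (f w - f z) * ((1 - v ^ S n) / (1 - v)))
    with ((f w - f z) * v ^ S n / (1 - v)) by (field; exact Hv1).
  rewrite Cmod_div, Cmod_mult, Cmod_pow, Hv by exact Hv1.
  assert (H1q : (1 - q <= Cmod (1 - v))%R).
  { pose proof (Cmod_triangle (1 - v) v) as T. replace (1 - v + v) with (RtoC 1) in T by ring.
    rewrite Cmod_1, Hv in T. lra. }
  assert (Hp : (0 <= q ^ S n)%R) by (apply pow_le; lra).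
  unfold Rdiv. apply Rmult_le_compat.
  - apply Rmult_le_pos; [apply Cmod_ge_0|exact Hp].
  - apply Rlt_le, Rinv_0_lt_compat. lra.
  - apply Rmult_le_compat_r; [exact Hp|]. apply HB, Ht.
  - apply Rinv_le_contravar; lra. }
intros eps He. destruct (geom_tail_small B q eps Hq He) as [N HN].
exists N. intros n Hn. eapply Rle_lt_trans; [apply Hest|apply HN, Hn].
Qed.

Theorem cauchy_taylor (f : C -> C) (c : C) (R0 r : R) : (0 < r < R0)%R ->
  (forall w, (Cmod (w - c) < R0)%R -> Cex f w) ->
  exists a : nat -> C, forall z, (Cmod z < r)%R -> is_PS a z (f (c + z)).
Proof.
intros Hr Hf. destruct (cauchy_taylor_0 (fun z => f (c + z)) R0 r 0 Hr) as [a [Ha _]].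
- intros w Hw. apply (Cex_comp (fun z => c + z) f); [cex|]. apply Hf.
  replace (c + w - c) with w by ring. exact Hw.
- exists a. exact Ha.
Qed.

Lemma is_PS_at_0 (a : nat -> C) : is_PS a 0 (a O).
Proof.
intros eps He. exists O. intros n _.
assert (E : Csum (fun k => a k * 0 ^ k) n = a O).
{ rewrite Csum_first; [simpl; ring|]. intros k. rewrite Cpow_S. ring. }
rewrite E. replace (a O - a O) with (RtoC 0) by ring. rewrite Cmod_0. exact He.
Qed.

Lemma is_PS_unique (a : nat -> C) (z l m : C) : is_PS a z l -> is_PS a z m -> l = m.
Proof.
intros Hl Hm.
assert (E : (Cmod (l - m) <= 0)%R).
{ apply Rle_plus_epsilon. intros eps He. rewrite Rplus_0_l.
  destruct (Hl (eps / 2)%R ltac:(lra)) as [N HN]. destruct (Hm (eps / 2)%R ltac:(lra)) as [N' HN'].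
  specialize (HN (max N N') ltac:(lia)). specialize (HN' (max N N') ltac:(lia)).
  set (s := Csum _ _) in *. replace (l - m) with (- (s - l) + (s - m)) by ring.
  eapply Rle_trans; [apply Cmod_triangle|]. rewrite Cmod_opp. lra. }
pose proof (Cmod_ge_0 (l - m)). assert (E0 : Cmod (l - m) = 0%R) by lra.
apply Cmod_eq_0 in E0. replace l with (l - m + m) by ring. rewrite E0. ring.
Qed.

Lemma is_PS_shift (a : nat -> C) (z l : C) : z <> 0 -> is_PS a z l ->
  is_PS (fun k => a (S k)) z ((l - a O) / z).
Proof.
intros Hz H eps He. assert (Hm : (0 < Cmod z)%R) by (apply Cmod_gt_0; exact Hz).
destruct (H (eps * Cmod z)%R) as [N HN]; [apply Rmult_lt_0_compat; lra|].
exists N. intros n Hn. specialize (HN (S n) ltac:(lia)).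
apply Rmult_lt_reg_r with (Cmod z); [exact Hm|].
rewrite <- Cmod_mult.
rewrite Csum_shift in HN.
rewrite (Csum_ext (fun k => (a (S k) * z ^ S k)%C) (fun k => (z * (a (S k) * z ^ k))%C)) in HN
  by (intros k; rewrite Cpow_S; ring).
rewrite Csum_scal in HN.
match goal with |- (Cmod ?x < _)%R => replace x with (a O * z ^ 0 + z * Csum (fun k => a (S k) * z ^ k) n - l) end.
- exact HN.
- simpl. field. exact Hz.
Qed.

Lemma is_PS_cons (a : nat -> C) (c z l : C) : is_PS a z l ->
  is_PS (fun k => match k with O => c | S j => a j end) z (c + z * l).
Proof.
intros H eps He.
assert (Hm : (0 < Cmod z + 1)%R) by (pose proof (Cmod_ge_0 z); lra).
destruct (H (eps / (Cmod z + 1))%R) as [N HN]; [apply Rdiv_lt_0_compat; lra|].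
exists (S N). intros n Hn. destruct n as [|n]; [lia|]. specialize (HN n ltac:(lia)).
rewrite Csum_shift.
rewrite (Csum_ext (fun k => (a k * z ^ S k)%C) (fun k => (z * (a k * z ^ k))%C))
  by (intros k; rewrite Cpow_S; ring).
rewrite Csum_scal.
replace (c * z ^ 0 + z * Csum (fun k => a k * z ^ k) n - (c + z * l))
  with (z * (Csum (fun k => a k * z ^ k) n - l)) by (simpl; ring).
rewrite Cmod_mult. set (x := Cmod (Csum (fun k => (a k * z ^ k)%C) n - l)) in *.
pose proof (Cmod_ge_0 z).
apply Rle_lt_trans with (Cmod z * (eps / (Cmod z + 1)))%R.
- apply Rmult_le_compat_l; lra.
- apply Rlt_le_trans with ((Cmod z + 1) * (eps / (Cmod z + 1)))%R; [|right; field; lra].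
  apply Rmult_lt_compat_r; [apply Rdiv_lt_0_compat|]; lra.
Qed.

Lemma is_PS_rescale (a : nat -> C) (y u l : C) : is_PS a (y * u) l ->
  is_PS (fun k => a k * y ^ k) u l.
Proof.
intros H eps He. destruct (H eps He) as [N HN]. exists N. intros n Hn.
rewrite (Csum_ext _ (fun k => (a k * (y * u) ^ k)%C)); [exact (HN n Hn)|].
intros k. rewrite Cpow_mult_l. ring.
Qed.

Lemma is_PS_zero (z : C) : is_PS (fun _ => 0) z 0.
Proof.
intros eps He. exists O. intros n _.
rewrite Csum_first; [|intros k; ring]. replace (0 * z ^ 0 - 0) with (RtoC 0) by ring.
rewrite Cmod_0. exact He.
Qed.

(** Division by w - c is a shift of the coefficients; at the centre the shifted series dictates the
    value [a 1]. *)
Lemma is_PS_quotient (f : C -> C) (c : C) (a : nat -> C) (r : R) : (0 < r)%R ->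
  (forall z, (Cmod z < r)%R -> is_PS a z (f (c + z))) ->
  exists q : C -> C, (forall w, f w = f c + (w - c) * q w) /\
    forall z, (Cmod z < r)%R -> is_PS (fun k => a (S k)) z (q (c + z)).
Proof.
intros Hr H.
assert (E0 : f c = a O).
{ apply (is_PS_unique a 0); [|apply is_PS_at_0].
  specialize (H 0). rewrite Cmod_0 in H. replace (c + 0) with c in H by ring. auto. }
exists (fun w => if excluded_middle_informative (w = c) then a 1%nat else (f w - f c) / (w - c)).
split.
- intros w. destruct (excluded_middle_informative (w = c)) as [->|Hw]; [ring|].
  field. apply C_minus_neq_0, Hw.
- intros z Hz. destruct (excluded_middle_informative (c + z = c)) as [E|E].
  + assert (Ez : z = 0) by (replace z with (c + z - c) by ring; rewrite E; ring).
    rewrite Ez. apply (is_PS_at_0 (fun k => a (S k))).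
  + assert (Ez : z <> 0) by (intros K; apply E; rewrite K; ring).
    replace (c + z - c) with z by ring. rewrite E0. apply is_PS_shift; auto.
Qed.

Lemma is_PS_Ccont (f : C -> C) (c : C) (a : nat -> C) (r : R) : (0 < r)%R ->
  (forall z, (Cmod z < r)%R -> is_PS a z (f (c + z))) -> Ccont f c.
Proof.
intros Hr H.
assert (E0 : f c = a O).
{ apply (is_PS_unique a 0); [|apply is_PS_at_0].
  specialize (H 0). rewrite Cmod_0 in H. replace (c + 0) with c in H by ring. auto. }
destruct (is_PS_terms_bounded a (RtoC (r / 2)) (f (c + RtoC (r / 2)))) as [M [HM HB]].
{ apply H. rewrite Cmod_R, Rabs_pos_eq; lra. }
rewrite Cmod_R, Rabs_pos_eq in HB by lra.
apply Ccont_eps. intros eps He.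
assert (HM1 : (0 < M + 1)%R) by lra.
(* With q = 2 |w - c| / r, the first bound gives q <= 1/2, hence a tail of at most 2 M q, and the
   second makes this smaller than eps. *)
exists (Rmin (r / 4) (eps * r / (4 * (M + 1)))). split.
{ apply Rmin_glb_lt; [lra|]. apply Rdiv_lt_0_compat; [apply Rmult_lt_0_compat|]; lra. }
intros w Hw.
assert (H1 : (Cmod (w - c) < r / 4)%R) by (eapply Rlt_le_trans; [exact Hw|apply Rmin_l]).
assert (H2 : (Cmod (w - c) < eps * r / (4 * (M + 1)))%R) by (eapply Rlt_le_trans; [exact Hw|apply Rmin_r]).
set (x := Cmod (w - c)) in *. pose proof (Cmod_ge_0 (w - c)) as Hx0. fold x in Hx0.
set (q := (x / (r / 2))%R).
assert (Eq : (q * (r / 2) = x)%R) by (unfold q; field; lra).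
assert (Hq : (0 <= q <= / 2)%R) by (split; nra).
pose proof (is_PS_tail a (w - c) (f (c + (w - c))) M q ltac:(lra)) as T.
specialize (T ltac:(intros k; rewrite Cmod_mult, Cmod_pow; fold x; rewrite <- Eq, Rpow_mult_distr, (Rmult_comm (q ^ k)), <- Rmult_assoc; apply Rmult_le_compat_r; [apply pow_le; lra|apply HB])).
specialize (T ltac:(apply H; fold x; lra) O).
replace (c + (w - c)) with w in T by ring.
simpl in T. rewrite Cmult_1_r, <- E0 in T.
replace (f w - f c) with (- (f c - f w)) by ring. rewrite Cmod_opp.
eapply Rle_lt_trans; [exact T|].
apply Rle_lt_trans with (2 * M * q)%R.
- apply Rmult_le_reg_r with (1 - q)%R; [lra|]. unfold Rdiv. rewrite Rmult_assoc, Rinv_l, !Rmult_1_r by lra.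
  assert (0 <= M * q)%R by nra. nra.
- apply Rlt_le_trans with (2 * (M + 1) * (eps / (2 * (M + 1))))%R; [|right; field; lra].
  assert (Hq2 : (q < eps / (2 * (M + 1)))%R).
  { unfold q. apply Rmult_lt_reg_r with (r / 2)%R; [lra|]. 
    replace (x / (r / 2) * (r / 2))%R with x by (field; lra).
    eapply Rlt_le_trans; [exact H2|]. right. field. lra. }
  assert (0 <= q)%R by lra. nra.
Qed.

(** * Division of a holomorphic function by a linear factor *)

Definition open_C (D : C -> Prop) : Prop :=
  forall c, D c -> exists r, (0 < r)%R /\ forall w, (Cmod (w - c) < r)%R -> D w.

(** Only the point c is delicate. There the quotient is itself the sum of a power series, so
    dividing a second time yields its own Carathéodory quotient, continuous at c. *)
Theorem holomorphic_division (D : C -> Prop) (f : C -> C) (c : C) : open_C D ->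
  (forall w, D w -> Cex f w) -> D c ->
  exists q : C -> C, (forall w, D w -> Cex q w) /\ forall w, f w = f c + (w - c) * q w.
Proof.
intros HD Hf Hc. destruct (HD c Hc) as [r [Hr Hr1]].
destruct (cauchy_taylor f c r (r / 2)) as [a Ha]; [lra|intros w Hw; apply Hf, Hr1, Hw|].
destruct (is_PS_quotient f c a (r / 2) ltac:(lra) Ha) as [q [Eq Hq]].
exists q. split; [|exact Eq]. intros w Hw.
destruct (excluded_middle_informative (w = c)) as [->|Hne].
- destruct (is_PS_quotient q c _ (r / 2) ltac:(lra) Hq) as [p [Ep Hp]].
  exists (p c). apply Caratheodory_is_derive. exists p. split; [|split; [reflexivity|exact Ep]].
  apply (is_PS_Ccont p c _ (r / 2) ltac:(lra) Hp).
- apply (Cex_difference_quotient f q c w Hne Eq), Hf, Hw.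
Qed.

(** * Laurent expansions, residues and Taylor coefficients *)

Lemma is_laurent_ext (f g : C -> C) (c : C) p q r : (0 < r)%R ->
  (forall z, (0 < Cmod (z - c) < r)%R -> f z = g z) -> is_laurent f c p q -> is_laurent g c p q.
Proof.
intros Hr E [s [Hs H]]. exists (Rmin r s). split; [apply Rmin_glb_lt; auto|].
intros z Hz. pose proof (Rmin_l r s). pose proof (Rmin_r r s).
rewrite <- E by lra. apply H. lra.
Qed.

(** Index j of the principal part stands for the exponent -j-1, so dividing by z - c pushes the
    constant coefficient [p 0] to the head of [q]. *)
Lemma laurent_div (f : C -> C) (c : C) p q : is_laurent f c p q ->
  is_laurent (fun z => f z / (z - c)) c (fun k => p (S k))
    (fun k => match k with O => p O | S j => q j end).
Proof.
intros [r [Hr H]]. exists r. split; [exact Hr|]. intros z Hz.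
destruct (H z Hz) as [s [t [Hs [Ht E]]]].
assert (Hz0 : z - c <> 0) by (apply Cmod_gt_0; lra).
exists ((s - p O) / (z - c)), (p O + / (z - c) * t). split; [|split].
- apply is_pseries_PS. apply is_PS_shift; [exact Hz0|]. apply is_pseries_PS, Hs.
- apply is_pseries_PS. apply is_PS_cons, is_pseries_PS, Ht.
- rewrite E. field. exact Hz0.
Qed.

(** The coefficient of exponent -1 is the (m-1)-th Taylor coefficient; writing m as [S j] avoids the
    subtraction and leaves out m = 0. *)
Lemma laurent_of_PS (f : C -> C) (c : C) (a : nat -> C) (r : R) : (0 < r)%R ->
  (forall z, (Cmod z < r)%R -> is_PS a z (f (c + z))) ->
  forall m, exists p q, is_laurent (fun z => f z / (z - c) ^ m) c p q /\
    (forall j, p j = a (m + j)%nat) /\ (forall j, m = S j -> q O = a j).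
Proof.
intros Hr H. induction m as [|m [p [q [HL [Hp Hq]]]]].
- exists a, (fun _ => 0). split; [|split; [reflexivity|intros j Hj; discriminate]].
  exists r. split; [exact Hr|]. intros z Hz. exists (f z), 0. split; [|split].
  + apply is_pseries_PS. replace (f z) with (f (c + (z - c))) by (f_equal; ring). apply H. lra.
  + apply is_pseries_PS, is_PS_zero.
  + simpl. field. apply Cmod_gt_0; lra.
- exists (fun k => p (S k)), (fun k => match k with O => p O | S j => q j end). split; [|split].
  + apply (is_laurent_ext (fun z => f z / (z - c) ^ m / (z - c)) _ c _ _ r Hr); [|apply laurent_div, HL].
    intros z Hz. rewrite Cpow_S. assert (Hz0 : z - c <> 0) by (apply Cmod_gt_0; lra).
    field. split; [|exact Hz0]. apply Cpow_nz, Hz0.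
  + intros j. rewrite Hp. f_equal. lia.
  + intros j Hj. injection Hj as <-. rewrite Hp. f_equal. lia.
Qed.

(** Expresses the residue by an integral, which makes it unique. Geometric domination on the circle
    of radius [rho] comes from convergence at radius (rho + r)/2 for the regular part and at radius
    rho/2, where 1/(z - c) is larger, for the principal part. *)
Theorem laurent_circle_integral (f : C -> C) (c : C) p q : is_laurent f c p q ->
  exists r, (0 < r)%R /\ forall rho a, (0 < rho < r)%R ->
    Cint (fun t => RtoC rho * circ t * f (c + RtoC rho * circ t)) a (a + 2 * PI) (RtoC (2 * PI) * q O).
Proof.
intros [r [Hr H]]. exists r. split; [exact Hr|]. intros rho a Hrho.
assert (Hnz : forall t, RtoC rho * circ t <> 0).
{ intros t. apply Cmod_gt_0. rewrite Cmod_scaled_circ; lra. }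
assert (Ec : forall u, c + u - c = u) by (intros u; ring).
assert (H' : forall t, exists st : C * C, is_PS p (RtoC rho * circ t) (fst st) /\
   is_PS q (/ (RtoC rho * circ t)) (snd st) /\
   f (c + RtoC rho * circ t) = fst st + snd st / (RtoC rho * circ t)).
{ intros t. destruct (H (c + RtoC rho * circ t)) as [s [u [Hs [Hu E]]]].
  - rewrite Ec, Cmod_scaled_circ; lra.
  - rewrite Ec in *. exists (s, u). split; [apply is_pseries_PS, Hs|split; [apply is_pseries_PS, Hu|exact E]]. }
set (ST := fun t => proj1_sig (constructive_indefinite_description _ (H' t))).
assert (HST : forall t, is_PS p (RtoC rho * circ t) (fst (ST t)) /\
   is_PS q (/ (RtoC rho * circ t)) (snd (ST t)) /\
   f (c + RtoC rho * circ t) = fst (ST t) + snd (ST t) / (RtoC rho * circ t)).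
{ intros t. unfold ST. apply (proj2_sig (constructive_indefinite_description _ (H' t))). }
assert (Hb1 : exists M, forall k, (Cmod (p k) * ((rho + r) / 2) ^ k <= M)%R).
{ destruct (H (c + RtoC ((rho + r) / 2))) as [s [u [Hs _]]].
  - rewrite Ec, Cmod_R, Rabs_pos_eq; lra.
  - rewrite Ec in Hs. apply is_pseries_PS, is_PS_terms_bounded in Hs. destruct Hs as [M [_ HM]].
    exists M. rewrite Cmod_R, Rabs_pos_eq in HM by lra. exact HM. }
assert (Hb2 : exists M, forall k, (Cmod (q k) * (/ (rho / 2)) ^ k <= M)%R).
{ destruct (H (c + RtoC (rho / 2))) as [s [u [_ [Hs _]]]].
  - rewrite Ec, Cmod_R, Rabs_pos_eq; lra.
  - rewrite Ec in Hs. apply is_pseries_PS, is_PS_terms_bounded in Hs. destruct Hs as [M [_ HM]].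
    exists M. rewrite Cmod_inv, Cmod_R, Rabs_pos_eq in HM; [exact HM|lra|].
    intros K. apply RtoC_inj in K. lra. }
destruct Hb1 as [M1 HM1]. destruct Hb2 as [M2 HM2].
set (r1 := ((rho + r) / 2)%R) in *.
assert (Hr1 : (rho < r1)%R) by (unfold r1; lra).
(* The factor [RtoC rho * circ t] shifts the regular part by one place, so the constant term of the
   series in [circ t] is 0. *)
assert (I1 : Cint (fun t => RtoC rho * circ t * fst (ST t)) a (a + 2 * PI) 0).
{ eapply Cint_eq; [apply (Cint_series (fun k => match k with O => RtoC 0 | S j => p j * RtoC rho ^ j end * RtoC rho) circ
     _ (M1 * r1) (rho / r1) a)|simpl; ring].
  - split; [apply Rle_mult_inv_pos; lra|]. apply Rmult_lt_reg_r with r1; [lra|].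
    unfold Rdiv. rewrite Rmult_assoc, Rinv_l; lra.
  - intros [|k].
    + rewrite Cmult_0_l, Cmod_0. simpl. specialize (HM1 O). simpl in HM1.
      pose proof (Cmod_ge_0 (p O)). nra.
    + rewrite !Cmod_mult, Cmod_pow, Cmod_R, Rabs_pos_eq by lra.
      replace (M1 * r1 * (rho / r1) ^ S k)%R with (M1 * (/ r1) ^ k * (rho ^ k * rho))%R.
      * rewrite Rmult_assoc. apply Rmult_le_compat_r.
        { apply Rmult_le_pos; [apply pow_le|]; lra. }
        apply Rmult_le_reg_r with (r1 ^ k)%R; [apply pow_lt; lra|].
        rewrite Rmult_assoc, <- Rpow_mult_distr, Rinv_l, pow1, Rmult_1_r by lra. apply HM1.
      * unfold Rdiv. rewrite <- tech_pow_Rmult, Rpow_mult_distr. field. lra.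
  - intros t. apply Cmod_circ.
  - intros k. apply Cint_circ_pow.
  - intros t. pose proof (is_PS_cons _ (RtoC 0) _ _ (is_PS_rescale _ _ _ _ (proj1 (HST t)))) as K.
    intros eps He. destruct (K (eps / rho)%R) as [N HN]; [apply Rdiv_lt_0_compat; lra|].
    exists N. intros n Hn. specialize (HN n Hn).
    rewrite (Csum_ext _ (fun k => (RtoC rho * (match k with O => RtoC 0 | S j => p j * RtoC rho ^ j end * circ t ^ k))%C))
      by (intros k; ring).
    rewrite Csum_scal.
    match goal with |- (Cmod ?x < _)%R => match type of HN with (Cmod ?y < _)%R =>
      replace x with (RtoC rho * y) by ring end end.
    rewrite Cmod_mult, Cmod_R, Rabs_pos_eq by lra.
    apply (Rmult_lt_compat_l rho) in HN; [|lra].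
    replace (rho * (eps / rho))%R with eps in HN by (field; lra). exact HN. }
assert (I2 : Cint (fun t => snd (ST t)) a (a + 2 * PI) (RtoC (2 * PI) * q O)).
{ eapply Cint_eq; [apply (Cint_series (fun k => q k * (/ RtoC rho) ^ k) (fun t => / circ t)
     _ M2 (/ 2) a)|simpl; ring].
  - lra.
  - intros k. rewrite Cmod_mult, Cmod_pow, Cmod_inv, Cmod_R, Rabs_pos_eq
      by (try lra; intros K; apply RtoC_inj in K; lra).
    replace ((/ rho) ^ k)%R with ((/ (rho / 2)) ^ k * (/ 2) ^ k)%R.
    + rewrite <- Rmult_assoc. apply Rmult_le_compat_r; [apply pow_le; lra|apply HM2].
    + rewrite <- Rpow_mult_distr. f_equal. field. lra.
  - intros t. rewrite Cmod_inv, Cmod_circ by apply circ_neq_0. lra.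
  - intros k. apply Cint_circ_inv_pow.
  - intros t. apply is_PS_rescale. replace (/ RtoC rho * / circ t) with (/ (RtoC rho * circ t)).
    + apply HST.
    + field. split; [apply circ_neq_0|intros K; apply RtoC_inj in K; lra]. }
eapply Cint_ext_all; [|eapply Cint_eq; [apply (Cint_plus _ _ _ _ _ _ I1 I2)|ring]].
intros t. cbv beta. destruct (HST t) as [_ [_ E]]. rewrite E. field. split; [apply circ_neq_0|].
intros K; apply RtoC_inj in K; lra.
Qed.

Lemma two_PI_neq_0 : RtoC (2 * PI) <> 0.
Proof. pose proof PI_RGT_0. intros K. apply RtoC_inj in K. lra. Qed.

Lemma Cmult_2PI_inj (a b : C) : RtoC (2 * PI) * a = RtoC (2 * PI) * b -> a = b.
Proof.
intros E. replace a with (/ RtoC (2 * PI) * (RtoC (2 * PI) * a)) by (field; apply two_PI_neq_0).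
rewrite E. field. apply two_PI_neq_0.
Qed.

Lemma laurent_residue_unique (f : C -> C) (c : C) p q p' q' :
  is_laurent f c p q -> is_laurent f c p' q' -> q O = q' O.
Proof.
intros H H'. apply laurent_circle_integral in H, H'.
destruct H as [r [Hr H]]. destruct H' as [r' [Hr' H']].
assert (Hm : (0 < Rmin r r')%R) by (apply Rmin_glb_lt; assumption).
pose proof (Rmin_l r r'). pose proof (Rmin_r r r').
apply Cmult_2PI_inj.
exact (Cint_unique _ _ _ _ _ (H (Rmin r r' / 2)%R 0%R ltac:(lra)) (H' (Rmin r r' / 2)%R 0%R ltac:(lra))).
Qed.

Lemma Residue_laurent (f : C -> C) (c : C) p q : is_laurent f c p q -> Residue f c = q O.
Proof.
intros H. apply (iota_unique (V := C_CompleteNormedModule)).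
- intros y [p' [q' [H' <-]]]. exact (laurent_residue_unique f c p' q' p q H' H).
- exists p, q. auto.
Qed.

(** [a n] is the residue at 0 of f / w^(n+1), so the Laurent formula also gives the Taylor
    coefficients and their uniqueness. *)
Lemma is_taylor_circle_integral (f : C -> C) (a : nat -> C) n : is_taylor f a ->
  exists r, (0 < r)%R /\ forall rho s, (0 < rho < r)%R ->
    Cint (fun t => f (RtoC rho * circ t) / (RtoC rho * circ t) ^ n) s (s + 2 * PI) (RtoC (2 * PI) * a n).
Proof.
intros [r [Hr H]].
destruct (laurent_of_PS f 0 a r Hr) with (m := S n) as [p [q [HL [_ Hq]]]].
{ intros z Hz. replace (0 + z) with z by ring. apply is_pseries_PS, H, Hz. }
destruct (laurent_circle_integral _ _ _ _ HL) as [r' [Hr' HI]].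
exists r'. split; [exact Hr'|]. intros rho s Hrho. rewrite <- (Hq n eq_refl).
eapply Cint_ext_all; [|apply (HI rho s Hrho)].
intros t. cbv beta. replace (0 + RtoC rho * circ t) with (RtoC rho * circ t) by ring.
replace (RtoC rho * circ t - 0) with (RtoC rho * circ t) by ring.
assert (Hnz : RtoC rho * circ t <> 0) by (apply Cmod_gt_0; rewrite Cmod_scaled_circ; lra).
rewrite Cpow_S. set (w := RtoC rho * circ t) in *. field. split; [apply Cpow_nz, Hnz|exact Hnz].
Qed.

Lemma taylor_coef_eq (f : C -> C) (a : nat -> C) n : is_taylor f a -> taylor_coef f n = a n.
Proof.
intros H. apply (iota_unique (V := C_CompleteNormedModule)).
- intros y [b [Hb <-]].
  destruct (is_taylor_circle_integral f a n H) as [r [Hr HI]].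
  destruct (is_taylor_circle_integral f b n Hb) as [r' [Hr' HI']].
  assert (Hm : (0 < Rmin r r')%R) by (apply Rmin_glb_lt; assumption).
  pose proof (Rmin_l r r'). pose proof (Rmin_r r r').
  apply Cmult_2PI_inj.
  exact (Cint_unique _ _ _ _ _ (HI' (Rmin r r' / 2)%R 0%R ltac:(lra)) (HI (Rmin r r' / 2)%R 0%R ltac:(lra))).
- exists a. auto.
Qed.

(** * Zeros and partial fractions *)

Definition eqC_dec (x y : C) : {x = y} + {x <> y} := excluded_middle_informative (x = y).

Fixpoint Cprod (l : list C) (w : C) : C :=
  match l with nil => 1 | a :: l => (w - a) * Cprod l w end.

Lemma Cprod_neq_0 (l : list C) (w : C) : ~ In w l -> Cprod l w <> 0.
Proof.
induction l as [|a l IH]; simpl; intros H.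
- intros K. apply RtoC_inj in K. lra.
- apply Cmult_neq_0; [apply C_minus_neq_0; intros ->; apply H; auto|apply IH; auto].
Qed.

Lemma Cprod_root (l : list C) (w : C) : In w l -> Cprod l w = 0.
Proof.
induction l as [|a l IH]; simpl; intros H; [contradiction|].
destruct H as [->|H]; [ring|rewrite IH by exact H; ring].
Qed.

Lemma Cex_Cprod (l : list C) (w : C) : Cex (Cprod l) w.
Proof.
induction l as [|a l IH]; [apply Cex_const|].
apply (Cex_mult (fun w => w - a) (Cprod l)); [cex|exact IH].
Qed.

Lemma Cprod_remove (a w : C) (l : list C) :
  Cprod l w = (w - a) ^ count_occ eqC_dec l a * Cprod (remove eqC_dec a l) w.
Proof.
induction l as [|b l IH]; [simpl; ring|].
simpl. destruct (eqC_dec a b) as [->|Hab].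
- destruct (eqC_dec b b) as [_|K]; [|congruence]. rewrite IH. simpl. ring.
- destruct (eqC_dec b a) as [K|_]; [congruence|]. simpl. rewrite IH. ring.
Qed.

Lemma Cprod_filter (P : C -> bool) (l : list C) (w : C) :
  Cprod l w = Cprod (filter P l) w * Cprod (filter (fun a => negb (P a)) l) w.
Proof.
induction l as [|b l IH]; [simpl; ring|].
simpl. destruct (P b); simpl; rewrite IH; ring.
Qed.

Lemma Cprod_lower_bound (l : list C) (w : C) (r : R) : (0 <= r)%R ->
  (forall a, In a l -> (r <= Cmod (w - a))%R) -> (r ^ length l <= Cmod (Cprod l w))%R.
Proof.
intros Hr. induction l as [|a l IH]; intros H; simpl; [rewrite Cmod_1; lra|].
rewrite Cmod_mult. apply Rmult_le_compat; auto; [apply pow_le, Hr|apply H; left; auto|].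
apply IH. intros b Hb. apply H. right; auto.
Qed.

Lemma Cprod_0_upper_bound (l : list C) (r : R) : (0 <= r)%R ->
  (forall a, In a l -> (Cmod a <= r)%R) -> (Cmod (Cprod l 0) <= r ^ length l)%R.
Proof.
intros Hr. induction l as [|a l IH]; intros H; simpl; [rewrite Cmod_1; lra|].
rewrite Cmod_mult. replace (0 - a) with (- a) by ring. rewrite Cmod_opp.
apply Rmult_le_compat; try apply Cmod_ge_0; [apply H; left; auto|].
apply IH. intros b Hb. apply H. right; auto.
Qed.

(* Jensen-type bound: factors with roots in [|a| <= 2] have modulus at least 3 on [|w| = 5],
   so the mean value of the cofactor [Q] at the origin is at most [M / 3 ^ N]. *)
Lemma root_count_bound (G : C -> C) (M : R) :
  (forall t, (0 <= t <= 0 + 2 * PI)%R -> (Cmod (G (RtoC 5 * circ t)%C) <= M)%R) ->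
  forall (l : list C) (Q : C -> C),
  (forall a, In a l -> (Cmod a <= 2)%R) -> (forall w, Cex Q w) ->
  (forall w, G w = Cprod l w * Q w) -> (Cmod (G 0%R) <= M * (2 / 3) ^ length l)%R.
Proof.
intros HM l Q Hl HQ E. pose proof PI_RGT_0.
pose proof (mean_value Q 6 0 5 0 (fun w _ => Cex_Ccont Q w (HQ w))
  (fun w _ _ _ => HQ w) ltac:(lra)) as MV.
assert (H3 : (0 < 3 ^ length l)%R) by (apply pow_lt; lra).
assert (HB : (Cmod (RtoC (2 * PI) * Q 0) <= (0 + 2 * PI - 0) * (M / 3 ^ length l))%R).
{ eapply Cint_bound; [lra| |exact MV]. intros t Ht.
  apply Rmult_le_reg_l with (3 ^ length l)%R; [exact H3|].
  replace (3 ^ length l * (M / 3 ^ length l))%R with M by (field; lra).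
  eapply Rle_trans; [|apply (HM t Ht)]. rewrite E, Cmod_mult.
  apply Rmult_le_compat_r; [apply Cmod_ge_0|]. apply Cprod_lower_bound; [lra|].
  intros a Ha. specialize (Hl a Ha).
  pose proof (Cmod_triangle (RtoC 5 * circ t - a) a) as T.
  replace (RtoC 5 * circ t - a + a) with (RtoC 5 * circ t) in T by ring.
  rewrite Cmod_scaled_circ in T by lra. lra. }
rewrite Cmod_mult, Cmod_R, Rabs_pos_eq in HB by lra.
assert (HQ0 : (Cmod (Q 0) <= M / 3 ^ length l)%R) by (apply Rmult_le_reg_l with (2 * PI)%R; lra).
rewrite E, Cmod_mult.
apply Rle_trans with (2 ^ length l * (M / 3 ^ length l))%R.
- apply Rmult_le_compat; try apply Cmod_ge_0; [|exact HQ0].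
  apply Cprod_0_upper_bound; [lra|exact Hl].
- right. unfold Rdiv. rewrite Rpow_mult_distr, pow_inv. ring.
Qed.

(** If zeros could be divided out for ever, N of them in |a| <= 2 would give |G 0| <= M (2/3)^N for
    every N, contradicting G 0 <> 0. No isolation of zeros is involved, and multiplicities are
    counted automatically. The radius 2 leaves room beyond the unit circle. *)
Lemma entire_factorization (G : C -> C) : (forall w, Cex G w) -> G 0 <> 0 ->
  exists (l : list C) (Q : C -> C), (forall a, In a l -> (Cmod a <= 2)%R) /\
    (forall w, Cex Q w) /\ (forall w, (Cmod w <= 2)%R -> Q w <> 0) /\
    forall w, G w = Cprod l w * Q w.
Proof.
intros HG HG0. apply NNPP. intros Hno.
assert (Hall : forall N, exists (l : list C) (Q : C -> C), length l = N /\
  (forall a, In a l -> (Cmod a <= 2)%R) /\ (forall w, Cex Q w) /\ forall w, G w = Cprod l w * Q w).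
{ induction N as [|N [l [Q [Hlen [Hl [HQ E]]]]]].
  - exists nil, G. simpl. repeat split; auto; [intros a []|intros w; ring].
  - assert (Hz : exists a, (Cmod a <= 2)%R /\ Q a = 0).
    { apply NNPP. intros K. apply Hno. exists l, Q. repeat split; auto.
      intros w Hw K'. apply K. exists w; auto. }
    destruct Hz as [a [Ha HQa]].
    destruct (holomorphic_division (fun _ => True) Q a) as [q [Hq Eq]].
    + intros c _. exists 1%R. split; [lra|auto].
    + intros w _. apply HQ.
    + exact I.
    + exists (a :: l), q. repeat split.
      * simpl. congruence.
      * intros b [<-|Hb]; auto.
      * intros w. apply Hq, I.
      * intros w. rewrite E, (Eq w), HQa. simpl. ring. }
destruct (Rcont_bounded (fun t => G (RtoC 5 * circ t)) 0 (0 + 2 * PI)) as [M [HM0 HM]].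
- pose proof PI_RGT_0; lra.
- intros t _. apply Rcont_scaled_circ, Cex_Ccont, HG.
- assert (Hg : (0 < Cmod (G 0))%R) by (apply Cmod_gt_0; exact HG0).
  destruct (pow_eventually_small (2 / 3) (Cmod (G 0) / (M + 1))) as [N HN]; [lra|apply Rdiv_lt_0_compat; lra|].
  destruct (Hall N) as [l [Q [Hlen [Hl [HQ E]]]]].
  pose proof (root_count_bound G M HM l Q Hl HQ E) as B.
  specialize (HN N (le_n N)). rewrite Hlen in B.
  apply (Rmult_lt_compat_l (M + 1)) in HN; [|lra].
  replace ((M + 1) * (Cmod (G 0) / (M + 1)))%R with (Cmod (G 0)) in HN by (field; lra).
  assert (0 < (2 / 3) ^ N)%R by (apply pow_lt; lra). nra.
Qed.

(** Finiteness provides a gap: among the listed roots, those outside the closed unit disc have a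
    least modulus. [R0] does not exceed it, nor 2, and these roots are moved into the cofactor. *)
Lemma unit_disc_factorization (G : C -> C) : (forall w, Cex G w) -> G 0 <> 0 ->
  exists (l : list C) (Q : C -> C) (R0 : R), (1 < R0)%R /\
    (forall a, In a l -> (Cmod a <= 1)%R /\ a <> 0) /\
    (forall w, Cex Q w) /\ (forall w, (Cmod w < R0)%R -> Q w <> 0) /\
    forall w, G w = Cprod l w * Q w.
Proof.
intros HG HG0. destruct (entire_factorization G HG HG0) as [l [Q [_ [HQ [HQ0 E]]]]].
set (P := fun a => if Rle_dec (Cmod a) 1 then true else false).
assert (HR : forall l, exists R0, (1 < R0 <= 2)%R /\ forall a, In a (filter (fun a => negb (P a)) l) -> (R0 <= Cmod a)%R).
{ clear. induction l as [|b l [R0 [HR IH]]].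
  - exists 2%R. split; [lra|intros a []].
  - simpl. unfold P at 1. destruct (Rle_dec (Cmod b) 1) as [K|K]; simpl.
    + exists R0. auto.
    + exists (Rmin R0 (Cmod b)). split.
      * split; [apply Rmin_glb_lt; lra|]. eapply Rle_trans; [apply Rmin_l|lra].
      * intros a [<-|Ha]; [apply Rmin_r|]. eapply Rle_trans; [apply Rmin_l|auto]. }
destruct (HR l) as [R0 [HR1 HR2]].
exists (filter P l), (fun w => Cprod (filter (fun a => negb (P a)) l) w * Q w), R0.
split; [lra|]. split; [|split; [|split]].
- intros a Ha. apply filter_In in Ha. destruct Ha as [Ha Pa]. unfold P in Pa.
  destruct (Rle_dec (Cmod a) 1) as [K|K]; [|discriminate]. split; [exact K|].
  intros ->. apply HG0. rewrite E, Cprod_root by exact Ha. ring.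
- intros w. apply Cex_mult; [apply Cex_Cprod|apply HQ].
- intros w Hw. apply Cmult_neq_0; [|apply HQ0; lra].
  apply Cprod_neq_0. intros K. apply HR2 in K. lra.
- intros w. rewrite E, (Cprod_filter P). ring.
Qed.

Fixpoint polar_sum (c : C -> C) (l : list C) (w : C) : C :=
  match l with nil => 0 | a :: l => c a / (w - a) + polar_sum c l w end.

Lemma polar_sum_ext (c d : C -> C) l w : (forall a, In a l -> c a = d a) ->
  polar_sum c l w = polar_sum d l w.
Proof.
induction l as [|a l IH]; simpl; intros H; [reflexivity|].
rewrite H, IH; auto.
Qed.

Lemma Cderive_inv_pow (a w k : C) (m : nat) : w <> a ->
  Cderive (fun w => (- k / RtoC (INR (S m))) * (/ (w - a)) ^ S m) w (k * (/ (w - a)) ^ S (S m)).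
Proof.
intros Hw. pose proof (C_minus_neq_0 w a Hw) as Hwa. eapply Cderive_eq.
- apply Cderive_mult; [apply Cderive_const|].
  apply (Cderive_comp (fun w => / (w - a)) (fun w => w ^ S m)); [|apply Cderive_pow].
  apply (Cderive_inv (fun w => w - a)); [exact Hwa|].
  apply (Cderive_plus (fun w => w) (fun _ => - a)); [apply Cderive_id|apply Cderive_const].
- cbv beta. rewrite !Cpow_S. field. split; [exact Hwa|apply INR_C_neq_0].
Qed.

(* Poles are removed one order at a time.  With the numerator [w ^ (n+1)] instead of a
   constant, a pole of order at least 2 contributes a multiple of [w ^ (n+1)] times a derivative,
   which affects neither the n-th Taylor coefficient, nor the circle integral, nor the residues. *)
Lemma partial_fractions (D : C -> Prop) (n : nat) (l : list C) : open_C D ->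
  forall A : C -> C, (forall w, D w -> Cex A w) -> (forall a, In a l -> D a /\ a <> 0) ->
  exists B c V V' : C -> C, (forall w, D w -> Cex B w) /\
    (forall w, (count_occ eqC_dec l w <= 1)%nat -> Cderive V w (V' w) /\ Cex V' w) /\
    forall w, D w -> ~ In w l ->
      A w / Cprod l w = B w + w ^ S n * (polar_sum c (nodup eqC_dec l) w + V' w).
Proof.
intros HD. induction l as [|a l IH]; intros A HA Hl.
- exists A, (fun _ => 0), (fun _ => 0), (fun _ => 0). split; [exact HA|split].
  + intros w _. split; [apply Cderive_const|apply Cex_const].
  + intros w _ _. simpl. field.
- destruct (Hl a (or_introl eq_refl)) as [Da Ha0].
  set (rest := Cprod (remove eqC_dec a l)).
  assert (Hrest : rest a <> 0) by (apply Cprod_neq_0, remove_In).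
  (* Chosen to make A - k w^(n+1) [rest] vanish at a. All copies of a are removed in [rest], so
     [rest a] is nonzero, and a itself is nonzero. *)
  set (k := A a / (a ^ S n * rest a)).
  assert (Hpa : a ^ S n <> 0) by (apply Cpow_nz, Ha0).
  destruct (holomorphic_division D (fun w => A w - k * w ^ S n * rest w) a HD) as [A1 [HA1 E1]].
  + intros w Hw. apply Cex_minus; [apply HA, Hw|].
    apply Cex_mult; [cex|apply Cex_Cprod].
  + exact Da.
  + assert (E2 : forall w, A w = k * w ^ S n * rest w + (w - a) * A1 w).
    { intros w. specialize (E1 w). cbv beta in E1.
      replace (A w) with (A w - k * w ^ S n * rest w + k * w ^ S n * rest w) by ring.
      rewrite E1. unfold k. field. auto. }
    destruct (IH A1 HA1) as [B [c [V [V' [HB [HV HE]]]]]].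
    { intros b Hb. apply Hl. right. exact Hb. }
    (* The list a :: l contains a exactly m + 1 times, so the split-off term becomes k w^(n+1) / (w
       - a)^(m+1). *)
    remember (count_occ eqC_dec l a) as m eqn:Em.
    assert (HE' : forall w, D w -> ~ In w (a :: l) -> A w / Cprod (a :: l) w =
      k * w ^ S n * (/ (w - a)) ^ S m + (B w + w ^ S n * (polar_sum c (nodup eqC_dec l) w + V' w))).
    { intros w Hw Hwl. assert (Hwa : w - a <> 0).
      { apply C_minus_neq_0. intros ->. apply Hwl. left; auto. }
      assert (Hwl' : ~ In w l) by (intros K; apply Hwl; right; exact K).
      rewrite <- (HE w Hw Hwl'). rewrite E2. simpl Cprod.
      assert (HP : Cprod l w <> 0) by (apply Cprod_neq_0, Hwl').
      rewrite Cpow_inv by exact Hwa. rewrite (Cpow_S (w - a) m).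
      pose proof (Cprod_remove a w l) as ER. fold rest in ER. rewrite <- Em in ER.
      assert (HPm : (w - a) ^ m <> 0) by (apply Cpow_nz, Hwa).
      assert (Hrw : rest w <> 0) by (intros K; rewrite K in ER; apply HP; rewrite ER; ring).
      rewrite ER. rewrite Cpow_S. field. auto. }
    (* For m = 0 the term is the simple polar part at a, and [c] may be set to k there because a
       does not occur in l. For larger m the term goes into V', while a is already represented in
       [nodup] of l. *)
    destruct m as [|m].
    * assert (Hnotin : ~ In a l) by (apply (count_occ_not_In eqC_dec); auto).
      exists B, (fun b => if eqC_dec b a then k else c b : C), V, V'. split; [exact HB|split].
      -- intros w Hw. apply HV. simpl in Hw. destruct (eqC_dec a w); lia.
      -- intros w Hw Hwl. rewrite HE' by assumption.
         simpl nodup. destruct (in_dec eqC_dec a l) as [K|_]; [contradiction|].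
         simpl polar_sum. destruct (eqC_dec a a) as [_|K]; [|congruence].
         rewrite (polar_sum_ext (fun b => if eqC_dec b a then k else c b) c).
         ++ simpl. unfold Cdiv. ring.
         ++ intros b Hb. destruct (eqC_dec b a) as [->|_]; [|reflexivity].
            apply nodup_In in Hb. contradiction.
    * exists B, c, (fun w => V w + (- k / RtoC (INR (S m))) * (/ (w - a)) ^ S m),
        (fun w => V' w + k * (/ (w - a)) ^ S (S m)). split; [exact HB|split].
      -- intros w Hw. simpl in Hw.
         assert (Hwa : w <> a).
         { intros ->. destruct (eqC_dec a a) as [_|K]; [|congruence]. lia. }
         destruct (HV w) as [HV1 HV2]; [destruct (eqC_dec a w); lia|]. split.
         ++ apply Cderive_plus; [exact HV1|]. apply Cderive_inv_pow, Hwa.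
         ++ apply Cex_plus; [exact HV2|]. cex. apply C_minus_neq_0, Hwa.
      -- intros w Hw Hwl. rewrite HE' by assumption.
         simpl nodup. destruct (in_dec eqC_dec a l) as [_|K].
         ++ ring.
         ++ apply (count_occ_not_In eqC_dec) in K. lia.
Qed.

(** * Principal values *)

(** The principal value for an arbitrary family of truncated integrands. In this form limits of
    summands truncated at the same points can be added. *)
Definition int_limit (u : R -> R -> C) (a b : R) (l : C) : Prop :=
  forall eta : R, (0 < eta)%R -> exists e0, (0 < e0)%R /\ forall eps, (0 < eps < e0)%R ->
    exists I : C, Cint (u eps) a b I /\ (Cmod (I - l) < eta)%R.

Lemma int_limit_PV (f : C -> C) a b l : int_limit (excise f) a b l -> is_PV_RInt f a b l.
Proof.
intros H P HP. apply locally_C_Cmod in HP. destruct HP as [d [Hd HP]].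
destruct (H d Hd) as [e0 [He0 H1]].
exists (mkposreal e0 He0). intros eps Heps Hpos.
destruct (H1 eps) as [I [HI Hl]].
- split; [exact Hpos|]. unfold ball in Heps; simpl in Heps.
  unfold AbsRing_ball, abs, minus, plus, opp in Heps; simpl in Heps.
  rewrite Ropp_0, Rplus_0_r, Rabs_pos_eq in Heps; lra.
- exists I. split; [exact HI|]. apply HP, Hl.
Qed.

Lemma int_limit_const (u : R -> C) a b l : Cint u a b l -> int_limit (fun _ => u) a b l.
Proof.
intros H eta He. exists 1%R. split; [lra|]. intros eps _. exists l. split; [exact H|].
replace (l - l) with (RtoC 0) by ring. rewrite Cmod_0. exact He.
Qed.

Lemma int_limit_ext (u v : R -> R -> C) a b l e : (a <= b)%R -> (0 < e)%R ->
  (forall eps t, (0 < eps < e)%R -> (a < t < b)%R -> u eps t = v eps t) ->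
  int_limit u a b l -> int_limit v a b l.
Proof.
intros Hab He E H eta Heta. destruct (H eta Heta) as [e0 [He0 H1]].
exists (Rmin e e0). split; [apply Rmin_glb_lt; assumption|]. intros eps Heps.
pose proof (Rmin_l e e0). pose proof (Rmin_r e e0).
destruct (H1 eps ltac:(lra)) as [I [HI Hl]]. exists I. split; [|exact Hl].
apply (Cint_ext (u eps)); auto. intros t Ht. apply E; lra.
Qed.

Lemma int_limit_plus (u v : R -> R -> C) a b l m : int_limit u a b l -> int_limit v a b m ->
  int_limit (fun eps t => u eps t + v eps t) a b (l + m).
Proof.
intros Hu Hv eta Heta.
destruct (Hu (eta / 2)%R ltac:(lra)) as [e1 [He1 H1]].
destruct (Hv (eta / 2)%R ltac:(lra)) as [e2 [He2 H2]].
exists (Rmin e1 e2). split; [apply Rmin_glb_lt; assumption|]. intros eps Heps.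
pose proof (Rmin_l e1 e2). pose proof (Rmin_r e1 e2).
destruct (H1 eps ltac:(lra)) as [I [HI Hl]]. destruct (H2 eps ltac:(lra)) as [J [HJ Hm]].
exists (I + J). split; [apply Cint_plus; assumption|].
replace (I + J - (l + m)) with ((I - l) + (J - m)) by ring.
eapply Rle_lt_trans; [apply Cmod_triangle|]. lra.
Qed.

Lemma int_limit_scal (c : C) (u : R -> R -> C) a b l : int_limit u a b l ->
  int_limit (fun eps t => c * u eps t) a b (c * l).
Proof.
intros Hu eta Heta. assert (Hc : (0 < Cmod c + 1)%R) by (pose proof (Cmod_ge_0 c); lra).
destruct (Hu (eta / (Cmod c + 1))%R) as [e1 [He1 H1]]; [apply Rdiv_lt_0_compat; lra|].
exists e1. split; [exact He1|]. intros eps Heps.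
destruct (H1 eps Heps) as [I [HI Hl]]. exists (c * I). split; [apply Cint_scal, HI|].
replace (c * I - c * l) with (c * (I - l)) by ring. rewrite Cmod_mult.
apply (Rmult_lt_compat_l (Cmod c + 1)) in Hl; [|exact Hc].
replace ((Cmod c + 1) * (eta / (Cmod c + 1)))%R with eta in Hl by (field; lra).
pose proof (Cmod_ge_0 (I - l)). nra.
Qed.

Lemma Cint_excise_point (u : R -> C) (a b s eps M : R) (I : C) : (0 < eps)%R ->
  (a <= s - eps)%R -> (s + eps <= b)%R -> Cint u a b I ->
  (forall t, (Rabs (t - s) <= eps)%R -> (Cmod (u t) <= M)%R) ->
  exists J : C, Cint (fun t => if Rlt_dec (Rabs (t - s)) eps then 0%R else u t) a b J /\
    (Cmod (J - I) <= 2 * eps * M)%R.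
Proof.
intros He Ha Hb HI HM.
destruct (Cint_sub u a b a (s - eps) I ltac:(lra) ltac:(lra) ltac:(lra) HI) as [I1 H1].
destruct (Cint_sub u a b (s - eps) (s + eps) I ltac:(lra) ltac:(lra) ltac:(lra) HI) as [I2 H2].
destruct (Cint_sub u a b (s + eps) b I ltac:(lra) ltac:(lra) ltac:(lra) HI) as [I3 H3].
exists (I1 + 0 + I3). split.
- apply (Cint_Chasles _ a (s + eps)); [apply (Cint_Chasles _ a (s - eps))|].
  + eapply Cint_ext; [lra| |exact H1]. intros t Ht. cbv beta.
    destruct (Rlt_dec (Rabs (t - s)) eps) as [K|K]; [|reflexivity].
    apply Rabs_def2 in K. lra.
  + eapply Cint_ext; [lra| |apply Cint_zero]. intros t Ht. cbv beta.
    destruct (Rlt_dec (Rabs (t - s)) eps) as [K|K]; [reflexivity|].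
    exfalso. apply K. apply Rabs_def1; lra.
  + eapply Cint_ext; [lra| |exact H3]. intros t Ht. cbv beta.
    destruct (Rlt_dec (Rabs (t - s)) eps) as [K|K]; [|reflexivity].
    apply Rabs_def2 in K. lra.
- assert (E : I = I1 + I2 + I3).
  { apply (Cint_unique u a b); [exact HI|].
    apply (Cint_Chasles _ a (s + eps)); [apply (Cint_Chasles _ a (s - eps))|]; assumption. }
  replace (I1 + 0 + I3 - I) with (- I2) by (rewrite E; ring).
  rewrite Cmod_opp. replace (2 * eps * M)%R with ((s + eps - (s - eps)) * M)%R by ring.
  eapply Cint_bound; [lra| |exact H2]. intros t Ht. apply HM. apply Rabs_le. lra.
Qed.

(** Like [excise], but the points are a given list instead of the poles of the integrand, so that
    each summand can be truncated at the poles of all of them. *)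
Definition excise_list (L : list R) (eps t : R) (v : C) : C :=
  if excluded_middle_informative (exists s, In s L /\ (Rabs (t - s) < eps)%R) then 0 else v.

Lemma excise_list_nil eps t v : excise_list nil eps t v = v.
Proof.
unfold excise_list. destruct (excluded_middle_informative _) as [[s [[] _]]|_]. reflexivity.
Qed.

Lemma excise_list_cons s L eps t v : excise_list (s :: L) eps t v =
  if Rlt_dec (Rabs (t - s)) eps then 0%R else excise_list L eps t v.
Proof.
unfold excise_list.
destruct (excluded_middle_informative _) as [[s' [[Es|Hin] Hs']]|Hno];
  destruct (Rlt_dec (Rabs (t - s)) eps) as [K|K]; try reflexivity.
- subst s'. contradiction.
- destruct (excluded_middle_informative _) as [_|Hno]; [reflexivity|].
  exfalso. apply Hno. exists s'. auto.
- exfalso. apply Hno. exists s. split; [left; reflexivity|exact K].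
- destruct (excluded_middle_informative _) as [[s' [Hin Hs']]|_]; [|reflexivity].
  exfalso. apply Hno. exists s'. split; [right; exact Hin|exact Hs'].
Qed.

Lemma excise_list_in s L eps t v : In s L ->
  excise_list (s :: L) eps t v = excise_list L eps t v.
Proof.
intros H. rewrite excise_list_cons. destruct (Rlt_dec _ _) as [K|K]; [|reflexivity].
unfold excise_list. destruct (excluded_middle_informative _) as [_|Hno]; [reflexivity|].
exfalso. apply Hno. exists s. auto.
Qed.

Lemma excise_list_plus L eps t v w :
  excise_list L eps t (v + w) = excise_list L eps t v + excise_list L eps t w.
Proof. unfold excise_list. destruct (excluded_middle_informative _); [ring|reflexivity]. Qed.

Lemma excise_list_scal c L eps t v :
  excise_list L eps t (c * v) = c * excise_list L eps t v.
Proof. unfold excise_list. destruct (excluded_middle_informative _); [ring|reflexivity]. Qed.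

Lemma excise_list_bound L eps t v M : (0 <= M)%R -> (Cmod v <= M)%R ->
  (Cmod (excise_list L eps t v) <= M)%R.
Proof.
intros HM H. unfold excise_list. destruct (excluded_middle_informative _); [|exact H].
rewrite Cmod_0. exact HM.
Qed.

(** A summand has to be truncated at the poles of the other summands as well. It is bounded near
    these, so each extra truncation changes the integral by O(eps); a point already in [L0] changes
    nothing. *)
Lemma int_limit_excise_more (u : R -> C) (L0 L : list R) a b l :
  int_limit (fun eps t => excise_list L0 eps t (u t)) a b l ->
  (forall s, In s L -> (a < s < b)%R /\ (In s L0 \/
     exists M e, (0 < e)%R /\ forall t, (Rabs (t - s) < e)%R -> (Cmod (u t) <= M)%R)) ->
  int_limit (fun eps t => excise_list (L ++ L0) eps t (u t)) a b l.
Proof.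
intros H0. induction L as [|s L IH]; intros HL; [exact H0|].
assert (H1 := IH (fun s' Hs' => HL s' (or_intror Hs'))).
destruct (HL s (or_introl eq_refl)) as [Hs [Hin|[M [e [He HM]]]]].
- apply (int_limit_ext (fun eps t => excise_list (L ++ L0) eps t (u t)) _ a b l 1); [lra|lra| |exact H1].
  intros eps t _ _. simpl. symmetry. apply excise_list_in. apply in_or_app. right. exact Hin.
- assert (HM0 : (0 <= M)%R).
  { eapply Rle_trans; [apply (Cmod_ge_0 (u s))|apply HM]. rewrite Rminus_diag, Rabs_R0. exact He. }
  intros eta Heta. destruct (H1 (eta / 2)%R ltac:(lra)) as [e0 [He0 H2]].
  (* Keeps the excised interval inside (a, b) and inside the region where [u] is bounded; the last
     entry makes the loss 2 eps M at most eta / 2. *)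
  set (e1 := Rmin (Rmin e0 e) (Rmin (Rmin (s - a) (b - s)) (eta / (4 * (M + 1))))).
  assert (He1 : (0 < e1)%R).
  { repeat apply Rmin_glb_lt; try lra. apply Rdiv_lt_0_compat; lra. }
  assert (B1 : (e1 <= e0)%R) by (eapply Rle_trans; [apply Rmin_l|apply Rmin_l]).
  assert (B2 : (e1 <= e)%R) by (eapply Rle_trans; [apply Rmin_l|apply Rmin_r]).
  assert (B3 : (e1 <= s - a)%R) by (eapply Rle_trans; [apply Rmin_r|eapply Rle_trans; [apply Rmin_l|apply Rmin_l]]).
  assert (B4 : (e1 <= b - s)%R) by (eapply Rle_trans; [apply Rmin_r|eapply Rle_trans; [apply Rmin_l|apply Rmin_r]]).
  assert (B5 : (e1 <= eta / (4 * (M + 1)))%R) by (eapply Rle_trans; [apply Rmin_r|apply Rmin_r]).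
  exists e1. split; [exact He1|]. intros eps Heps.
  destruct (H2 eps ltac:(lra)) as [I [HI HIl]].
  destruct (Cint_excise_point (fun t => excise_list (L ++ L0) eps t (u t)) a b s eps M I) as [J [HJ HJI]];
    try lra; [exact HI| |].
  + intros t Ht. apply excise_list_bound; [exact HM0|]. apply HM. lra.
  + exists J. split.
    * eapply Cint_ext_all; [|exact HJ]. intros t. simpl. symmetry. apply excise_list_cons.
    * replace (J - l) with ((J - I) + (I - l)) by ring.
      eapply Rle_lt_trans; [apply Cmod_triangle|].
      assert (2 * eps * M <= eta / 2)%R.
      { assert (eps * (4 * (M + 1)) <= eta)%R.
        { apply Rle_trans with (eta / (4 * (M + 1)) * (4 * (M + 1)))%R; [|right; field; lra].
          apply Rmult_le_compat_r; lra. }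
        nra. }
      lra.
Qed.

(** * The kernel of a simple pole on the unit circle *)

Lemma circ_pair t : circ t = (cos t, sin t).
Proof.
unfold circ, Cexp, Ci, Cmult, RtoC, Re, Im; simpl.
replace (0 * t - 1 * 0)%R with 0%R by ring. replace (0 * 0 + 1 * t)%R with t by ring.
rewrite exp_0. f_equal; ring.
Qed.

Lemma circ_plus s t : circ (s + t) = circ s * circ t.
Proof. unfold circ. rewrite <- Cexp_plus, RtoC_plus. f_equal. ring. Qed.

Lemma circ_0 : circ 0 = 1.
Proof. rewrite circ_pair, cos_0, sin_0. reflexivity. Qed.

Lemma circ_opp t : circ (- t) = / circ t.
Proof.
assert (E : circ (- t) * circ t = 1) by (rewrite <- circ_plus, Rplus_opp_l; apply circ_0).
replace (circ (- t)) with (circ (- t) * circ t * / circ t) by (field; apply circ_neq_0).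
rewrite E. ring.
Qed.

(** Factoring out the midpoint [circ m] leaves e^(ih) / (e^(ih) - e^(-ih)) = e^(ih) / (2 i sin h)
    with h = (t - s)/2. *)
Lemma simple_pole_on_circle (s t : R) : sin ((t - s) / 2) <> 0%R ->
  circ t / (circ t - circ s) = ((1 / 2)%R, (- (cos ((t - s) / 2) / (2 * sin ((t - s) / 2))))%R).
Proof.
intros Hs. set (h := ((t - s) / 2)%R) in *. set (m := ((t + s) / 2)%R).
assert (Et : circ t = circ m * circ h) by (rewrite <- circ_plus; f_equal; unfold m, h; field).
assert (Es : circ s = circ m * / circ h) by (rewrite <- circ_opp, <- circ_plus; f_equal; unfold m, h; field).
rewrite Et, Es, <- circ_opp.
assert (D : circ h - circ (- h) = RtoC 2 * Ci * RtoC (sin h)).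
{ rewrite !circ_pair, cos_neg, sin_neg. unfold Ci, RtoC, Cmult, Cminus, Cplus, Copp; simpl. f_equal; ring. }
assert (Hd : RtoC 2 * Ci * RtoC (sin h) <> 0).
{ apply Cmult_neq_0; [apply Cmult_neq_0|].
  - intros K; apply RtoC_inj in K; lra.
  - intros K. pose proof Cmod_Ci as M. rewrite K, Cmod_0 in M. lra.
  - intros K; apply RtoC_inj in K; lra. }
replace (circ m * circ h / (circ m * circ h - circ m * circ (- h)))
  with (circ h / (circ h - circ (- h))).
2:{ rewrite D. replace (circ m * circ h - circ m * circ (- h)) with (circ m * (circ h - circ (- h))) by ring.
    rewrite D. field. repeat split; try apply circ_neq_0.
    - intros K; apply RtoC_inj in K; lra.
    - intros K. apply Hd. rewrite K. ring. }
rewrite D.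
match goal with |- _ = ?p => replace (circ h) with (p * (RtoC 2 * Ci * RtoC (sin h))) end.
- field. split.
  + intros K; apply RtoC_inj in K; lra.
  + intros K. pose proof Cmod_Ci as M. rewrite K, Cmod_0 in M. lra.
- rewrite circ_pair. unfold Ci, RtoC, Cmult; simpl. f_equal; field; exact Hs.
Qed.

(** The primitive is -ln |sin((t - s)/2)|; the two sides of s are treated apart, each with the sign
    that makes the argument of [ln] positive. *)
Lemma half_cot_integral_left (a b s : R) : (a <= b)%R -> (s - 2 * PI < a)%R -> (b < s)%R ->
  is_RInt (fun t => - (cos ((t - s) / 2) / (2 * sin ((t - s) / 2))))%R a b
    (ln (sin ((s - a) / 2)) - ln (sin ((s - b) / 2)))%R.
Proof.
intros Hab Ha Hb.
assert (Hs : forall t, (a <= t <= b)%R -> (0 < sin ((s - t) / 2))%R).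
{ intros t Ht. apply sin_gt_0; lra. }
assert (Hs' : forall t, (a <= t <= b)%R -> (sin ((t - s) / 2) <> 0)%R).
{ intros t Ht. replace ((t - s) / 2)%R with (- ((s - t) / 2))%R by field.
  rewrite sin_neg. specialize (Hs t Ht). lra. }
replace (ln (sin ((s - a) / 2)) - ln (sin ((s - b) / 2)))%R
  with (minus (- ln (sin ((s - b) / 2)))%R (- ln (sin ((s - a) / 2)))%R)
  by (unfold minus, plus, opp; simpl; ring).
apply (is_RInt_derive (fun t => (- ln (sin ((s - t) / 2)))%R)); intros t; rewrite Rmin_left, Rmax_right by exact Hab; intros Ht.
- auto_derive; [apply (Hs t Ht)|].
  replace ((t - s) * / 2)%R with (- ((s + - t) * / 2))%R by field.
  replace ((t - s) / 2)%R with (- ((s + - t) * / 2))%R by field.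
  rewrite sin_neg, cos_neg. specialize (Hs t Ht).
  replace ((s - t) / 2)%R with ((s + - t) * / 2)%R in Hs by field. field. lra.
- apply (ex_derive_continuous (K := R_AbsRing) (V := R_NormedModule)). auto_derive.
  specialize (Hs' t Ht). intros K. apply Hs'.
  replace ((t - s) / 2)%R with ((t + - s) * / 2)%R by field. lra.
Qed.

Lemma half_cot_integral_right (a b s : R) : (a <= b)%R -> (s < a)%R -> (b < s + 2 * PI)%R ->
  is_RInt (fun t => - (cos ((t - s) / 2) / (2 * sin ((t - s) / 2))))%R a b
    (ln (sin ((a - s) / 2)) - ln (sin ((b - s) / 2)))%R.
Proof.
intros Hab Ha Hb.
assert (Hs : forall t, (a <= t <= b)%R -> (0 < sin ((t - s) / 2))%R).
{ intros t Ht. apply sin_gt_0; lra. }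
replace (ln (sin ((a - s) / 2)) - ln (sin ((b - s) / 2)))%R
  with (minus (- ln (sin ((b - s) / 2)))%R (- ln (sin ((a - s) / 2)))%R)
  by (unfold minus, plus, opp; simpl; ring).
apply (is_RInt_derive (fun t => (- ln (sin ((t - s) / 2)))%R)); intros t; rewrite Rmin_left, Rmax_right by exact Hab; intros Ht.
- auto_derive; [apply (Hs t Ht)|]. specialize (Hs t Ht).
  replace ((t - s) / 2)%R with ((t + - s) * / 2)%R in * by field. field. lra.
- apply (ex_derive_continuous (K := R_AbsRing) (V := R_NormedModule)). auto_derive.
  specialize (Hs t Ht).
  replace ((t - s) / 2)%R with ((t + - s) * / 2)%R in Hs by field. lra.
Qed.

(** The logarithms at s - eps and s + eps cancel by symmetry and those at the ends of the period by
    periodicity of |sin|. What remains is half the length 2 PI - 2 eps, with no further error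
    term. *)
Lemma simple_pole_excised_integral (a s eps : R) : (0 < eps)%R ->
  (eps < s - a)%R -> (eps < a + 2 * PI - s)%R ->
  Cint (fun t => excise_list (s :: nil) eps t (circ t / (circ t - circ s))) a (a + 2 * PI)
    (RtoC (PI - eps)).
Proof.
intros He Ha Hb. pose proof PI_RGT_0.
assert (Hsin : forall t, (a < t < a + 2 * PI)%R -> t <> s -> sin ((t - s) / 2) <> 0%R).
{ intros t Ht Hts K. destruct (Rtotal_order t s) as [Hlt|[Heq|Hgt]]; [|contradiction|].
  - assert (0 < sin ((s - t) / 2))%R by (apply sin_gt_0; lra).
    replace ((t - s) / 2)%R with (- ((s - t) / 2))%R in K by field. rewrite sin_neg in K. lra.
  - assert (0 < sin ((t - s) / 2))%R by (apply sin_gt_0; lra). lra. }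
pose proof (half_cot_integral_left a (s - eps) s ltac:(lra) ltac:(lra) ltac:(lra)) as HL.
pose proof (half_cot_integral_right (s + eps) (a + 2 * PI) s ltac:(lra) ltac:(lra) ltac:(lra)) as HR.
replace ((s - (s - eps)) / 2)%R with (eps / 2)%R in HL by field.
replace ((s + eps - s) / 2)%R with (eps / 2)%R in HR by field.
replace (sin ((a + 2 * PI - s) / 2)) with (sin ((s - a) / 2)) in HR.
2:{ replace ((a + 2 * PI - s) / 2)%R with (PI - (s - a) / 2)%R by field. now rewrite <- sin_PI_x. }
set (x := ln (sin ((s - a) / 2))) in *. set (y := ln (sin (eps / 2))) in *.
assert (E : RtoC (PI - eps) = ((1 / 2 * (s - eps - a))%R, (x - y)%R) + 0 +
   ((1 / 2 * (a + 2 * PI - (s + eps)))%R, (y - x)%R) :> C).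
{ unfold RtoC, Cplus; simpl. f_equal; field. }
assert (Hconst : forall u v, is_RInt (fun _ : R => (1 / 2)%R) u v (1 / 2 * (v - u))%R).
{ intros u v. replace (1 / 2 * (v - u))%R with (scal (v - u)%R (1 / 2)%R)
    by (unfold scal; simpl; unfold mult; simpl; ring).
  exact (is_RInt_const (V := R_NormedModule) u v (1 / 2)%R). }
rewrite E. apply (Cint_Chasles _ a (s + eps)); [apply (Cint_Chasles _ a (s - eps))|].
- apply (Cint_ext (fun t => ((1 / 2)%R, (- (cos ((t - s) / 2) / (2 * sin ((t - s) / 2))))%R))); [lra| |].
  + intros t Ht. rewrite excise_list_cons, excise_list_nil.
    destruct (Rlt_dec (Rabs (t - s)) eps) as [K|K]; [apply Rabs_def2 in K; lra|].
    symmetry. apply simple_pole_on_circle, Hsin; lra.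
  + apply Cint_pair; [apply Hconst|exact HL].
- apply (Cint_ext (fun _ => RtoC 0)); [lra| |apply Cint_zero].
  intros t Ht. rewrite excise_list_cons.
  destruct (Rlt_dec (Rabs (t - s)) eps) as [K|K]; [reflexivity|].
  exfalso. apply K. apply Rabs_def1; lra.
- apply (Cint_ext (fun t => ((1 / 2)%R, (- (cos ((t - s) / 2) / (2 * sin ((t - s) / 2))))%R))); [lra| |].
  + intros t Ht. rewrite excise_list_cons, excise_list_nil.
    destruct (Rlt_dec (Rabs (t - s)) eps) as [K|K]; [apply Rabs_def2 in K; lra|].
    symmetry. apply simple_pole_on_circle, Hsin; lra.
  + apply Cint_pair; [apply Hconst|exact HR].
Qed.

Lemma simple_pole_int_limit (a s : R) : (a < s < a + 2 * PI)%R ->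
  int_limit (fun eps t => excise_list (s :: nil) eps t (circ t / (circ t - circ s)))
    a (a + 2 * PI) (RtoC PI).
Proof.
intros Hs eta Heta. exists (Rmin eta (Rmin (s - a) (a + 2 * PI - s))). split.
{ repeat apply Rmin_glb_lt; lra. }
intros eps Heps. pose proof (Rmin_l eta (Rmin (s - a) (a + 2 * PI - s))).
pose proof (Rmin_r eta (Rmin (s - a) (a + 2 * PI - s))).
pose proof (Rmin_l (s - a) (a + 2 * PI - s)). pose proof (Rmin_r (s - a) (a + 2 * PI - s)).
exists (RtoC (PI - eps)). split; [apply simple_pole_excised_integral; lra|].
rewrite <- RtoC_minus, Cmod_R. replace (PI - eps - PI)%R with (- eps)%R by ring.
rewrite Rabs_Ropp, Rabs_pos_eq; lra.
Qed.

(** * Poles in the closed unit disc and their excision points *)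

Lemma circ_inj_period (a s t : R) : (a < s < a + 2 * PI)%R -> (a < t < a + 2 * PI)%R ->
  circ s = circ t -> s = t.
Proof.
intros Hs Ht E. destruct (Req_dec s t) as [->|Hne]; [reflexivity|exfalso].
assert (Hsin : sin ((t - s) / 2) <> 0%R).
{ intros K. destruct (Rtotal_order t s) as [Hlt|[Heq|Hgt]]; [|now apply Hne|].
  - assert (0 < sin ((s - t) / 2))%R by (apply sin_gt_0; lra).
    replace ((t - s) / 2)%R with (- ((s - t) / 2))%R in K by field. rewrite sin_neg in K. lra.
  - assert (0 < sin ((t - s) / 2))%R by (apply sin_gt_0; lra). lra. }
pose proof (circ_plus s (t - s)) as E1. replace (s + (t - s))%R with t in E1 by ring.
rewrite <- E in E1.
assert (E2 : circ (t - s) = 1).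
{ replace (circ (t - s)) with (/ circ s * (circ s * circ (t - s))) by (field; apply circ_neq_0).
  rewrite <- E1. field. apply circ_neq_0. }
rewrite circ_pair in E2. apply (f_equal fst) in E2. simpl in E2.
replace (t - s)%R with (2 * ((t - s) / 2))%R in E2 by field.
rewrite cos_2a_sin in E2. apply Hsin. nra.
Qed.

Lemma circ_INR (t : R) (k : nat) : circ (t + 2 * PI * INR k) = circ t.
Proof.
rewrite !circ_pair. replace (t + 2 * PI * INR k)%R with (t + 2 * INR k * PI)%R by ring.
now rewrite cos_period, sin_period.
Qed.

Lemma circ_IZR (t : R) (k : Z) : circ (t + 2 * PI * IZR k) = circ t.
Proof.
destruct (Z.le_gt_cases 0 k) as [Hk|Hk].
- rewrite <- (Z2Nat.id k Hk), <- INR_IZR_INZ. apply circ_INR.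
- rewrite <- (circ_INR (t + 2 * PI * IZR k) (Z.to_nat (- k))). f_equal.
  rewrite INR_IZR_INZ, Z2Nat.id, opp_IZR by lia. ring.
Qed.

Lemma circ_arg (a : R) (w : C) : Cmod w = 1%R -> w <> circ a ->
  exists s, (a < s < a + 2 * PI)%R /\ circ s = w.
Proof.
intros Hw Hwa. pose proof PI_RGT_0.
assert (Hw0 : w <> 0) by (apply Cmod_gt_0; lra).
set (y := ((Carg w - a) / (2 * PI))%R).
set (k := (up y - 1)%Z).
assert (Hk : (IZR k <= y < IZR k + 1)%R).
{ unfold k. rewrite minus_IZR. destruct (archimed y). lra. }
set (s := (Carg w + 2 * PI * IZR (- k))%R).
assert (Ey : (Carg w = a + 2 * PI * y)%R) by (unfold y; field; lra).
assert (Hcs : circ s = w).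
{ unfold s. rewrite circ_IZR. rewrite (Carg_polar w Hw0) at 2. rewrite Hw. unfold circ. ring. }
assert (Hs : (a <= s < a + 2 * PI)%R).
{ unfold s. rewrite opp_IZR, Ey. split; nra. }
exists s. split; [|exact Hcs]. split; [|lra].
destruct (Req_dec a s) as [E|E]; [|lra]. exfalso. apply Hwa. rewrite <- Hcs, <- E. reflexivity.
Qed.

(** Supplies the excision points of one period; that [circ a] is not a root keeps the end points out
    of the list. *)
Lemma circ_preimages (a : R) (l : list C) : ~ In (circ a) l ->
  exists L : list R, forall s, In s L <-> (a < s < a + 2 * PI)%R /\ In (circ s) l.
Proof.
induction l as [|w l IH]; intros Ha.
- exists nil. intros s. simpl. tauto.
- destruct IH as [L HL]; [intros K; apply Ha; right; exact K|].
  destruct (excluded_middle_informative (exists s, (a < s < a + 2 * PI)%R /\ circ s = w)) as [[s0 [Hs0 E0]]|Hno].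
  + exists (s0 :: L). intros s. simpl. rewrite HL. split.
    * intros [<-|[Hs Hin]]; [split; auto|split; auto].
    * intros [Hs [Hin|Hin]]; [left|right; auto].
      apply (circ_inj_period a); auto. rewrite E0. exact Hin.
  + exists L. intros s. rewrite HL. simpl. split; [tauto|].
    intros [Hs [Hin|Hin]]; [|auto]. exfalso. apply Hno. exists s. auto.
Qed.

Lemma geometric_PS (a u : C) : (Cmod a < 1)%R -> Cmod u = 1%R ->
  is_PS (fun k => a ^ k) u (/ (1 - a * u)).
Proof.
intros Ha Hu eps He. set (v := a * u).
assert (Hv : Cmod v = Cmod a) by (unfold v; rewrite Cmod_mult, Hu; ring).
assert (Hv1 : 1 - v <> 0) by (apply C_minus_neq_0; intros K; rewrite <- K, Cmod_1 in Hv; lra).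
pose proof (proj1 (Cmod_gt_0 _) Hv1) as Hm.
destruct (pow_eventually_small (Cmod a) (eps * Cmod (1 - v))) as [N HN];
  [split; [apply Cmod_ge_0|exact Ha]|nra|].
exists N. intros n Hn.
rewrite (Csum_ext _ (fun k => v ^ k)) by (intros k; unfold v; rewrite Cpow_mult_l; reflexivity).
apply Rmult_lt_reg_r with (Cmod (1 - v)); [exact Hm|].
rewrite <- Cmod_mult.
replace ((Csum (fun k => v ^ k) n - / (1 - v)) * (1 - v)) with (- v ^ S n).
- rewrite Cmod_opp, Cmod_pow, Hv. apply HN. lia.
- replace ((Csum (fun k => v ^ k) n - / (1 - v)) * (1 - v))
    with (Csum (fun k => v ^ k) n * (1 - v) - 1) by (field; exact Hv1).
  rewrite Csum_geom. ring.
Qed.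

(** On the unit circle w / (w - a) is the sum of the (a / w)^k, of which only the constant term 1
    has a nonzero mean. *)
Lemma inner_pole_circle_integral (a : C) (b : R) : (Cmod a < 1)%R ->
  Cint (fun t => circ t / (circ t - a)) b (b + 2 * PI) (RtoC (2 * PI)).
Proof.
intros Ha. eapply Cint_eq.
- apply (Cint_series (fun k => a ^ k) (fun t => / circ t) _ 1 (Cmod a) b).
  + split; [apply Cmod_ge_0|exact Ha].
  + intros k. rewrite Cmod_pow. lra.
  + intros t. rewrite Cmod_inv, Cmod_circ by apply circ_neq_0. lra.
  + intros k. apply Cint_circ_inv_pow.
  + intros t.
    assert (H1 : circ t - a <> 0).
    { apply C_minus_neq_0. intros K. pose proof (Cmod_circ t) as M. rewrite K in M. lra. }
    replace (circ t / (circ t - a)) with (/ (1 - a * / circ t)).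
    * apply geometric_PS; [exact Ha|]. rewrite Cmod_inv, Cmod_circ by apply circ_neq_0. lra.
    * field. split; [exact H1|apply circ_neq_0].
- simpl. ring.
Qed.

Lemma circle_pole_bounded (w : C) (s : R) : circ s <> w ->
  exists M e, (0 < e)%R /\ forall t, (Rabs (t - s) < e)%R -> (Cmod (circ t / (circ t - w)) <= M)%R.
Proof.
intros Hw.
assert (Hc : Rcont (fun t => circ t * / (circ t + - w)) s).
{ rcont; [apply Rcont_circ|exact (C_minus_neq_0 _ _ Hw)|apply Rcont_circ]. }
destruct (proj1 (Rcont_eps _ _) Hc 1%R Rlt_0_1) as [e [He H]].
exists (1 + Cmod (circ s * / (circ s + - w)))%R, e. split; [exact He|].
intros t Ht. specialize (H t Ht). cbv beta in H.
set (x := circ t * / (circ t + - w)) in *. set (y := circ s * / (circ s + - w)) in *.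
change (Cmod x <= 1 + Cmod y)%R.
replace x with ((x - y) + y) by ring. eapply Rle_trans; [apply Cmod_triangle|]. lra.
Qed.

(** [Theta] enters here. For w = x zeta_k, [- ln (Cmod w)] is Im theta_k: positive for an interior
    pole, whose mean counts in full, and zero for a pole on the circle, whose principal value is
    half of that. Points of [L] that do not map to w cost nothing in the limit. *)
Lemma unit_disc_pole_int_limit (b : R) (L : list R) (w : C) :
  (forall s, In s L -> (b < s < b + 2 * PI)%R) -> w <> 0 -> (Cmod w <= 1)%R ->
  (Cmod w = 1%R -> exists s, In s L /\ circ s = w) ->
  int_limit (fun eps t => excise_list L eps t (circ t / (circ t - w))) b (b + 2 * PI)
    (RtoC (2 * PI) * RtoC (Theta (- ln (Cmod w)))).
Proof.
intros HL Hw0 Hw Hin. pose proof PI_RGT_0. apply Cmod_gt_0 in Hw0.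
assert (Hmore : forall s, In s L -> circ s <> w -> (b < s < b + 2 * PI)%R /\
   exists M e, (0 < e)%R /\ forall t, (Rabs (t - s) < e)%R -> (Cmod (circ t / (circ t - w)) <= M)%R).
{ intros s Hs Hsw. split; [apply HL, Hs|apply circle_pole_bounded, Hsw]. }
destruct (Rlt_dec (Cmod w) 1) as [K|K].
- assert (HT : Theta (- ln (Cmod w)) = 1%R).
  { unfold Theta. destruct (Rlt_dec 0 (- ln (Cmod w))) as [_|C0]; [reflexivity|].
    exfalso. apply C0. pose proof (ln_increasing _ 1 Hw0 K). rewrite ln_1 in *. lra. }
  rewrite HT, Cmult_1_r. rewrite <- (app_nil_r L).
  apply int_limit_excise_more.
  + apply (int_limit_ext (fun _ t => circ t / (circ t - w)) _ _ _ _ 1); [lra|lra| |].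
    * intros eps t _ _. symmetry. apply excise_list_nil.
    * apply int_limit_const, inner_pole_circle_integral, K.
  + intros s Hs. destruct (Hmore s Hs) as [H1 H2]; [|auto].
    intros E. pose proof (Cmod_circ s) as M. rewrite E in M. lra.
- assert (E1 : Cmod w = 1%R) by lra.
  destruct (Hin E1) as [s0 [Hs0 E0]].
  assert (HT : Theta (- ln (Cmod w)) = (1 / 2)%R).
  { rewrite E1, ln_1, Ropp_0. unfold Theta. destruct (Rlt_dec 0 0) as [C0|_]; [lra|].
    destruct (Req_EM_T 0 0) as [_|C0]; [reflexivity|congruence]. }
  rewrite HT, <- RtoC_mult. replace (2 * PI * (1 / 2))%R with PI by field.
  (* [s0] already belongs to [L], so appending it does not change the truncation; it isolates the
     singular point as the base case to which the others are added. *)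
  apply (int_limit_ext (fun eps t => excise_list (L ++ s0 :: nil) eps t (circ t / (circ t - w))) _ _ _ _ 1);
    [lra|lra| |].
  + intros eps t _ _. unfold excise_list.
    destruct (excluded_middle_informative _) as [[s [Hs Hse]]|Hno];
      destruct (excluded_middle_informative _) as [[s' [Hs' Hse']]|Hno']; try reflexivity; exfalso.
    * apply Hno'. exists s. split; [|exact Hse]. apply in_app_or in Hs.
      destruct Hs as [Hs|[<-|[]]]; assumption.
    * apply Hno. exists s'. split; [|exact Hse']. apply in_or_app. left. exact Hs'.
  + apply int_limit_excise_more.
    * rewrite <- E0. apply simple_pole_int_limit, HL, Hs0.
    * intros s Hs. split; [apply HL, Hs|].
      destruct (excluded_middle_informative (circ s = w)) as [E|E].
      -- left. left. apply (circ_inj_period b); [apply HL, Hs0|apply HL, Hs|congruence].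
      -- right. apply Hmore; assumption.
Qed.

Fixpoint Clist_sum {T : Type} (f : T -> C) (l : list T) : C :=
  match l with nil => 0 | a :: l => f a + Clist_sum f l end.

Lemma polar_sum_int_limit (b : R) (L : list R) (c : C -> C) (l : list C) :
  (forall s, In s L -> (b < s < b + 2 * PI)%R) ->
  (forall w, In w l -> w <> 0 /\ (Cmod w <= 1)%R /\ (Cmod w = 1%R -> exists s, In s L /\ circ s = w)) ->
  int_limit (fun eps t => excise_list L eps t (circ t * polar_sum c l (circ t))) b (b + 2 * PI)
    (RtoC (2 * PI) * Clist_sum (fun w => RtoC (Theta (- ln (Cmod w))) * c w) l).
Proof.
intros HL. pose proof PI_RGT_0. induction l as [|w l IH]; intros Hl.
- apply (int_limit_ext (fun _ _ => RtoC 0) _ _ _ _ 1); [lra|lra| |].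
  + intros eps t _ _. simpl. unfold excise_list. destruct (excluded_middle_informative _); [reflexivity|ring].
  + simpl. rewrite Cmult_0_r. apply int_limit_const, Cint_zero.
- destruct (Hl w (or_introl eq_refl)) as [H0 [H1 H2]].
  apply (int_limit_ext (fun eps t => c w * excise_list L eps t (circ t / (circ t - w)) +
     excise_list L eps t (circ t * polar_sum c l (circ t))) _ _ _ _ 1); [lra|lra| |].
  + intros eps t _ _. rewrite <- excise_list_scal, <- excise_list_plus. f_equal. simpl. unfold Cdiv. ring.
  + simpl Clist_sum.
    replace (RtoC (2 * PI) * (RtoC (Theta (- ln (Cmod w))) * c w + Clist_sum (fun w => RtoC (Theta (- ln (Cmod w))) * c w) l))
      with (c w * (RtoC (2 * PI) * RtoC (Theta (- ln (Cmod w)))) +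
        RtoC (2 * PI) * Clist_sum (fun w => RtoC (Theta (- ln (Cmod w))) * c w) l) by ring.
    apply int_limit_plus.
    * apply int_limit_scal, unit_disc_pole_int_limit; assumption.
    * apply IH. intros w' Hw'. apply Hl. right. exact Hw'.
Qed.

Lemma regular_int_limit (b : R) (L : list R) (u : R -> C) (l : C) :
  (forall s, In s L -> (b < s < b + 2 * PI)%R) -> (forall t, Rcont u t) ->
  Cint u b (b + 2 * PI) l ->
  int_limit (fun eps t => excise_list L eps t (u t)) b (b + 2 * PI) l.
Proof.
intros HL Hu Hl. pose proof PI_RGT_0. rewrite <- (app_nil_r L). apply int_limit_excise_more.
- apply (int_limit_ext (fun _ => u) _ _ _ _ 1); [lra|lra| |apply int_limit_const, Hl].
  intros eps t _ _. symmetry. apply excise_list_nil.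
- intros s Hs. split; [apply HL, Hs|]. right.
  destruct (proj1 (Rcont_eps _ _) (Hu s) 1%R Rlt_0_1) as [e [He H1]].
  exists (1 + Cmod (u s))%R, e. split; [exact He|]. intros t Ht. specialize (H1 t Ht).
  replace (u t) with ((u t - u s) + u s) by ring. eapply Rle_trans; [apply Cmod_triangle|]. lra.
Qed.

(** * Residues in the angular variable *)

Definition ei (theta : C) : C := Cexp (Ci * theta).

Lemma ei_neq_0 theta : ei theta <> 0.
Proof. apply Cexp_neq_0. Qed.

Lemma Cderive_ei theta : Cderive ei theta (Ci * ei theta).
Proof.
eapply Cderive_eq.
- apply (Cderive_comp (fun z => Ci * z) Cexp); [|apply Cexp_deriv].
  apply Cderive_mult; [apply Cderive_const|apply Cderive_id].
- cbv beta. unfold ei. ring.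
Qed.

Lemma Cex_ei theta : Cex ei theta.
Proof. eexists. apply Cderive_ei. Qed.

Lemma Cex_comp_ei (f : C -> C) theta : Cex f (ei theta) -> Cex (fun z => f (ei z)) theta.
Proof. apply (Cex_comp ei f), Cex_ei. Qed.

(** The derivative of [ei] never vanishes, so each value is taken with multiplicity one; the slope
    [Ci * ei theta0] is what determines the residue. *)
Lemma ei_minus_factor (theta0 : C) : exists u : C -> C, (forall theta, Cex u theta) /\
  u theta0 = Ci * ei theta0 /\ forall theta, ei theta - ei theta0 = (theta - theta0) * u theta.
Proof.
destruct (holomorphic_division (fun _ => True) (fun z => ei z - ei theta0) theta0) as [u [Hu E]].
- intros c _. exists 1%R. split; [lra|auto].
- intros w _. apply Cex_minus; [apply Cex_ei|apply Cex_const].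
- exact I.
- exists u. split; [intros theta; apply Hu, I|]. split.
  + apply (Cderive_unique ei theta0); [|apply Cderive_ei].
    apply Caratheodory_is_derive. exists u. split; [apply Cex_Ccont, Hu, I|split; [reflexivity|]].
    intros w. specialize (E w). cbv beta in E.
    replace (ei w) with ((ei w - ei theta0) + ei theta0) by ring. rewrite E. ring.
  + intros theta. rewrite (E theta). cbv beta. ring.
Qed.

(** Each root equal to [ei theta0] contributes one factor theta - theta0 and a nonzero cofactor; the
    other roots go into [U]. Thus m is the multiplicity of [ei theta0] in l, possibly 0. *)
Lemma ei_pullback_factor (l : list C) (theta0 : C) : exists (m : nat) (U : C -> C),
  (forall theta, Cex U theta) /\ U theta0 <> 0 /\
  forall theta, Cprod l (ei theta) = (theta - theta0) ^ m * U theta.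
Proof.
induction l as [|a l [m [U [HU [HU0 E]]]]].
- exists O, (fun _ => RtoC 1). split; [intros; apply Cex_const|split].
  + intros K; apply RtoC_inj in K; lra.
  + intros theta. simpl. ring.
- destruct (eqC_dec (ei theta0) a) as [<-|Ha].
  + destruct (ei_minus_factor theta0) as [u [Hu [Hu0 Eu]]].
    exists (S m), (fun theta => u theta * U theta). split; [intros theta; apply Cex_mult; auto|split].
    * apply Cmult_neq_0; [|exact HU0]. rewrite Hu0. apply Cmult_neq_0; [exact Ci_neq_0|apply ei_neq_0].
    * intros theta. simpl. rewrite Eu, E. ring.
  + exists m, (fun theta => (ei theta - a) * U theta). split; [|split].
    * intros theta. apply Cex_mult; [|apply HU]. apply Cex_minus; [apply Cex_ei|apply Cex_const].
    * apply Cmult_neq_0; [apply C_minus_neq_0, Ha|exact HU0].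
    * intros theta. simpl. rewrite E. ring.
Qed.

Lemma Ccont_nonzero_near (f : C -> C) (c : C) : Ccont f c -> f c <> 0 ->
  exists r, (0 < r)%R /\ forall z, (Cmod (z - c) < r)%R -> f z <> 0.
Proof.
intros Hf Hc. pose proof (proj1 (Cmod_gt_0 _) Hc) as Hm.
destruct (proj1 (Ccont_eps _ _) Hf _ Hm) as [r [Hr H]].
exists r. split; [exact Hr|]. intros z Hz K. specialize (H z Hz). rewrite K in H.
replace (0 - f c) with (- f c) in H by ring. rewrite Cmod_opp in H. lra.
Qed.

Lemma small_circle_mean (h : C -> C) (c : C) (r rho a : R) : (0 < rho < r)%R ->
  (forall z, (Cmod (z - c) < r)%R -> Cex h z) ->
  Cint (fun t => h (c + RtoC rho * circ t)) a (a + 2 * PI) (RtoC (2 * PI) * h c).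
Proof.
intros Hrho Hh.
assert (H1 : forall w, (Cmod w < r)%R -> Cex (fun z => h (c + z)) w).
{ intros w Hw. apply (Cex_comp (fun z => c + z) h); [cex|]. apply Hh.
  replace (c + w - c) with w by ring. exact Hw. }
eapply Cint_eq.
- apply (mean_value (fun z => h (c + z)) r 0 rho a); [| |lra].
  + intros w Hw. apply Cex_Ccont, H1, Hw.
  + intros w Hw _ _. apply H1, Hw.
- cbv beta. do 2 f_equal. ring.
Qed.

Lemma small_circle_zero (h : C -> C) (c : C) (r rho a : R) : (0 < rho < r)%R ->
  (forall z, (Cmod (z - c) < r)%R -> Cex h z) ->
  Cint (fun t => RtoC rho * circ t * h (c + RtoC rho * circ t)) a (a + 2 * PI) 0.
Proof.
intros Hrho Hh.
eapply Cint_ext_all; [|eapply Cint_eq; [apply (small_circle_mean (fun z => (z - c) * h z) c r rho a Hrho)|ring]].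
- intros t. cbv beta. ring.
- intros z Hz. apply Cex_mult; [cex|apply Hh, Hz].
Qed.

(** When w = ei theta0 the integrand becomes ei / u along the circle, with [u] the factor of
    [ei_minus_factor], and ei theta0 / u theta0 = 1 / i = -i. Otherwise the term is holomorphic. *)
Lemma polar_term_small_circle (theta0 w : C) (r rho a : R) : (0 < rho < r)%R ->
  (forall theta, (0 < Cmod (theta - theta0) < r)%R -> ei theta <> w) ->
  Cint (fun t => RtoC rho * circ t * (ei (theta0 + RtoC rho * circ t) / (ei (theta0 + RtoC rho * circ t) - w)))
    a (a + 2 * PI) (RtoC (2 * PI) * (if eqC_dec w (ei theta0) then - Ci else 0)).
Proof.
intros Hrho Hw. destruct (eqC_dec w (ei theta0)) as [->|Hne].
- destruct (ei_minus_factor theta0) as [u [Hu [Hu0 Eu]]].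
  assert (Hunz : forall theta, (Cmod (theta - theta0) < r)%R -> u theta <> 0).
  { intros theta Ht K. destruct (eqC_dec theta theta0) as [->|Hne].
    - rewrite Hu0 in K. revert K. apply Cmult_neq_0; [exact Ci_neq_0|apply ei_neq_0].
    - apply (Hw theta).
      + split; [apply Cmod_gt_0, C_minus_neq_0, Hne|exact Ht].
      + replace (ei theta) with ((ei theta - ei theta0) + ei theta0) by ring.
        rewrite Eu, K. ring. }
  eapply Cint_ext_all; [|eapply Cint_eq; [apply (small_circle_mean (fun z => ei z / u z) theta0 r rho a Hrho)|]].
  + intros t. cbv beta. rewrite Eu.
    replace (theta0 + RtoC rho * circ t - theta0) with (RtoC rho * circ t) by ring.
    field. split; [|split; [apply circ_neq_0|intros K; apply RtoC_inj in K; lra]].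
    apply Hunz. replace (theta0 + RtoC rho * circ t - theta0) with (RtoC rho * circ t) by ring.
    rewrite Cmod_scaled_circ; lra.
  + intros z Hz. apply Cex_div; [apply Hunz, Hz|apply Cex_ei|apply Hu].
  + cbv beta. rewrite Hu0, <- Ci_inv. f_equal. field. split; [exact Ci_neq_0|apply ei_neq_0].
- eapply Cint_eq; [apply (small_circle_zero (fun z => ei z / (ei z - w)) theta0 r rho a Hrho)|ring].
  intros z Hz. apply Cex_div; [|apply Cex_ei|apply Cex_minus; [apply Cex_ei|apply Cex_const]].
  apply C_minus_neq_0. destruct (eqC_dec z theta0) as [->|Hz0]; [congruence|].
  apply Hw. split; [apply Cmod_gt_0, C_minus_neq_0, Hz0|exact Hz].
Qed.

Lemma polar_sum_small_circle (theta0 : C) (c : C -> C) (l : list C) (r rho a : R) : (0 < rho < r)%R ->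
  (forall theta, (0 < Cmod (theta - theta0) < r)%R -> ~ In (ei theta) l) ->
  Cint (fun t => RtoC rho * circ t * (ei (theta0 + RtoC rho * circ t) * polar_sum c l (ei (theta0 + RtoC rho * circ t))))
    a (a + 2 * PI) (RtoC (2 * PI) * Clist_sum (fun w => c w * (if eqC_dec w (ei theta0) then - Ci else 0)) l).
Proof.
intros Hrho. induction l as [|w l IH]; intros Hl.
- simpl. eapply Cint_ext_all; [|eapply Cint_eq; [apply Cint_zero|ring]]. intros t. cbv beta. ring.
- eapply Cint_ext_all; [|eapply Cint_eq; [apply Cint_plus;
    [apply (Cint_scal (c w)), (polar_term_small_circle theta0 w r rho a Hrho)|apply IH]|]].
  + intros t. simpl. unfold Cdiv. ring.
  + intros theta Ht K. apply (Hl theta Ht). left. auto.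
  + intros theta Ht K. apply (Hl theta Ht). right. exact K.
  + simpl Clist_sum. ring.
Qed.

Lemma Clist_sum_single (c : C -> C) (a d : C) (l : list C) : NoDup l ->
  Clist_sum (fun w => c w * (if eqC_dec w a then d else 0)) l = if in_dec eqC_dec a l then c a * d else 0.
Proof.
induction 1 as [|w l Hw Hl IH]; [reflexivity|].
simpl Clist_sum. rewrite IH.
destruct (in_dec eqC_dec a (w :: l)) as [K|K]; destruct (in_dec eqC_dec a l) as [K'|K'];
  destruct (eqC_dec w a) as [E|E]; try ring; try (subst w; ring);
  exfalso; simpl in K; subst; tauto.
Qed.

(* The residue is read off a small circle, where the exact derivative [V'] contributes nothing. *)
Lemma residue_of_decomposition (F h B V V' c : C -> C) (l : list C) (theta0 : C) (m : nat) (r : R) :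
  (0 < r)%R -> NoDup l -> In (ei theta0) l ->
  (forall z, (Cmod (z - theta0) < r)%R -> Cex h z) ->
  (forall z, (0 < Cmod (z - theta0) < r)%R -> F z = h z / (z - theta0) ^ m) ->
  (forall z, (Cmod (z - theta0) < r)%R -> Cex B z) ->
  (forall z, (0 < Cmod (z - theta0) < r)%R -> ~ In (ei z) l /\
     Cderive V (ei z) (V' (ei z)) /\ Cex V' (ei z) /\
     F z = B z + ei z * (polar_sum c l (ei z) + V' (ei z))) ->
  Residue F theta0 = - Ci * c (ei theta0).
Proof.
intros Hr Hnd Hin Hh HF HB Hdec.
(* The factorised form provides a Laurent expansion of F, without which [Residue] would carry no
   information; the decomposition is then used to evaluate the same circle integral. *)
destruct (cauchy_taylor h theta0 r (r / 2) ltac:(lra) Hh) as [a Ha].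
destruct (laurent_of_PS h theta0 a (r / 2) ltac:(lra) Ha m) as [p [q [HL _]]].
assert (HLF : is_laurent F theta0 p q).
{ apply (is_laurent_ext (fun z => h z / (z - theta0) ^ m) F theta0 p q r Hr); [|exact HL].
  intros z Hz. symmetry. apply HF, Hz. }
rewrite (Residue_laurent F theta0 p q HLF).
destruct (laurent_circle_integral F theta0 p q HLF) as [r' [Hr' HI]].
set (rho := (Rmin r r' / 2)%R).
assert (Hm : (0 < Rmin r r')%R) by (apply Rmin_glb_lt; assumption).
pose proof (Rmin_l r r'). pose proof (Rmin_r r r').
assert (Hrho : (0 < rho < r)%R) by (unfold rho; lra).
assert (Hrho' : (0 < rho < r')%R) by (unfold rho; lra).
assert (Hpt : forall t, (0 < Cmod (theta0 + RtoC rho * circ t - theta0) < r)%R).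
{ intros t. replace (theta0 + RtoC rho * circ t - theta0) with (RtoC rho * circ t) by ring.
  rewrite Cmod_scaled_circ; lra. }
pose proof (small_circle_zero B theta0 r rho 0 Hrho HB) as I1.
pose proof (polar_sum_small_circle theta0 c l r rho 0 Hrho (fun z Hz => proj1 (Hdec z Hz))) as I2.
assert (I3 : Cint (fun t => RtoC rho * circ t * (ei (theta0 + RtoC rho * circ t) * V' (ei (theta0 + RtoC rho * circ t))))
   0 (0 + 2 * PI) 0).
(* Since ei' = i ei, the function -i V(ei z) is a primitive of ei z V'(ei z). *)
{ apply (Cint_circle_derive (fun z => - Ci * V (ei z)) (fun z => ei z * V' (ei z))).
  - intros t. destruct (Hdec _ (Hpt t)) as [_ [HV _]]. eapply Cderive_eq.
    + apply Cderive_mult; [apply Cderive_const|].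
      apply (Cderive_comp ei V); [apply Cderive_ei|exact HV].
    + cbv beta. set (e := ei (theta0 + RtoC rho * circ t)).
      transitivity (- (Ci * Ci) * (e * V' e)); [ring|rewrite Ci_sqr; ring].
  - intros t. destruct (Hdec _ (Hpt t)) as [_ [_ [HV' _]]].
    apply Cex_Ccont, Cex_mult; [apply Cex_ei|apply Cex_comp_ei, HV']. }
apply Cmult_2PI_inj.
apply (Cint_unique (fun t => RtoC rho * circ t * F (theta0 + RtoC rho * circ t)) 0 (0 + 2 * PI)); [apply HI, Hrho'|].
eapply Cint_ext_all; [|eapply Cint_eq; [apply (Cint_plus _ _ _ _ _ _ I1 (Cint_plus _ _ _ _ _ _ I2 I3))|]].
- intros t. cbv beta. destruct (Hdec _ (Hpt t)) as [_ [_ [_ E]]]. rewrite E. ring.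
- rewrite Clist_sum_single by exact Hnd.
  destruct (in_dec eqC_dec (ei theta0) l) as [_|K]; [ring|contradiction].
Qed.

Lemma pole_of_factor (F h : C -> C) (c : C) (m : nat) (r : R) : (0 < r)%R -> Ccont h c -> h c <> 0 ->
  (forall z, (0 < Cmod (z - c) < r)%R -> F z = h z / (z - c) ^ S m) -> is_pole F c.
Proof.
intros Hr Hh Hc HF. pose proof (proj1 (Cmod_gt_0 _) Hc) as Hm.
destruct (proj1 (Ccont_eps _ _) Hh (Cmod (h c) / 2)%R) as [r1 [Hr1 H1]]; [lra|].
intros P [M HM].
set (M' := (Rabs M + 1)%R). assert (HM' : (0 < M')%R) by (unfold M'; pose proof (Rabs_pos M); lra).
(* Within distance 1 of c, |z - c|^(m+1) <= |z - c|, so |F z| exceeds |h c| / (2 |z - c|); the last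
   entry makes this larger than M'. *)
set (d := Rmin (Rmin r r1) (Rmin 1 (Cmod (h c) / (2 * M')))).
assert (Hd : (0 < d)%R).
{ repeat apply Rmin_glb_lt; try lra. apply Rdiv_lt_0_compat; lra. }
assert (B1 : (d <= r)%R) by (eapply Rle_trans; [apply Rmin_l|apply Rmin_l]).
assert (B2 : (d <= r1)%R) by (eapply Rle_trans; [apply Rmin_l|apply Rmin_r]).
assert (B3 : (d <= 1)%R) by (eapply Rle_trans; [apply Rmin_r|apply Rmin_l]).
assert (B4 : (d <= Cmod (h c) / (2 * M'))%R) by (eapply Rle_trans; [apply Rmin_r|apply Rmin_r]).
apply locally_C_Cmod. exists d. split; [exact Hd|]. intros z Hz Hne. apply HM.
assert (Hz0 : z - c <> 0) by (apply C_minus_neq_0, Hne).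
pose proof (proj1 (Cmod_gt_0 _) Hz0) as Hzm.
rewrite HF by lra. rewrite Cmod_div, Cmod_pow by (apply Cpow_nz, Hz0).
set (x := Cmod (z - c)) in *.
assert (Hx1 : (x ^ S m <= x)%R).
{ simpl. rewrite <- (Rmult_1_r x) at 3. apply Rmult_le_compat_l; [lra|].
  rewrite <- (pow1 m). apply pow_incr. lra. }
assert (Hxp : (0 < x ^ S m)%R) by (apply pow_lt; lra).
specialize (H1 z ltac:(fold x; lra)).
assert (Hhz : (Cmod (h c) / 2 < Cmod (h z))%R).
{ pose proof (Cmod_triangle (h z) (- (h z - h c))) as T. rewrite Cmod_opp in T.
  replace (h z + - (h z - h c)) with (h c) in T by ring. lra. }
apply Rlt_trans with M'; [unfold M'; pose proof (Rle_abs M); lra|].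
apply Rmult_lt_reg_r with (x ^ S m)%R; [exact Hxp|].
unfold Rdiv at 1. rewrite Rmult_assoc, Rinv_l, Rmult_1_r by lra.
apply Rle_lt_trans with (M' * x)%R; [apply Rmult_le_compat_l; lra|].
apply Rlt_trans with (M' * (Cmod (h c) / (2 * M')))%R; [apply Rmult_lt_compat_l; lra|].
replace (M' * (Cmod (h c) / (2 * M')))%R with (Cmod (h c) / 2)%R by (field; lra). exact Hhz.
Qed.

Lemma Ccont_not_pole (F : C -> C) (c : C) : Ccont F c -> ~ is_pole F c.
Proof.
intros HF Hp.
assert (H1 : Rbar_locally p_infty (fun y => (Cmod (F c) + 1 < y)%R)) by (exists (Cmod (F c) + 1)%R; auto).
apply Hp in H1. apply locally_C_Cmod in H1. destruct H1 as [d [Hd H1]].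
destruct (proj1 (Ccont_eps _ _) HF 1%R Rlt_0_1) as [d' [Hd' H2]].
set (e := (Rmin d d' / 2)%R).
assert (Hm : (0 < Rmin d d')%R) by (apply Rmin_glb_lt; assumption).
pose proof (Rmin_l d d'). pose proof (Rmin_r d d').
assert (E : c + RtoC e - c = RtoC e) by ring.
assert (He : Cmod (c + RtoC e - c) = e) by (rewrite E, Cmod_R, Rabs_pos_eq; unfold e; lra).
specialize (H1 (c + RtoC e)). specialize (H2 (c + RtoC e)). rewrite He in *.
specialize (H2 ltac:(unfold e; lra)).
assert (K : (Cmod (F c) + 1 < Cmod (F (c + RtoC e)%C))%R).
{ apply H1; [unfold e; lra|]. intros K. rewrite K in E. replace (c - c) with (RtoC 0) in E by ring.
  apply RtoC_inj in E. unfold e in E. lra. }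
pose proof (Cmod_triangle (F (c + RtoC e) - F c) (F c)) as T.
replace (F (c + RtoC e) - F c + F c) with (F (c + RtoC e)) in T by ring. lra.
Qed.

Lemma Cex_polar_sum (c : C -> C) (l : list C) (w : C) : ~ In w l -> Cex (polar_sum c l) w.
Proof.
induction l as [|a l IH]; intros H; [apply Cex_const|].
apply (Cex_plus (fun w => c a / (w - a)) (polar_sum c l)).
- cex. apply C_minus_neq_0. intros ->. apply H. left. reflexivity.
- apply IH. intros K. apply H. right. exact K.
Qed.

(** * Taylor coefficients of the pieces *)

Lemma taylor_coef_unit_circle (B : C -> C) (R0 a : R) (n : nat) : (1 < R0)%R ->
  (forall w, (Cmod w < R0)%R -> Cex B w) ->
  Cint (fun t => B (circ t) * (/ circ t) ^ n) a (a + 2 * PI) (RtoC (2 * PI) * taylor_coef B n).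
Proof.
intros HR HB. destruct (cauchy_taylor_0 B R0 1 a ltac:(lra) HB) as [c [Hc HI]].
rewrite (taylor_coef_eq B c n).
- eapply Cint_ext_all; [|apply (HI n)]. intros t. cbv beta.
  replace (RtoC 1 * circ t) with (circ t) by ring. reflexivity.
- exists 1%R. split; [lra|]. intros z Hz. apply is_pseries_PS, Hc, Hz.
Qed.

Lemma Cex_is_taylor (f : C -> C) (r : R) : (0 < r)%R -> (forall w, (Cmod w < r)%R -> Cex f w) ->
  exists a, is_taylor f a.
Proof.
intros Hr Hf. destruct (cauchy_taylor_0 f r (r / 2) 0 ltac:(lra) Hf) as [c [Hc _]].
exists c. exists (r / 2)%R. split; [lra|]. intros z Hz. apply is_pseries_PS, Hc, Hz.
Qed.

(** Divided by w^n, the remainder w^(n+1) H becomes w H, whose mean over a small circle is zero. *)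
Lemma taylor_coef_remainder (f B H : C -> C) (r : R) (n : nat) : (0 < r)%R ->
  (forall w, (Cmod w < r)%R -> Cex f w /\ Cex B w /\ Cex H w /\ f w = B w + w ^ S n * H w) ->
  taylor_coef f n = taylor_coef B n.
Proof.
intros Hr Hall.
destruct (Cex_is_taylor f r Hr (fun w Hw => proj1 (Hall w Hw))) as [a Ha].
destruct (Cex_is_taylor B r Hr (fun w Hw => proj1 (proj2 (Hall w Hw)))) as [b Hb].
rewrite (taylor_coef_eq f a n Ha), (taylor_coef_eq B b n Hb).
destruct (is_taylor_circle_integral f a n Ha) as [r1 [Hr1 I1]].
destruct (is_taylor_circle_integral B b n Hb) as [r2 [Hr2 I2]].
set (rho := (Rmin r (Rmin r1 r2) / 2)%R).
assert (Hm : (0 < Rmin r (Rmin r1 r2))%R) by (repeat apply Rmin_glb_lt; assumption).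
pose proof (Rmin_l r (Rmin r1 r2)). pose proof (Rmin_r r (Rmin r1 r2)).
pose proof (Rmin_l r1 r2). pose proof (Rmin_r r1 r2).
apply Cmult_2PI_inj.
apply (Cint_unique (fun t => f (RtoC rho * circ t) / (RtoC rho * circ t) ^ n) 0 (0 + 2 * PI)).
- apply I1. unfold rho; lra.
- assert (I3 : Cint (fun t => RtoC rho * circ t * H (0 + RtoC rho * circ t)) 0 (0 + 2 * PI) 0).
  { apply (small_circle_zero H 0 r rho 0); [unfold rho; lra|].
    intros z Hz. replace (z - 0) with z in Hz by ring. apply Hall, Hz. }
  eapply Cint_ext_all; [|eapply Cint_eq; [apply (Cint_plus _ _ _ _ _ _ (I2 rho 0%R ltac:(unfold rho; lra)) I3)|ring]].
  intros t. cbv beta. replace (0 + RtoC rho * circ t) with (RtoC rho * circ t) by ring.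
  assert (Hw : Cmod (RtoC rho * circ t) = rho) by (apply Cmod_scaled_circ; unfold rho; lra).
  set (w := RtoC rho * circ t) in *.
  assert (Hw0 : w <> 0) by (apply Cmod_gt_0; rewrite Hw; unfold rho; lra).
  destruct (Hall w) as [_ [_ [_ E]]]; [rewrite Hw; unfold rho; lra|].
  rewrite E, Cpow_S. field. apply Cpow_nz, Hw0.
Qed.

Lemma taylor_coef_rescale (f : C -> C) (y : C) (r : R) (n : nat) : (0 < r)%R ->
  (forall w, (Cmod w < r)%R -> Cex f w) ->
  taylor_coef (fun z => f (y * z)) n = y ^ n * taylor_coef f n.
Proof.
intros Hr Hf. destruct (cauchy_taylor_0 f r (r / 2) 0 ltac:(lra) Hf) as [c [Hc _]].
rewrite (taylor_coef_eq f c n), (taylor_coef_eq _ (fun k => c k * y ^ k) n).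
- ring.
- assert (Hy : (0 < Cmod y + 1)%R) by (pose proof (Cmod_ge_0 y); lra).
  exists (r / 2 / (Cmod y + 1))%R. split; [apply Rdiv_lt_0_compat; lra|].
  intros z Hz. apply is_pseries_PS, is_PS_rescale, Hc. rewrite Cmod_mult.
  apply (Rmult_lt_compat_l (Cmod y + 1)) in Hz; [|exact Hy].
  replace ((Cmod y + 1) * (r / 2 / (Cmod y + 1)))%R with (r / 2)%R in Hz by (field; lra).
  pose proof (Cmod_ge_0 z). nra.
- exists (r / 2)%R. split; [lra|]. intros z Hz. apply is_pseries_PS, Hc, Hz.
Qed.

(** * The points theta_k *)

Lemma ei_theta_pt (x z : C) : x * z <> 0 -> ei (theta_pt x z) = x * z.
Proof.
intros H. pose proof (proj1 (Cmod_gt_0 _) H) as Hm. unfold ei, theta_pt.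
replace (Ci * (RtoC (Carg (x * z)) - Ci * RtoC (ln (Cmod (x * z)))))
  with (RtoC (ln (Cmod (x * z))) + Ci * RtoC (Carg (x * z))).
- rewrite Cexp_plus, Cexp_RtoC, exp_ln by exact Hm. symmetry. apply Carg_polar, H.
- replace (Ci * (RtoC (Carg (x * z)) - Ci * RtoC (ln (Cmod (x * z)))))
    with (Ci * RtoC (Carg (x * z)) - (Ci * Ci) * RtoC (ln (Cmod (x * z)))) by ring.
  rewrite Ci_sqr. ring.
Qed.

Lemma Im_theta_pt (x z : C) : Im (theta_pt x z) = (- ln (Cmod (x * z)))%R.
Proof. unfold theta_pt, Ci, RtoC, Cminus, Cplus, Copp, Cmult, Im; simpl. ring. Qed.

(** A repeated root would leave a factor (ei theta - a)^2, whose derivative vanishes at theta0. This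
    turns simplicity in the variable theta into multiplicity one in the list, the condition under
    which V' is regular. *)
Lemma simple_zero_count (l : list C) (Q : C -> C) (theta0 : C) : (forall w, Cex Q w) ->
  is_simple_zero (fun theta => Cprod l (ei theta) * Q (ei theta)) theta0 ->
  (count_occ eqC_dec l (ei theta0) <= 1)%nat.
Proof.
intros HQ [_ [d [Hd Hd0]]]. set (a := ei theta0) in *.
destruct (count_occ eqC_dec l a) as [|[|m]] eqn:Em; [lia|lia|exfalso]. apply Hd0.
set (X := fun w => (w - a) ^ m * Cprod (remove eqC_dec a l) w * Q w).
assert (HX : Cex (fun theta => X (ei theta)) theta0).
{ apply Cex_comp_ei. unfold X. apply Cex_mult; [|apply HQ]. apply Cex_mult; [cex|apply Cex_Cprod]. }
destruct HX as [e He].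
apply (Cderive_unique (fun theta => Cprod l (ei theta) * Q (ei theta)) theta0 _ _ Hd).
apply (is_derive_ext (K := C_AbsRing) (V := C_NormedModule)
  (fun theta => (ei theta - a) * ((ei theta - a) * X (ei theta)))).
- intros theta. change ((ei theta - a) * ((ei theta - a) * X (ei theta)) = Cprod l (ei theta) * Q (ei theta)).
  rewrite (Cprod_remove a (ei theta) l), Em. unfold X. rewrite !Cpow_S. ring.
- assert (HD : Cderive (fun theta => ei theta - a) theta0 (Ci * a + 0)).
  { apply (Cderive_plus ei (fun _ => - a)); [apply Cderive_ei|apply Cderive_const]. }
  eapply Cderive_eq.
  + apply (Cderive_mult _ _ _ _ _ HD (Cderive_mult _ _ _ _ _ HD He)).
  + cbv beta. fold a. ring.
Qed.

Lemma exists_preimage_list {T : Type} (f : T -> C) (l : list C) : NoDup l ->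
  (forall w, In w l -> exists k, f k = w) -> exists kl, NoDup kl /\ map f kl = l.
Proof.
intros Hnd H.
assert (E : exists kl, map f kl = l).
{ clear Hnd. induction l as [|w l IH].
  - exists nil. reflexivity.
  - destruct IH as [kl E]; [intros v Hv; apply H; right; exact Hv|].
    destruct (H w (or_introl eq_refl)) as [k Ek]. exists (k :: kl). simpl. congruence. }
destruct E as [kl E]. exists kl. split; [|exact E].
apply (NoDup_map_inv f). rewrite E. exact Hnd.
Qed.

(** Keeps the poles of neighbouring periods away from the ends of the interval, so that their
    excised neighbourhoods do not reach into it. *)
Lemma circ_avoids_near (l : list C) (a : R) : ~ In (circ a) l ->
  exists e, (0 < e)%R /\ forall s, (Rabs (s - a) < e)%R -> ~ In (circ s) l.
Proof.
intros Ha. pose proof (proj1 (Cmod_gt_0 _) (Cprod_neq_0 l _ Ha)) as Hm.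
assert (Hc : Rcont (fun t => Cprod l (circ t)) a).
{ apply (Rcont_comp (Cprod l) circ); [apply Rcont_circ|apply Cex_Ccont, Cex_Cprod]. }
destruct (proj1 (Rcont_eps _ _) Hc _ Hm) as [e [He H]].
exists e. split; [exact He|]. intros s Hs Hin. specialize (H s Hs). cbv beta in H.
rewrite (Cprod_root l (circ s) Hin) in H.
replace (0 - Cprod l (circ a)) with (- Cprod l (circ a)) in H by ring. rewrite Cmod_opp in H. lra.
Qed.

(** [excise] truncates at all real poles, including those of other periods. For small eps only the
    poles inside the period matter, and the truncation becomes an [excise_list], which distributes
    over the summands. *)
Lemma PV_period_of_decomposition (F c : C -> C) (u : R -> C) (l : list C) (J : C) :
  (forall w, In w l -> w <> 0 /\ (Cmod w <= 1)%R) ->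
  (forall s : R, is_pole F (RtoC s) <-> In (circ s) l) ->
  (forall t, Rcont u t) -> (forall a, Cint u a (a + 2 * PI) J) ->
  (forall t : R, ~ In (circ t) l -> F (RtoC t) = u t + circ t * polar_sum c (nodup eqC_dec l) (circ t)) ->
  is_PV_period F (J + RtoC (2 * PI) *
    Clist_sum (fun w => RtoC (Theta (- ln (Cmod w))) * c w) (nodup eqC_dec l)).
Proof.
intros Hl Hpole Hu HJ HF a Ha. pose proof PI_RGT_0.
assert (Ha' : ~ In (circ a) l) by (rewrite <- Hpole; exact Ha).
destruct (circ_preimages a l Ha') as [L HL].
destruct (circ_avoids_near l a Ha') as [e [He Hnear]].
apply int_limit_PV.
apply (int_limit_ext (fun eps t => excise_list L eps t (u t) +
   excise_list L eps t (circ t * polar_sum c (nodup eqC_dec l) (circ t))) _ _ _ _ e); [lra|exact He| |].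
- intros eps t Heps Ht. rewrite <- excise_list_plus. unfold excise_list, excise.
  destruct (excluded_middle_informative _) as [[s [Hs Hse]]|Hno];
    destruct (excluded_middle_informative _) as [[s' [Hs' Hse']]|Hno']; try reflexivity.
  + exfalso. apply Hno'. exists s. split; [|exact Hse]. apply Hpole. apply HL, Hs.
  (* A pole outside the period within eps of t would lie within e of a or of a + 2 PI; the latter
     case is moved to a by periodicity. *)
  + exfalso. apply Hno. exists s'. split; [|exact Hse']. apply HL. apply Hpole in Hs'.
    split; [|exact Hs']. apply Rabs_def2 in Hse'. split.
    * apply Rnot_le_lt. intros K. apply (Hnear s'); [|exact Hs']. apply Rabs_def1; lra.
    * apply Rnot_le_lt. intros K. apply (Hnear (s' - 2 * PI)%R).
      -- apply Rabs_def1; lra.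
      -- rewrite <- circ_2PI. replace (s' - 2 * PI + 2 * PI)%R with s' by ring. exact Hs'.
  + symmetry. apply HF. intros K. apply Hno. exists t. split; [apply HL; split; [lra|exact K]|].
    rewrite Rminus_diag, Rabs_R0. lra.
- assert (HLb : forall s, In s L -> (a < s < a + 2 * PI)%R) by (intros s Hs; apply HL, Hs).
  apply int_limit_plus.
  + apply regular_int_limit; auto.
  + apply polar_sum_int_limit; [exact HLb|].
    intros w Hw. apply nodup_In in Hw. destruct (Hl w Hw) as [H0 H1].
    split; [exact H0|split; [exact H1|]]. intros E.
    destruct (circ_arg a w E) as [s [Hs Es]]; [intros K; apply Ha'; rewrite <- K; exact Hw|].
    exists s. split; [|exact Es]. apply HL. rewrite Es. split; assumption.
Qed.

(** * Evaluation and comparison of the two sides of the formula *)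

Theorem theorem2p1
  (g : C -> C) (Hg : entire g) (Hg0 : g 0 <> 0)
  (K : Type) (zeta : K -> C)
  (Hinj : forall j k : K, zeta j = zeta k -> j = k)
  (Hzeros : forall z : C, g z = 0 <-> exists k : K, zeta k = z)
  (n : nat) (x : C) (Hx : x <> 0)
  (Hsimple : forall k : K, Im (theta_pt x (zeta k)) = 0%R ->
     is_simple_zero (fun theta : C => g (Cexp (Ci * theta) / x))
       (theta_pt x (zeta k))) :
  exists I S : C,
    is_PV_period (integrand g n x) I /\
    is_finite_support_sum K
      (fun k : K =>
         RtoC (Theta (Im (theta_pt x (zeta k)))) *
         Residue (integrand g n x) (theta_pt x (zeta k))) S /\
    rescaled_appell g n x / RtoC (INR (fact n)) =
      x ^ n / RtoC (2 * PI) * (I - RtoC (2 * PI) * Ci * S).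
Proof.
set (G := fun w => g (w / x)).
assert (HG : forall w, Cex G w).
{ intros w. apply (Cex_comp (fun w => w / x) g); [|apply Hg]. cex. exact Hx. }
assert (HG0 : G 0 <> 0) by (unfold G; replace (0 / x) with (RtoC 0) by (field; exact Hx); exact Hg0).
destruct (unit_disc_factorization G HG HG0) as [l [Q [R0 [HR0 [Hl [HQ [HQ0 EG]]]]]]].
set (D := fun w => (Cmod w < R0)%R).
assert (HD : open_C D).
{ intros c Hc. exists (R0 - Cmod c)%R. split; [unfold D in Hc; lra|]. intros w Hw. unfold D.
  pose proof (Cmod_triangle (w - c) c) as T. replace (w - c + c) with w in T by ring. lra. }
set (E := fun w => Cexp (RtoC (INR n) * w)).
assert (HE : forall w, Cex E w) by (intros w; unfold E; cex).
(* The factor Q has no zero in the disc D and joins the numerator, so the denominator left is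
   exactly the product over the listed roots. *)
destruct (partial_fractions D n l HD (fun w => E w / Q w)) as [B [c [V [V' [HB [HV HEq]]]]]].
{ intros w Hw. apply Cex_div; [apply HQ0, Hw|apply HE|apply HQ]. }
{ intros a Ha. destruct (Hl a Ha) as [H1 H2]. split; [unfold D; lra|exact H2]. }
set (l' := nodup eqC_dec l) in *.
set (F := integrand g n x).
assert (EF : forall theta, F theta = (/ ei theta) ^ n * E (ei theta) / G (ei theta)).
{ intros theta. unfold F, integrand. fold (ei theta). unfold G, E. f_equal.
  replace (RtoC (INR n) * (ei theta - Ci * theta))
    with (RtoC (INR n) * - (Ci * theta) + RtoC (INR n) * ei theta) by ring.
  rewrite Cexp_plus, Cexp_nat, Cexp_opp. reflexivity. }
assert (Hdec : forall theta, D (ei theta) -> ~ In (ei theta) l ->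
  F theta = (/ ei theta) ^ n * B (ei theta) + ei theta * (polar_sum c l' (ei theta) + V' (ei theta))).
{ intros theta H1 H2. pose proof (HEq _ H1 H2) as H3. rewrite EF, EG.
  assert (HP := Cprod_neq_0 l _ H2). assert (HQn := HQ0 _ H1). assert (He := ei_neq_0 theta).
  replace ((/ ei theta) ^ n * E (ei theta) / (Cprod l (ei theta) * Q (ei theta)))
    with ((/ ei theta) ^ n * (E (ei theta) / Q (ei theta) / Cprod l (ei theta))) by (field; auto).
  rewrite H3, Cpow_inv, Cpow_S by exact He. field. apply Cpow_nz, He. }
assert (Hroot : forall w, D w -> (In w l <-> exists k, x * zeta k = w)).
{ intros w Hw. split.
  - intros Hin. assert (Hz : G w = 0) by (rewrite EG, Cprod_root by exact Hin; ring).
    apply Hzeros in Hz. destruct Hz as [k Hk]. exists k. rewrite Hk. field. exact Hx.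
  - intros [k Hk]. destruct (in_dec eqC_dec w l) as [Hin|Hin]; [exact Hin|exfalso].
    assert (Hz : G w = 0).
    { apply Hzeros. exists k. rewrite <- Hk. field. exact Hx. }
    rewrite EG in Hz. revert Hz. apply Cmult_neq_0; [apply Cprod_neq_0, Hin|apply HQ0, Hw]. }
assert (HxK : forall k, x * zeta k <> 0).
{ intros k. apply Cmult_neq_0; [exact Hx|]. intros Hk. apply Hg0. apply Hzeros. exists k. exact Hk. }
(* A root on the unit circle is some x zeta_k with Im theta_k = 0, where the simplicity assumption
   applies. *)
assert (Hcount : forall w, Cmod w = 1%R -> (count_occ eqC_dec l w <= 1)%nat).
{ intros w Hw. destruct (in_dec eqC_dec w l) as [Hin|Hin].
  2:{ apply (count_occ_not_In eqC_dec) in Hin. lia. }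
  destruct (proj1 (Hroot w ltac:(unfold D; lra)) Hin) as [k Hk].
  rewrite <- Hk, <- ei_theta_pt by apply HxK.
  apply (simple_zero_count l Q); [exact HQ|].
  assert (Hs := Hsimple k). rewrite Im_theta_pt, Hk, Hw, ln_1, Ropp_0 in Hs.
  destruct (Hs eq_refl) as [Hz [d [Hd Hd0]]].
  split; [rewrite <- EG; exact Hz|]. exists d. split; [|exact Hd0].
  eapply (is_derive_ext (K := C_AbsRing) (V := C_NormedModule)); [|exact Hd].
  intros theta. apply (EG (ei theta)). }
(* This local form serves twice: on the real axis it shows that every root gives a genuine pole, and
   at each theta_k it provides the Laurent expansion. *)
assert (Hfac : forall theta0, D (ei theta0) -> exists (h : C -> C) (m : nat) (r : R), (0 < r)%R /\
  (forall z, (Cmod (z - theta0) < r)%R -> Cex h z /\ D (ei z)) /\ h theta0 <> 0 /\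
  (forall z, (0 < Cmod (z - theta0) < r)%R -> F z = h z / (z - theta0) ^ m /\ ~ In (ei z) l) /\
  (In (ei theta0) l -> m <> O)).
{ intros theta0 H0. destruct (ei_pullback_factor l theta0) as [m [U [HU [HU0 EU]]]].
  assert (HN : Cex (fun z => U z * Q (ei z)) theta0) by (apply Cex_mult; [apply HU|apply Cex_comp_ei, HQ]).
  destruct (Ccont_nonzero_near _ theta0 (Cex_Ccont _ _ HN)) as [r1 [Hr1 H1]].
  { apply Cmult_neq_0; [exact HU0|apply HQ0, H0]. }
  destruct (HD _ H0) as [r2 [Hr2 H2]].
  destruct (proj1 (Ccont_eps _ _) (Cex_Ccont _ _ (Cex_ei theta0)) r2 Hr2) as [r3 [Hr3 H3]].
  pose proof (Rmin_l r1 r3). pose proof (Rmin_r r1 r3).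
  exists (fun z => (/ ei z) ^ n * E (ei z) / (U z * Q (ei z))), m, (Rmin r1 r3).
  split; [apply Rmin_glb_lt; assumption|].
  assert (HDz : forall z, (Cmod (z - theta0) < Rmin r1 r3)%R -> D (ei z)).
  { intros z Hz. apply H2, H3. lra. }
  split; [|split; [|split]].
  - intros z Hz. split; [|apply HDz, Hz].
    apply Cex_div; [apply H1; lra| |apply Cex_mult; [apply HU|apply Cex_comp_ei, HQ]].
    apply Cex_mult; [|apply Cex_comp_ei, HE]. apply Cex_pow. apply Cex_inv; [apply ei_neq_0|apply Cex_ei].
  - assert (Hth : U theta0 * Q (ei theta0) <> 0) by (apply Cmult_neq_0; [exact HU0|apply HQ0, H0]).
    unfold Cdiv. apply Cmult_neq_0.
    + apply Cmult_neq_0; [|apply Cexp_neq_0]. apply Cpow_nz. intros K0.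
      pose proof (Cinv_r _ (ei_neq_0 theta0)) as Ki. rewrite K0 in Ki.
      apply (f_equal fst) in Ki. simpl in Ki. lra.
    + intros K0. pose proof (Cinv_r _ Hth) as Ki. rewrite K0 in Ki.
      apply (f_equal fst) in Ki. simpl in Ki. lra.
  - intros z Hz. assert (Hz0 : z - theta0 <> 0) by (apply Cmod_gt_0; lra).
    assert (HUQ := H1 z ltac:(lra)). cbv beta in HUQ.
    assert (HUz : U z <> 0) by (intros K0; apply HUQ; rewrite K0; ring).
    assert (HQz : Q (ei z) <> 0) by (intros K0; apply HUQ; rewrite K0; ring).
    assert (Hpz := Cpow_nz _ m Hz0). split.
    + rewrite EF, EG, EU. field. auto.
    + intros Hin. apply Cprod_root in Hin. rewrite EU in Hin. revert Hin.
      apply Cmult_neq_0; assumption.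
  - intros Hin ->. apply Cprod_root in Hin. rewrite EU in Hin. apply HU0.
    simpl in Hin. rewrite Cmult_1_l in Hin. exact Hin. }
assert (Hei : forall t : R, ei (RtoC t) = circ t) by reflexivity.
assert (Hcirc : forall t, D (circ t)) by (intros t; unfold D; rewrite Cmod_circ; exact HR0).
assert (Hpole : forall s : R, is_pole F (RtoC s) <-> In (circ s) l).
{ intros s. split.
  - intros Hp. destruct (in_dec eqC_dec (circ s) l) as [Hin|Hin]; [exact Hin|exfalso].
    revert Hp. apply Ccont_not_pole, Cex_Ccont.
    apply (Cex_near (fun theta => (/ ei theta) ^ n * E (ei theta) / G (ei theta)) F _ 1 Rlt_0_1).
    + intros w _. symmetry. apply EF.
    + apply Cex_div; [|apply Cex_mult; [|apply Cex_comp_ei, HE]|apply Cex_comp_ei, HG].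
      * rewrite EG. apply Cmult_neq_0; [apply Cprod_neq_0, Hin|apply HQ0, Hcirc].
      * apply Cex_pow. apply Cex_inv; [apply ei_neq_0|apply Cex_ei].
  - intros Hin. destruct (Hfac (RtoC s) (Hcirc s)) as [h [m [r [Hr [H1 [H2 [H3 H4]]]]]]].
    destruct m as [|m]; [exfalso; exact (H4 Hin eq_refl)|].
    apply (pole_of_factor F h (RtoC s) m r Hr); [|exact H2|intros z Hz; apply H3, Hz].
    apply Cex_Ccont, H1. replace (RtoC s - RtoC s) with (RtoC 0) by ring. rewrite Cmod_0. exact Hr. }
assert (HVc : forall t, Cderive V (circ t) (V' (circ t)) /\ Cex V' (circ t)).
{ intros t. apply HV, Hcount, Cmod_circ. }
set (Sig := Clist_sum (fun w => RtoC (Theta (- ln (Cmod w))) * c w) l').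
set (b := taylor_coef B n).
(* Multiplied by -2 pi i, the residue sum -i [Sig] gives -2 pi [Sig], which cancels the polar part
   of the principal value and leaves 2 pi b. *)
exists (RtoC (2 * PI) * b + RtoC (2 * PI) * Sig), (- Ci * Sig).
split; [|split].
- apply (PV_period_of_decomposition F c (fun t => B (circ t) * (/ circ t) ^ n + circ t * V' (circ t))).
  + intros w Hw. destruct (Hl w Hw). auto.
  + exact Hpole.
  + intros t. apply Rcont_plus; apply Rcont_mult.
    * apply (Rcont_comp B circ); [apply Rcont_circ|apply Cex_Ccont, HB, Hcirc].
    * apply Rcont_pow, Rcont_inv; [apply circ_neq_0|apply Rcont_circ].
    * apply Rcont_circ.
    * apply (Rcont_comp V' circ); [apply Rcont_circ|apply Cex_Ccont, HVc].
  + intros a. eapply Cint_eq; [apply Cint_plus; [apply (taylor_coef_unit_circle B R0 a n HR0 HB)|]|fold b; apply Cplus_0_r].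
    eapply Cint_ext_all; [|apply (Cint_circle_derive V V' 0 1 a)].
    * intros t. cbv beta. replace (0 + RtoC 1 * circ t) with (circ t) by ring. ring.
    * intros t. replace (0 + RtoC 1 * circ t) with (circ t) by ring. apply HVc.
    * intros t. replace (0 + RtoC 1 * circ t) with (circ t) by ring. apply Cex_Ccont, HVc.
  + intros t Ht. rewrite (Hdec (RtoC t)); [rewrite !Hei; unfold l'; ring|apply Hcirc|exact Ht].
- destruct (exists_preimage_list (fun k => x * zeta k) l') as [kl [Hnd Hkl]].
  { apply NoDup_nodup. }
  { intros w Hw. apply nodup_In in Hw. apply Hroot; [|exact Hw]. unfold D. destruct (Hl w Hw). lra. }
  exists kl. split; [exact Hnd|split].
  + intros k Hk.
    (* A nonzero term forces [Theta] to be nonzero, hence |x zeta_k| <= 1, and such a point is one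
       of the listed roots. *)
    assert (Hle : (Cmod (x * zeta k) <= 1)%R).
    { apply Rnot_lt_le. intros Hlt. apply Hk. rewrite Im_theta_pt.
      assert (Hln : (0 < ln (Cmod (x * zeta k)))%R) by (rewrite <- ln_1; apply ln_increasing; lra).
      unfold Theta. destruct (Rlt_dec 0 _) as [K1|_]; [lra|].
      destruct (Req_EM_T _ 0) as [K1|_]; [lra|]. ring. }
    assert (Hin : In (x * zeta k) l') by (apply nodup_In, Hroot; [unfold D; lra|exists k; reflexivity]).
    rewrite <- Hkl in Hin. apply in_map_iff in Hin. destruct Hin as [k' [Ek Hk']].
    replace k with k'; [exact Hk'|]. apply Hinj.
    replace (zeta k') with (/ x * (x * zeta k')) by (field; exact Hx). rewrite Ek. field. exact Hx.
  + unfold Sig. rewrite <- Hkl.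
    assert (Hk : forall k, In k kl -> Residue F (theta_pt x (zeta k)) = - Ci * c (x * zeta k)).
    { intros k Hk. assert (Ek := ei_theta_pt x (zeta k) (HxK k)).
      assert (Hin : In (x * zeta k) l) by (apply (nodup_In eqC_dec); fold l'; rewrite <- Hkl; apply (in_map (fun k => x * zeta k)), Hk).
      rewrite <- Ek in *. set (theta0 := theta_pt x (zeta k)) in *.
      destruct (Hfac theta0) as [h [m [r [Hr [H1 [_ [H3 _]]]]]]].
      { unfold D. destruct (Hl _ Hin). lra. }
      apply (residue_of_decomposition F h (fun z => (/ ei z) ^ n * B (ei z)) V V' c l' theta0 m r Hr).
      - apply NoDup_nodup.
      - apply nodup_In, Hin.
      - intros z Hz. apply H1, Hz.
      - intros z Hz. apply H3, Hz.
      - intros z Hz. apply Cex_mult; [|apply Cex_comp_ei, HB, H1, Hz].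
        apply Cex_pow. apply Cex_inv; [apply ei_neq_0|apply Cex_ei].
      (* The decomposition is used on the punctured disc only, where [ei z] is no root. A multiple
         root at the centre inside the unit disc is therefore allowed. *)
      - intros z Hz. destruct (H3 z Hz) as [_ Hnin].
        assert (Hc : (count_occ eqC_dec l (ei z) <= 1)%nat).
        { apply (count_occ_not_In eqC_dec) in Hnin. lia. }
        destruct (HV _ Hc) as [HV1 HV2].
        split; [intros K0; apply nodup_In in K0; contradiction|].
        split; [exact HV1|split; [exact HV2|]]. apply Hdec; [apply H1, Hz|exact Hnin]. }
    clear Hnd Hkl. induction kl as [|k kl IH]; cbn [map fold_right Clist_sum]; [ring|].
    rewrite <- IH by (intros k' Hk'; apply Hk; right; exact Hk').
    rewrite (Hk k (or_introl eq_refl)), Im_theta_pt. ring.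
- assert (Hnear : exists r, (0 < r)%R /\ (r <= 1)%R /\ forall w, (Cmod w < r)%R -> G w <> 0).
  { destruct (Ccont_nonzero_near G 0 (Cex_Ccont _ _ (HG 0)) HG0) as [r [Hr H]].
    exists (Rmin r 1). pose proof (Rmin_l r 1). pose proof (Rmin_r r 1).
    split; [apply Rmin_glb_lt; lra|split; [lra|]]. intros w Hw. apply H.
    replace (w - 0) with w by ring. lra. }
  destruct Hnear as [r [Hr [Hr1 Hnz]]].
  assert (Hnl : forall w, (Cmod w < r)%R -> ~ In w l).
  { intros w Hw Hin. apply (Hnz w Hw). rewrite EG, Cprod_root by exact Hin. ring. }
  assert (HEG : forall w, (Cmod w < r)%R -> Cex (fun w => E w / G w) w).
  { intros w Hw. apply Cex_div; [apply Hnz, Hw|apply HE|apply HG]. }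
  assert (ET : taylor_coef (fun w => E w / G w) n = b).
  { apply (taylor_coef_remainder _ B (fun w => polar_sum c l' w + V' w) r n Hr).
    intros w Hw. assert (HwD : D w) by (unfold D; lra). pose proof (Hnl w Hw) as Hwl.
    split; [apply HEG, Hw|split; [apply HB, HwD|split]].
    - apply Cex_plus.
      + apply Cex_polar_sum. intros K0. apply nodup_In in K0. contradiction.
      + apply HV. apply (count_occ_not_In eqC_dec) in Hwl. lia.
    - rewrite <- (HEq w HwD Hwl), EG. field. split; [apply HQ0, HwD|apply Cprod_neq_0, Hwl]. }
  (* The substitution w = x z turns e^(z n x) / g(z) into E(w) / G(w); it is the origin of the
     factor x^n. *)
  assert (EA : taylor_coef (fun z => Cexp (z * (RtoC (INR n) * x)) / g z) n = x ^ n * b).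
  { rewrite <- ET, <- (taylor_coef_rescale (fun w => E w / G w) x r n Hr HEG). f_equal.
    apply functional_extensionality. intros z. unfold E, G.
    f_equal; [f_equal; ring|f_equal]. f_equal. field. exact Hx. }
  unfold rescaled_appell, appell. rewrite EA.
  assert (Hf : RtoC (INR (fact n)) <> 0) by (intros K0; apply RtoC_inj in K0; revert K0; apply INR_fact_neq_0).
  replace (RtoC (2 * PI) * b + RtoC (2 * PI) * Sig - RtoC (2 * PI) * Ci * (- Ci * Sig))
    with (RtoC (2 * PI) * b + RtoC (2 * PI) * Sig + RtoC (2 * PI) * (Ci * Ci) * Sig) by ring.
  rewrite Ci_sqr. field. split; [exact two_PI_neq_0|exact Hf].
Qed.
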